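(* Let $\mathbb{K}$, $\mathcal{P}$, ${\rm mult}(\mathscr{B}(\mathcal{P}))$ and $K_1^L,K_2^L$ be as in the context. There exists a non-empty Zariski open subset $\Omega$ of $\mathscr{G}(\mathbb{P}^3(\mathbb{K}))^*$ such that for every $L\in\Omega$, $${\rm mult}(\mathscr{B}(\mathcal{P}))=\deg_{\overline t}\Big({\rm Content}_{\overline x}\big({\rm Res}_{t_3}(K_1^L,K_2^L)\big)\Big).$$
   Context: $\mathbb{K}$ is an algebraically closed field of characteristic zero. $\mathcal{P}=(p_1:\cdots:p_4):\mathbb{P}^2(\mathbb{K})\dashrightarrow\mathbb{P}^3(\mathbb{K})$ is a rational parametrization of a surface, with $p_i\in\mathbb{K}[t_1,t_2,t_3]$ homogeneous of the same degree, $\gcd(p_1,\dots,p_4)=1$, $p_4\ne0$ and $p_i(0,0,1)\neq0$ for all $i$. $\mathscr{B}(\mathcal{P})$ is the set of common zeros of the $p_i$ in $\mathbb{P}^2(\mathbb{K})$. With indeterminates $\overline x=(x_1,\dots,x_4)$, $\overline y=(y_1,\dots,y_4)$ and $\mathbb{F}$ the algebraic closure of $\mathbb{K}(\overline x,\overline y)$, set $W_1=\sum x_ip_i$, $W_2=\sum y_ip_i$ and ${\rm mult}(\mathscr{B}(\mathcal{P}))=\sum_{A\in\mathscr{B}(\mathcal{P})}{\rm mult}_A(\mathscr{C}(W_1),\mathscr{C}(W_2))$ (intersection multiplicities of the plane curves in $\mathbb{P}^2(\mathbb{F})$). $\mathscr{G}(\mathbb{P}^3(\mathbb{K}))^*$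 is the set of projective transformations of $\mathbb{P}^3(\mathbb{K})$ with matrix $\begin{pmatrix}M&0\\0&1\end{pmatrix}$, $M\in GL_3(\mathbb{K})$, i.e. $L=(L_1:L_2:L_3:L_4)$ with $L_4(u)=u_4$ and $L_1,L_2,L_3$ linear forms in $u_1,u_2,u_3$; it is viewed as a variety via the entries of $M$. For such $L$, with $L_i(\mathcal{P})=L_i(p_1,\dots,p_4)$, set $K_1^L=x_4L_1(\mathcal{P})-x_1L_4(\mathcal{P})$ and $K_2^L=x_4L_3(\mathcal{P})-x_3L_4(\mathcal{P})$. ${\rm Res}_{t_3}$ is the resultant with respect to $t_3$; ${\rm Content}_{\overline x}(R)$ of $R\in\mathbb{K}[\overline x,t_1,t_2]$ is the gcd in $\mathbb{K}[t_1,t_2]$ of its coefficients as a polynomial in $\overline x$ (up to a nonzero constant); $\deg_{\overline t}$ is the degree in $t_1,t_2$. *)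

(* Defs.v *)
From HB Require Import structures.
From mathcomp Require Import all_boot all_order all_algebra.
From mathcomp Require Import mpoly.
Set Implicit Arguments. Unset Strict Implicit. Unset Printing Implicit Defensive.
Import Order.TTheory GRing.Theory Num.Theory.
Local Open Scope ring_scope.

Definition mdvd (n : nat) (R : comNzRingType) (a b : {mpoly R[n]}) : Prop :=
  exists q : {mpoly R[n]}, b = q * a.

Definition mpoly_coprime4 (K : fieldType) (p : 'I_4 -> {mpoly K[3]}) : Prop :=
  forall D : {mpoly K[3]}, (forall i, mdvd D (p i)) -> exists c : K, D = c%:MP.

Definition e3 (K : nzRingType) : 'I_3 -> K := fun i => (i == 2%N :> nat)%:R.

(* ---------- Zariski open subsets of G(P^3)^* ~ GL_3(K) ------------- *)
Definition mx_coords (K : nzRingType) (M : 'M[K]_3) : 'I_(3 * 3) -> K :=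
  fun i => mxvec M 0 i.

Definition zariski_open_GL3 (K : fieldType) (Omega : 'M[K]_3 -> Prop) : Prop :=
  (forall M, Omega M -> M \in unitmx) /\
  exists S : seq {mpoly K[3 * 3]},
    forall M, M \in unitmx ->
      (Omega M <-> exists2 h, h \in S & h.@[mx_coords M] != 0).

Section IntMult.
Variable F : fieldType.

Definition chart (A : 'I_3 -> F) : 'I_3 := odflt ord0 [pick k | A k != 0].

(* s lies in the ideal (f,g) of the local ring O_A of P^2 at A, computed in
   the affine chart {t_k = A_k} (k = chart A), i.e. in the local ring at A
   of F[t1,t2,t3]/(t_k - A_k) *)
Definition in_local_ideal (f g : {mpoly F[3]}) (A : 'I_3 -> F)
    (s : {mpoly F[3]}) : Prop :=
  exists u a b r : {mpoly F[3]},
    u.@[A] != 0 /\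
    u * s = a * f + b * g + ('X_(chart A) - (A (chart A))%:MP) * r.

Definition loc_indep (f g : {mpoly F[3]}) (A : 'I_3 -> F)
    (h : seq {mpoly F[3]}) : Prop :=
  forall c : seq F, size c = size h ->
    in_local_ideal f g A (\sum_(i < size h) c`_i *: h`_i) ->
    forall i, c`_i = 0.

(* mult_A(C(f),C(g)) = m, i.e. dim_F O_A/(f,g) = m *)
Definition int_mult (f g : {mpoly F[3]}) (A : 'I_3 -> F) (m : nat) : Prop :=
  (exists h, size h = m /\ loc_indep f g A h) /\
  (forall h, loc_indep f g A h -> (size h <= m)%N).
End IntMult.

Section Data.
Variables (K : fieldType) (F : fieldType).
(* K[x,y] : variables x_1..x_4 = 'X_(lshift 4 i), y_1..y_4 = 'X_(rshift 4 i) *)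
Variable iota : {rmorphism {mpoly K[4 + 4]} -> F}.
Variable p : 'I_4 -> {mpoly K[3]}.

Definition kF (c : K) : F := iota c%:MP.

Definition W1 : {mpoly F[3]} :=
  \sum_(i < 4) iota 'X_(lshift 4 i) *: map_mpoly kF (p i).
Definition W2 : {mpoly F[3]} :=
  \sum_(i < 4) iota 'X_(rshift 4 i) *: map_mpoly kF (p i).

Definition proportional (A B : 'I_3 -> K) : Prop :=
  exists2 l : K, l != 0 & forall j, B j = l * A j.

Definition base_point (A : 'I_3 -> K) : Prop :=
  (exists j, A j != 0) /\ forall i, (p i).@[A] = 0.

(* mult(B(P)) = m : s is a set of representatives of the base points
   (one per point of P^2(K)), and m is the sum of the intersection
   multiplicities of C(W1), C(W2) at these points, seen in P^2(F) *)
Definition mult_base (m : nat) : Prop :=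
  exists s : seq ('I_3 -> K),
    (forall i, (i < size s)%N -> base_point (nth (fun=> 0) s i)) /\
    (forall i j, (i < size s)%N -> (j < size s)%N -> i != j ->
        ~ proportional (nth (fun=> 0) s i) (nth (fun=> 0) s j)) /\
    (forall B, base_point B ->
        exists2 i, (i < size s)%N & proportional (nth (fun=> 0) s i) B) /\
    exists ms : seq nat, size ms = size s /\
      (forall i, (i < size s)%N ->
         int_mult W1 W2 (fun j => kF (nth (fun=> 0) s i j)) (nth 0%N ms i)) /\
      m = sumn ms.
End Data.

Section Resultant.
Variable K : fieldType.
(* Tt := K[t1,t2] ; Bx := K[t1,t2][x1..x4] ; K[x,t1,t2,t3] = {poly Bx} in t3 *)
Local Notation Tt := {mpoly K[2]}.
Local Notation Bx := {mpoly Tt[4]}.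

Definition toBxt3 (q : {mpoly K[3]}) : {poly Bx} :=
  mmap (fun c : K => ((c%:MP : Tt)%:MP : Bx)%:P)
       (fun j : 'I_3 =>
          if j == 0%N :> nat then ((('X_ord0 : Tt)%:MP : Bx)%:P)
          else if j == 1%N :> nat then ((('X_(inord 1) : Tt)%:MP : Bx)%:P)
          else 'X) q.

Definition xv (i : 'I_4) : {poly Bx} := ('X_i : Bx)%:P.
Definition kc (c : K) : {poly Bx} := ((c%:MP : Tt)%:MP : Bx)%:P.

Variable p : 'I_4 -> {mpoly K[3]}.
Variable M : 'M[K]_3.

Definition LP (j : 'I_3) : {poly Bx} :=
  \sum_(l < 3) kc (M j l) * toBxt3 (p (widen_ord (leqnSn 3) l)).
Definition L4P : {poly Bx} := toBxt3 (p ord_max).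

Definition K1L : {poly Bx} := xv ord_max * LP 0 - xv 0 * L4P.
Definition K2L : {poly Bx} := xv ord_max * LP (inord 2) - xv (inord 2) * L4P.

Definition ResL : Bx := resultant K1L K2L.
End Resultant.

Definition is_content_x (K : fieldType) (R : {mpoly {mpoly K[2]}[4]})
    (C : {mpoly K[2]}) : Prop :=
  (forall m, mdvd C R@_m) /\
  (forall D : {mpoly K[2]}, (forall m, mdvd D R@_m) -> mdvd D C).

Definition deg_t (K : fieldType) (C : {mpoly K[2]}) : nat := (msize C).-1.

(* Main.v *)
(* Both sides are sums, over the finitely many lines through [(0 : 0 : 1)] that carry a base point, of
   orders of vanishing.  No [p_i] vanishes at [(0 : 0 : 1)], so after substituting a pencil parameter
   [s] for the direction of a line, all forms have unit leading coefficient in [t_3].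
   - For two such polynomials [f, g] in [F[s][t_3]], the order at [s = 0] of their resultant is the
     colength of [(f, g)] localized at the fibre [s = 0], hence the sum of the local intersection
     multiplicities along the line.  By genericity of [x, y], the common points of [W_1] and [W_2]
     on a line defined over [K] are exactly the base points.
   - The universal resultant [U] of [sum_i x_i p_i] and [sum_i y_i p_i] factors on each line as
     [s^e U'] with [U'] nonzero at [s = 0].  [Res(K_1^L, K_2^L)] is a specialization of [U]; if it
     does not kill [U'] at [s = 0], which is an open condition on [M], it has the same order [e].
   - On a line without base points the resultant must not vanish identically in [x].  It could
     only do so at a point where [p_4] vanishes and [v = (p_1, p_2, p_3)], nonzero, is killed by rows
     1 and 3 of [M], that is, is proportional to their cross product.  These [v] sweep out a curve, which
     satisfies a nontrivial homogeneous relation, so this does not happen for generic [M].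
   The coefficients of the resultant being binary forms of one degree, the content is then the
   product of the linear forms of the lines to the powers [e]. *)
Require Import Defs.
From HB Require Import structures.
From mathcomp Require Import all_boot all_order all_algebra all_field.
From mathcomp Require Import mpoly.
From mathcomp Require Import perm ring zify.
Set Implicit Arguments. Unset Strict Implicit. Unset Printing Implicit Defensive.
Import Order.TTheory GRing.Theory Num.Theory.
Local Open Scope ring_scope.

(** The lines that carry a base point are finitely many, so each may impose its own open condition
    on [M]. The other lines form an infinite family and must be handled by one polynomial in [M];
    hence a relation valid along the whole affine curve [p_4 = 0] is built, by counting dimensions.
    The exponent [e] of a line is read off in [K[s][x, y]], before [M] or [F] enters: pushing the
    universal resultant forward along the injective [iota] gives the multiplicities, specializing it
    to rows 1 and 3 of [M] gives the content. Genericity survives the second specialization because,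
    with [x_4 = 1], the six entries of these rows and [x_1], [x_3] fill all eight coordinates
    independently. Maximality of the content is proved without factoring: the cofactors have no
    common zero on the projective line, so a Bezout relation on the affine part and a reduction at
    the remaining point show that any common divisor divides the candidate times a power of each of
    the two variables. *)

(** * Nonvanishing points and evaluation of forms *)

Lemma mpoly_rmorph_eq (n : nat) (R : nzRingType) (S : nzRingType)
    (f g : {rmorphism {mpoly R[n]} -> S}) :
  (forall c, f c%:MP = g c%:MP) -> (forall i, f 'X_i = g 'X_i) -> f =1 g.
Proof.
move=> hC hX p; elim/mpolyind: p => [|c m p _ _ IH]; first by rewrite !rmorph0.
rewrite !rmorphD /= IH -mul_mpolyC !rmorphM /= hC; congr (_ * _ + _).
by rewrite mpolyXE_id !rmorph_prod; apply: eq_bigr => i _; rewrite !rmorphXn /= hX.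
Qed.

Lemma pchar0_natr_inj (K : fieldType) : [pchar K] =i pred0 ->
  injective (fun n : nat => n%:R : K).
Proof.
move=> char0; have h m n : (m <= n)%N -> m%:R = n%:R :> K -> m = n.
  move=> lemn /eqP; rewrite eq_sym -subr_eq0 -natrB //.
  by rewrite ((pcharf0P K).1 char0) subn_eq0 => lenm; apply/eqP; rewrite eqn_leq lemn.
move=> m n /= e; case/orP: (leq_total m n) => l; [exact: h | by apply/esym/h].
Qed.

Lemma poly_nonroot (K : fieldType) (q : {poly K}) : [pchar K] =i pred0 ->
  q != 0 -> exists x, q.[x] != 0.
Proof.
move=> char0 q0; pose rs := [seq n%:R | n <- iota 0 (size q)] : seq K.
have [/allP h|/allPn[x _ hx]] := boolP (all (root q) rs); last by exists x.
have := max_poly_roots q0 (introT allP h).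
by rewrite map_inj_uniq ?iota_uniq ?size_map ?size_iota ?ltnn; [move/(_ isT)|apply: pchar0_natr_inj].
Qed.

(** Induction on the number of variables. [U] reads [q] as a polynomial in its last variable and has
    the left inverse [B], so [U q] is nonzero; values [v] that keep its leading coefficient reduce
    the claim to one variable. *)
Lemma mpoly_nonroot (K : fieldType) (n : nat) (q : {mpoly K[n]}) : [pchar K] =i pred0 ->
  q != 0 -> exists v, q.@[v] != 0.
Proof.
move=> char0; elim: n q => [|n IH] q q0.
  exists (fun=> 0); rewrite (nvar0_mpolyC q) mevalC.
  by apply: contraNneq q0 => e; rewrite (nvar0_mpolyC q) e mpolyC0.
pose X1 i : {poly {mpoly K[n]}} :=
  if unlift ord_max i is Some j then ('X_j)%:P else 'X.
pose U := mmap (polyC \o @mpolyC n K) X1.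
pose B := horner_eval ('X_ord_max : {mpoly K[n.+1]})
  \o map_poly (mmap (@mpolyC n.+1 K) (fun j => 'X_(lift ord_max j))).
have BU : B \o U =1 idfun.
  apply: mpoly_rmorph_eq => [c|i] /=; rewrite /U ?mmapC ?mmapX ?mmap1U /horner_eval.
    by rewrite map_polyC /= hornerC mmapC.
  rewrite /X1; case: unliftP => [j ->|->]; last by rewrite map_polyX hornerX.
  by rewrite map_polyC hornerC /= mmapX mmap1U.
have U0 : U q != 0.
  by apply: contraNneq q0 => e; have := BU q; rewrite /B [LHS]/= e !raddf0 => /esym/eqP.
have [v hv] := IH _ (etrans (congr1 negb (lead_coef_eq0 _)) U0).
have [x hx] : exists x, (map_poly (meval v) (U q)).[x] != 0.
  apply: poly_nonroot => //; apply: contraNneq hv => e.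
  by rewrite lead_coefE -coef_map /= e coef0.
pose w i := if unlift ord_max i is Some j then v j else x.
exists w; suff <- : (map_poly (meval v) (U q)).[x] = q.@[w] by [].
suff h : horner_eval x \o map_poly (meval v) \o U =1 meval w by apply: h.
apply: mpoly_rmorph_eq => [c|i] /=; rewrite /U ?mmapC ?mmapX ?mmap1U /horner_eval ?mevalC ?mevalXU.
  by rewrite map_polyC /= hornerC mevalC.
rewrite /X1 /w; case: unliftP => [j _|_]; last by rewrite map_polyX hornerX.
by rewrite map_polyC hornerC /= mevalXU.
Qed.

Lemma seq_choice (A : eqType) (B : Type) (P : A -> B -> Prop) (L : seq A) (b0 : B) :
  (forall a, a \in L -> exists b, P a b) -> exists f, forall a, a \in L -> P a (f a).
Proof.
elim: L => [|a L IH] h; first by exists (fun=> b0).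
have [b hb] := h a (mem_head _ _).
have [f hf] := IH (fun x hx => h x (mem_behead (s := a :: L) hx)).
exists (fun x => if x == a then b else f x) => x; rewrite inE.
by case: eqP => [->|_] //=; apply: hf.
Qed.

Lemma row_kernel (F : fieldType) (m n : nat) (A : 'M[F]_(m, n)) : (n < m)%N ->
  exists2 v : 'rV_m, v != 0 & v *m A = 0.
Proof.
move=> ltnm; have : kermx A != 0.
  rewrite kermx_eq0 /row_free neq_ltn (leq_ltn_trans (rank_leq_col A)) //.
by case/rowV0Pn => v /sub_kermxP hv v0; exists v.
Qed.

Lemma mdeg_homog (R : nzRingType) (n d : nat) (q : {mpoly R[n]}) m :
  q \is d.-homog -> m \in msupp q -> mdeg m = d.
Proof. by move=> /dhomogP h /h. Qed.

Lemma meval_homog (R : comNzRingType) (n d : nat) (q : {mpoly R[n]}) (l : R) v :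
  q \is d.-homog -> q.@[fun i => l * v i] = l ^+ d * q.@[v].
Proof.
move=> /mdeg_homog hq; rewrite !mevalE mulr_sumr big_seq [RHS]big_seq.
apply: eq_bigr => m /hq <-; rewrite mulrCA; congr (_ * _).
rewrite mdegE -prodrXr -big_split; apply: eq_bigr => i _.
by rewrite exprMn.
Qed.

Lemma big_ord3 (S : Type) (idx : S) (op : Monoid.law idx) (f : 'I_3 -> S) :
  \big[op/idx]_(i < 3) f i = op (f (inord 0)) (op (f (inord 1)) (f (inord 2))).
Proof.
rewrite !big_ord_recl big_ord0 Monoid.mulm1.
by congr (op (f _) (op (f _) (f _))); apply/val_inj; rewrite /= inordK.
Qed.

(** * Substitution of a line into a ternary form *)

Definition pt3 (S : Type) (x y z : S) : 'I_3 -> S :=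
  fun j => if j == 0%N :> nat then x else if j == 1%N :> nat then y else z.

(* Locked, so that unification never unfolds it. *)
HB.lock Definition tsub (R : nzRingType) (S : comNzRingType) (g : R -> S) (x y : S)
    (q : {mpoly R[3]}) : {poly S} :=
  mmap (polyC \o g) (pt3 x%:P y%:P 'X) q.
Canonical tsub_unlockable := Unlockable tsub.unlock.

Section Tsub.
Variables (R : nzRingType) (S : comNzRingType).

Lemma tsub_is_zmod_morphism (g : {rmorphism R -> S}) x y : zmod_morphism (tsub g x y).
Proof. by move=> p q; rewrite unlock [LHS]raddfB. Qed.

Lemma tsub_is_monoid_morphism (g : {rmorphism R -> S}) x y : monoid_morphism (tsub g x y).
Proof. by split=> [|p q]; rewrite unlock ?[LHS]rmorph1 // [LHS]rmorphM. Qed.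

HB.instance Definition _ (g : {rmorphism R -> S}) x y :=
  GRing.isZmodMorphism.Build {mpoly R[3]} {poly S} (tsub g x y) (tsub_is_zmod_morphism g x y).

HB.instance Definition _ (g : {rmorphism R -> S}) x y :=
  GRing.isMonoidMorphism.Build {mpoly R[3]} {poly S} (tsub g x y)
    (tsub_is_monoid_morphism g x y).

Lemma tsubC (g : {rmorphism R -> S}) x y c : tsub g x y c%:MP = (g c)%:P.
Proof. by rewrite unlock mmapC. Qed.

Lemma tsubX (g : {rmorphism R -> S}) x y i : tsub g x y 'X_i = pt3 x%:P y%:P 'X i.
Proof. by rewrite unlock mmapX mmap1U. Qed.

Lemma coef_tsub (g : R -> S) x y (q : {mpoly R[3]}) j :
  (tsub g x y q)`_j =
  \sum_(m <- msupp q | m (inord 2) == j) g q@_m * x ^+ m (inord 0) * y ^+ m (inord 1).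
Proof.
rewrite unlock /mmap coef_sum [RHS]big_mkcond /=; apply: eq_bigr => m _.
rewrite /mmap1 big_ord3 /pt3 !inordK //=.
rewrite -!rmorphXn /= !mulrA -!polyCM coefCM coefXn eq_sym.
by case: eqP; rewrite ?mulr1 ?mulr0.
Qed.

Lemma mdeg3 (m : 'X_{1..3}) : mdeg m = (m (inord 0) + m (inord 1) + m (inord 2))%N.
Proof.
by rewrite mdegE big_ord3 /= addnA.
Qed.

Lemma size_tsub (g : R -> S) x y (q : {mpoly R[3]}) d :
  q \is d.-homog -> (size (tsub g x y q) <= d.+1)%N.
Proof.
move=> /mdeg_homog hq; apply/leq_sizeP => j hj; rewrite coef_tsub big_seq_cond big1 // => m.
case/andP=> /hq; rewrite mdeg3 => hm /eqP; lia.
Qed.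

(** Only the monomial [t_3^d] reaches degree [d] in [t_3], so the top coefficient is the same
    constant on every line. This is how nonvanishing at [(0 : 0 : 1)] prevents any drop of
    degree. *)
Lemma lead_tsub (g : {rmorphism R -> S}) x y (q : {mpoly R[3]}) d :
  q \is d.-homog -> (tsub g x y q)`_d = g q.@[@e3 R].
Proof.
move=> /mdeg_homog hq; rewrite coef_tsub mevalE rmorph_sum big_mkcond /= big_seq [RHS]big_seq.
apply: eq_bigr => m /hq; rewrite mdeg3 => hm.
rewrite big_ord3 /e3 !inordK //=.
case: eqP => [hd|hd].
  have [-> ->] : m (inord 0) = 0%N /\ m (inord 1) = 0%N by lia.
  by rewrite !expr0 expr1n !mulr1.
have [h0|h1] : (0 < m (inord 0))%N \/ (0 < m (inord 1))%N by lia.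
  by rewrite expr0n eqn0Ngt h0 /= mul0r mulr0 rmorph0.
by rewrite [X in _ * (_ * (X * _))]expr0n eqn0Ngt h1 /= mul0r !mulr0 rmorph0.
Qed.
End Tsub.

Lemma map_tsub (R : nzRingType) (S T : comNzRingType) (g : {rmorphism R -> S})
    (h : {rmorphism S -> T}) x y q :
  map_poly h (tsub g x y q) = tsub (h \o g) (h x) (h y) q.
Proof.
suff e : map_poly h \o tsub g x y =1 tsub (h \o g) (h x) (h y) by apply: e.
apply: mpoly_rmorph_eq => [c|i] /=; rewrite ?tsubC ?tsubX ?map_polyC //=.
by rewrite /pt3; case: ifP => _; last case: ifP => _; rewrite ?map_polyC ?map_polyX.
Qed.

Lemma tsub_map (Q R : nzRingType) (S : comNzRingType) (f : {rmorphism Q -> R})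
    (g : {rmorphism R -> S}) x y q :
  tsub g x y (map_mpoly f q) = tsub (g \o f) x y q.
Proof.
suff e : tsub g x y \o map_mpoly f =1 tsub (g \o f) x y by apply: e.
apply: mpoly_rmorph_eq => [c|i] /=; first by rewrite map_mpolyC !tsubC.
by rewrite map_mpolyX !tsubX.
Qed.

Lemma horner_tsub (R : nzRingType) (S : comNzRingType) (g : {rmorphism R -> S}) x y z q :
  (tsub g x y q).[z] = mmap g (pt3 x y z) q.
Proof.
suff e : horner_eval z \o tsub g x y =1 mmap g (pt3 x y z) by apply: e.
apply: mpoly_rmorph_eq => [c|i] /=; rewrite /horner_eval ?tsubC ?tsubX ?mmapC ?hornerC //.
rewrite mmapX mmap1U /pt3.
by case: ifP => _; last case: ifP => _; rewrite ?hornerC ?hornerX.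
Qed.

Lemma horner_tsub_id (R : comNzRingType) (x y z : R) q :
  (tsub idfun x y q).[z] = q.@[pt3 x y z].
Proof. by rewrite horner_tsub. Qed.

Lemma toBxt3E (K : fieldType) (q : {mpoly K[3]}) :
  toBxt3 q = tsub (@mpolyC 4 {mpoly K[2]} \o @mpolyC 2 K)
    ('X_ord0)%:MP ('X_(inord 1))%:MP q.
Proof. by rewrite unlock. Qed.

(** * Colength of the ideal of two polynomials, localized at a fibre *)

(** This is [dim_F (V / J) = n], expressed by a surjective map with kernel [J] so that no quotient
    is formed. [V] is a module over [{poly F}], and [F] acts through the constants. *)
Definition codim (F : fieldType) (V : lmodType {poly F}) (J : V -> Prop) (n : nat) : Prop :=
  exists phi : V -> 'rV[F]_n,
    [/\ forall c u v, phi (c%:P *: u + v) = c *: phi u + phi v,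
        forall w, exists v, phi v = w
      & forall v, phi v = 0 <-> J v].

Lemma mulX_drop_poly (R : nzRingType) (p : {poly R}) : p = drop_poly 1 p * 'X + (p`_0)%:P.
Proof.
rewrite -[LHS](poly_take_drop 1) addrC expr1; congr (_ + _).
by apply/polyP => -[|i]; rewrite coef_take_poly coefC.
Qed.

Lemma drop_poly_linear (R : comNzRingType) (c : R) (p q : {poly R}) :
  drop_poly 1 (c%:P * p + q) = c%:P * drop_poly 1 p + drop_poly 1 q.
Proof. by rewrite drop_polyD !mul_polyC drop_polyZ. Qed.

(* If [G] is singular at [0], a constant change of columns makes its last column divisible by ['X];
   dividing it by ['X] lowers both the order of the determinant and the codimension by one. *)
Lemma codim_rowspace_loc (F : fieldType) (e d : nat) (G : 'M[{poly F}]_d) (w : {poly F}) :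
  \det G = 'X^e * w -> w.[0] != 0 ->
  codim (fun v : 'rV_d => exists2 a, a.[0] != 0 & exists z, a *: v = z *m G) e.
Proof.
elim: e d G w => [|e IH] d G w hdet hw.
  exists (fun=> 0); split=> [c u v|x|v]; rewrite ?scaler0 ?addr0 //.
    by exists 0; rewrite [x]thinmx0.
  split=> // _; exists w => //; exists (v *m \adj G).
  by rewrite -mulmxA mul_adj_mx hdet mul1r mul_mx_scalar.
case: d G hdet => [|d] G hdet.
  move: hdet; rewrite det_mx00 => /(congr1 (fun q => q.[0])).
  by rewrite hornerM hornerXn expr0n mul0r hornerC => /eqP; rewrite oner_eq0.
pose G0 : 'M[F]_d.+1 := map_mx (horner_eval 0) G.
have rG0 : (\rank G0 <= d)%N.
  rewrite -ltnS ltn_neqAle rank_leq_row andbT -[_ == _]/(row_free G0) row_free_unit unitmxE.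
  by rewrite det_map_mx hdet /= /horner_eval hornerM hornerXn expr0n mul0r unitr0.
pose U0 := row_ebase G0; have uU0 : U0 \in unitmx := row_ebase_unit G0.
pose P : 'M[{poly F}]_d.+1 := map_mx polyC (invmx U0).
pose P' : 'M[{poly F}]_d.+1 := map_mx polyC U0.
have PP' : P *m P' = 1%:M by rewrite -map_mxM mulVmx // map_mx1.
have P'P : P' *m P = 1%:M by rewrite -map_mxM mulmxV // map_mx1.
have [H HE] : exists H, H = G *m P by exists (G *m P).
(* At [0], [H] becomes [G0 *m invmx U0], which is [col_ebase G0] times a partial identity of rank at
   most [d], so its last column is zero. *)
have H0 i : (H i ord_max)`_0 = 0.
  have -> : (H i ord_max)`_0 = (map_mx (horner_eval 0) H) i ord_max.
    by rewrite [RHS]mxE /= /horner_eval horner_coef0.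
  rewrite HE map_mxM -/G0 /P -map_mx_comp map_mx_id; last by move=> x; rewrite /= /horner_eval hornerC.
  rewrite -[G0](mulmx_ebase) mulmxK // mxE big1 // => k _.
  by rewrite mxE; case: eqP => [/= ->|]; rewrite ?mulr0 // ltnNge rG0 mulr0.
pose D : 'rV[{poly F}]_d.+1 := \row_j if j == ord_max then 'X else 1.
pose G' := \matrix_(i, j) if j == ord_max then drop_poly 1 (H i j) else H i j.
have HD : H = G' *m diag_mx D.
  apply/matrixP => i j; rewrite mul_mx_diag !mxE; case: eqP => [->|_]; last by rewrite mulr1.
  by rewrite {1}[H i _]mulX_drop_poly H0 addr0.
have detD : \det (diag_mx D) = 'X.
  rewrite det_diag (bigD1 ord_max) //= big1 => [|j /negbTE hj]; by rewrite mxE ?eqxx ?mulr1 ?hj.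
have detP : \det P = (\det (invmx U0))%:P by rewrite det_map_mx.
have detP0 : \det (invmx U0) != 0 by rewrite -unitfE -unitmxE unitmx_inv.
have hdet' : \det G' = 'X^e * (w * \det P).
  apply: (mulIf (negbT (polyX_eq0 F))).
  have -> : \det G' * 'X = \det G * \det P by rewrite -detD -det_mulmx -HD HE det_mulmx.
  by rewrite hdet exprS; ring.
have hw' : (w * \det P).[0] != 0 by rewrite detP hornerM hornerC mulf_neq0.
have [phi [lphi sphi kphi]] := IH _ _ _ hdet' hw'.
pose dr (u : 'rV[{poly F}]_d.+1) : 'rV_d.+1 :=
  \row_j if j == ord_max then drop_poly 1 (u 0 j) else u 0 j.
(* The extra coordinate is the constant term of the last entry; the other [e] see that entry only
   after division by ['X]. *)
pose psi (v : 'rV[{poly F}]_d.+1) : 'rV[F]_(1 + e) :=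
  row_mx (((v *m P) 0 ord_max)`_0)%:M (phi (dr (v *m P))).
rewrite -[e.+1]/(1 + e)%N; exists psi; split.
- move=> c u v; rewrite /psi scale_row_mx add_row_mx; congr row_mx.
    apply/matrixP => i j; rewrite !ord1 mulmxDl -scalemxAl !mxE /=.
    by rewrite !mulr1n coefD coefCM.
  rewrite -lphi; congr phi; apply/rowP => j; rewrite mulmxDl -scalemxAl !mxE.
  by case: eqP => // _; rewrite drop_poly_linear.
- move=> x; have [y hy] := sphi (rsubmx (x : 'rV_(1 + e))).
  pose u : 'rV_d.+1 := y *m diag_mx D
    + \row_j if j == ord_max then ((lsubmx (x : 'rV_(1 + e))) 0 0)%:P else 0.
  have hu : u *m P' *m P = u by rewrite -mulmxA P'P mulmx1.
  exists (u *m P'); rewrite /psi hu -[RHS]hsubmxK; congr row_mx.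
    rewrite [RHS]mx11_scalar; congr (_%:M).
    by rewrite /u mul_mx_diag !mxE eqxx coefD coefMX coefC add0r.
  rewrite -hy; congr phi; apply/rowP => j; rewrite /u mul_mx_diag !mxE.
  case: eqP => [->|_]; last by rewrite mulr1 addr0.
  by apply/polyP => i; rewrite coef_drop_poly coefD addn1 coefMX coefC addr0.
move=> v; rewrite /psi; have [u uE] : exists u, u = v *m P by exists (v *m P).
rewrite -uE.
have du : u = dr u *m diag_mx D + \row_j if j == ord_max then ((u 0 ord_max)`_0)%:P else 0.
  apply/rowP => j; rewrite mul_mx_diag !mxE.
  case: eqP => [->|_]; last by rewrite mulr1 addr0.
  by rewrite -mulX_drop_poly.
split=> [/eqP|].
  rewrite row_mx_eq0 => /andP[/eqP h0 /eqP/kphi[a a0 [z hz]]].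
  have u0 : (u 0 ord_max)`_0 = 0.
    by move/matrixP: h0 => /(_ 0 0); rewrite !mxE mulr1n.
  have du' : u = dr u *m diag_mx D.
    rewrite {1}du u0 [X in _ + X](_ : _ = 0) ?addr0 //.
    by apply/rowP => j; rewrite !mxE; case: ifP.
  exists a => //; exists z.
  have : a *: u = z *m H by rewrite HD mulmxA -hz -scalemxAl -du'.
  by move/(congr1 (mulmx^~ P')); rewrite uE HE -scalemxAl -!mulmxA PP' !mulmx1.
case=> a a0 [z hz].
have hzu : a *: u = (z *m G') *m diag_mx D.
  by rewrite -mulmxA -HD HE mulmxA -hz -scalemxAl uE.
have hzuj j : a * u 0 j = (z *m G') 0 j * D 0 j.
  have : (a *: u) 0 j = ((z *m G') *m diag_mx D) 0 j by rewrite hzu.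
  by rewrite mul_mx_diag [LHS]mxE [RHS]mxE.
(* ['X] divides [a * u 0 ord_max] while [a] does not vanish at [0]. *)
have u0 : (u 0 ord_max)`_0 = 0.
  move: (hzuj ord_max); rewrite [D _ _]mxE eqxx.
  move/(congr1 (coefp 0)); rewrite /= coefMX coef0M => /eqP.
  by rewrite mulf_eq0 -horner_coef0 (negbTE a0) => /eqP.
have du' : u = dr u *m diag_mx D.
  rewrite {1}du u0 [X in _ + X](_ : _ = 0) ?addr0 //.
  by apply/rowP => j; rewrite !mxE; case: ifP.
apply/eqP; rewrite u0 row_mx_eq0 raddf0 eqxx /=.
apply/eqP/kphi; exists a => //; exists z.
apply/rowP => j; move: (hzuj j); rewrite {1}du' mul_mx_diag [X in a * X]mxE mulrA.
move=> hj; rewrite [LHS]mxE; apply: mulIf hj.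
by rewrite mxE; case: ifP => _; rewrite ?polyX_eq0 ?oner_eq0.
Qed.

Definition in_ideal (R : nzRingType) (f g s : R) : Prop := exists a b, s = a * f + b * g.

Section InIdeal.
Variables (R : comNzRingType) (f g : R).
Implicit Types s t : R.

Lemma in_idealD s t : in_ideal f g s -> in_ideal f g t -> in_ideal f g (s + t).
Proof. by move=> [a [b ->]] [a' [b' ->]]; exists (a + a'), (b + b'); ring. Qed.

Lemma in_idealM s t : in_ideal f g t -> in_ideal f g (s * t).
Proof. by move=> [a [b ->]]; exists (s * a), (s * b); ring. Qed.

Lemma in_ideal0 : in_ideal f g 0.
Proof. by exists 0, 0; ring. Qed.

Lemma in_ideall s : in_ideal f g (s * f).
Proof. by exists s, 0; ring. Qed.

Lemma in_idealr s : in_ideal f g (s * g).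
Proof. by exists 0, s; ring. Qed.
End InIdeal.

Section Sylvester.
Variables (F : fieldType) (f g : {poly {poly F}}).
Hypotheses (f0 : lead_coef f \is a GRing.unit) (g0 : lead_coef g \is a GRing.unit).

Let nzf : f != 0.
Proof. by apply: contraTneq f0 => ->; rewrite lead_coef0 unitr0. Qed.

Let nzg : g != 0.
Proof. by apply: contraTneq g0 => ->; rewrite lead_coef0 unitr0. Qed.

Let sf : (0 < size f)%N. Proof. by rewrite size_poly_gt0. Qed.
Let sg : (0 < size g)%N. Proof. by rewrite size_poly_gt0. Qed.

(** Rows of the Sylvester matrix only give combinations [a f + b g] with bounded [a] and [b]. Any
    other combination of small degree is brought to this form by dividing [b] by [f], which is
    possible since [f] has a unit leading coefficient; the bound on [a] then follows from the degree
    of the result. *)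
Lemma Sylvester_rowspanP (v : 'rV[{poly F}]_((size g).-1 + (size f).-1)) :
  (exists z, v = z *m Sylvester_mx f g) <-> in_ideal f g (rVpoly v).
Proof.
have aux a x y : (0 < y -> a <= x.-1 -> (a + y).-1 <= x.-1 + y.-1)%N by lia.
have aux' a x y : (0 < y -> 0 < a -> (a + y).-1 <= x.-1 + y.-1 -> a <= x.-1)%N by lia.
split=> [[z ->]|[a [b hab]]].
  rewrite -[z]hsubmxK mul_row_col !mul_rV_lin1 /= linearD /=.
  have h1 : (size (rVpoly (lsubmx z)) <= (size g).-1)%N by apply: size_poly.
  have h2 : (size (rVpoly (rsubmx z)) <= (size f).-1)%N by apply: size_poly.
  exists (rVpoly (lsubmx z)), (rVpoly (rsubmx z)).
  rewrite !poly_rV_K //; apply: leq_trans (size_polyMleq _ _) _; last exact: aux.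
  by rewrite [leqRHS]addnC; apply: aux.
pose b' := modp b f; pose a' := a + divp b f * g.
have eb : b = divp b f * f + b' by apply: Pdiv.IdomainUnit.divp_eq.
have hv : rVpoly v = a' * f + b' * g by rewrite hab {1}eb /a'; ring.
have sb' : (size b' <= (size f).-1)%N by rewrite -ltnS prednK // ltn_modp.
have sb'g : (size (b' * g)%R <= (size g).-1 + (size f).-1)%N.
  by apply: leq_trans (size_polyMleq _ _) _; rewrite [leqRHS]addnC; apply: aux.
have sv : (size (rVpoly v) <= (size g).-1 + (size f).-1)%N by apply: size_poly.
have sa' : (size a' <= (size g).-1)%N.
  have : (size (a' * f)%R <= (size g).-1 + (size f).-1)%N.
    have -> : a' * f = rVpoly v - b' * g by rewrite hv addrK.
    by apply: leq_trans (size_polyD _ _) _; rewrite geq_max size_polyN sv.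
  have [->|nza] := eqVneq a' 0; first by rewrite size_poly0.
  by rewrite size_mul //; apply: aux'; rewrite ?size_poly_gt0.
exists (row_mx (poly_rV a') (poly_rV b')).
rewrite mul_row_col !mul_rV_lin1 /= !poly_rV_K // -linearD -hv.
by rewrite /= rVpolyK.
Qed.

(** Remainders modulo [f] fit in the row vectors on which the Sylvester matrix acts. The quotient by
    [(f, g)] is thus the quotient by its row space, whose determinant is the resultant. *)
Lemma codim_ideal_loc (e : nat) (w : {poly F}) :
  resultant f g = 'X^e * w -> w.[0] != 0 ->
  codim (fun s : {poly {poly F}} => exists2 a, a.[0] != 0 & in_ideal f g (a *: s)) e.
Proof.
move=> hres hw; have [phi [lphi sphi kphi]] := codim_rowspace_loc hres hw.
have rvM s : rVpoly (poly_rV (modp s f) : 'rV_((size g).-1 + (size f).-1)) = modp s f.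
  apply: poly_rV_K; have : (size (modp s f) < size f)%N by rewrite ltn_modp.
  by move=> h; apply: leq_trans (leq_addl _ _); rewrite -ltnS prednK.
have es s : s = divp s f * f + modp s f by apply: Pdiv.IdomainUnit.divp_eq.
have kphi' v : phi v = 0 <-> exists2 a, a.[0] != 0 & in_ideal f g (a *: rVpoly v).
  split=> [/kphi[a a0 [z hz]]|[a a0 ha]].
    by exists a => //; rewrite -linearZ; apply/Sylvester_rowspanP; exists z.
  apply/kphi; exists a => //; apply/Sylvester_rowspanP.
  by rewrite linearZ.
have phiB u v : phi (u - v) = phi u - phi v.
  have -> : u - v = (-1)%:P *: v + u by rewrite polyCN scaleN1r addrC.
  by rewrite lphi scaleN1r addrC.
exists (fun s => phi (poly_rV (modp s f))); split=> [c u v|x|s].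
- by rewrite Pdiv.IdomainUnit.modpD // Pdiv.IdomainUnit.modpZl // linearD linearZ /= lphi.
- have [v hv] := sphi x; exists (rVpoly v); apply/eqP; rewrite -hv -subr_eq0 -phiB.
  apply/eqP/kphi'; exists 1; rewrite ?hornerC ?oner_eq0 // scale1r linearB /= rvM.
  exists (- divp (rVpoly v) f), 0; rewrite {2}[rVpoly v]es; ring.
have e1 a : a *: s = (a *: divp s f) * f + a *: modp s f.
  by rewrite {1}[s]es scalerDr scalerAl.
split=> [/kphi'|] [a a0 ha].
  by exists a => //; rewrite e1; apply: in_idealD; [apply: in_ideall | rewrite -rvM].
apply/kphi'; exists a => //; rewrite rvM.
have -> : a *: modp s f = a *: s + (- (a *: divp s f)) * f by rewrite e1; ring.
by apply: in_idealD => //; apply: in_ideall.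
Qed.
End Sylvester.

Lemma codim_ext (F : fieldType) (V : lmodType {poly F}) (J J' : V -> Prop) n :
  (forall v, J v <-> J' v) -> codim J n -> codim J' n.
Proof.
move=> h [phi [l s k]]; exists phi; split=> // v.
by split=> [/k/h|/h/k].
Qed.

Lemma linC_sum (F : fieldType) (V : lmodType {poly F}) (n : nat) (phi : V -> 'rV[F]_n)
    k (c : 'I_k -> F) (b : 'I_k -> V) :
  (forall c u v, phi (c%:P *: u + v) = c *: phi u + phi v) ->
  phi (\sum_(i < k) (c i)%:P *: b i) = \sum_(i < k) c i *: phi (b i).
Proof.
move=> l; have phi0 : phi 0 = 0.
  have e : phi 0 = phi 0 + phi 0 by have := l 1 0 0; rewrite polyC1 !scale1r addr0.
  by apply: (addrI (phi 0)); rewrite -e addr0.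
by elim/big_rec2: _ => // i x y _ <-; rewrite l.
Qed.

(** * Splitting a colength by an idempotent *)

Section CodimSplit.
Variables (F : fieldType) (V : lmodType {poly F}).

Lemma codim_rank (e k : nat) (phi : V -> 'rV[F]_e) (M : 'M[F]_(e, k)) :
  (forall c u v, phi (c%:P *: u + v) = c *: phi u + phi v) ->
  (forall w, exists v, phi v = w) ->
  codim (fun v => phi v *m M = 0) (\rank M).
Proof.
move=> l s; have fM : row_free (row_base M) by apply: row_base_free.
exists (fun v => phi v *m M *m pinvmx (row_base M)); split.
- by move=> c u v; rewrite l !mulmxDl -!scalemxAl.
- move=> w; have /submxP[y hy] : (w *m row_base M <= M)%MS.
    by apply: submx_trans (submxMl _ _) _; rewrite eq_row_base.
  by have [v hv] := s y; exists v; rewrite hv -hy -mulmxA mulmxVp // mulmx1.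
move=> v; split=> [h|->]; last by rewrite mul0mx.
have : (phi v *m M <= row_base M)%MS by rewrite eq_row_base submxMl.
by move/mulmxKpV; rewrite h mul0mx.
Qed.

(** The hypotheses make [T] act on the [e]-dimensional quotient by an idempotent matrix [M]; the
    ranks of [M] and [1 - M] add up to [e]. *)
Lemma codim_split (J : V -> Prop) (e : nat) (T : V -> V) :
  codim J e ->
  (forall c u v, T (c%:P *: u + v) = c%:P *: T u + T v) ->
  (forall v, J v -> J (T v)) -> (forall v, J (T (v - T v))) ->
  exists m1 m2, [/\ e = (m1 + m2)%N, codim (fun v => J (T v)) m1
                  & codim (fun v => J (v - T v)) m2].
Proof.
move=> [phi [l s k]] lT JT JTT.
have phiB u v : phi (u - v) = phi u - phi v.
  have -> : u - v = (-1)%:P *: v + u by rewrite polyCN scaleN1r addrC.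
  by rewrite l scaleN1r addrC.
have TB u v : T (u - v) = T u - T v.
  have -> : u - v = (-1)%:P *: v + u by rewrite polyCN scaleN1r addrC.
  by rewrite lT polyCN scaleN1r addrC.
have phi0 : phi 0 = 0 by rewrite -[0](subrr (0 : V)) phiB subrr.
have T0 : T 0 = 0 by rewrite -[0 in LHS](subrr (0 : V)) TB subrr.
have [b hb] : exists b : 'I_e -> V, forall i, phi (b i) = delta_mx 0 i.
  by apply: (fin_all_exists (fun i => s (delta_mx 0 i))).
(* The matrix of [T] on the quotient, computed on lifts [b] of the standard basis; it is independent
   of the lifts because [T] preserves [J]. *)
pose M : 'M[F]_e := \matrix_(i, j) phi (T (b i)) 0 j.
have phiT v : phi (T v) = phi v *m M.
  pose lin := fun (c : 'I_e -> F) => \sum_(i < e) (c i)%:P *: b i.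
  have e1 : phi (lin (fun i => phi v 0 i)) = phi v.
    by rewrite linC_sum // [RHS]row_sum_delta; apply: eq_bigr => i _; rewrite hb.
  have /k/JT/k : phi (v - lin (fun i => phi v 0 i)) = 0 by rewrite phiB e1 subrr.
  rewrite TB phiB => /eqP; rewrite subr_eq0 => /eqP ->.
  have -> : phi (T (lin (fun i => phi v 0 i))) = \sum_(i < e) phi v 0 i *: phi (T (b i)).
    by rewrite -(@linC_sum _ _ _ (phi \o T)) // => c u u'; rewrite /= lT l.
  by rewrite mulmx_sum_row; apply: eq_bigr => i _; congr (_ *: _); apply/rowP => j; rewrite !mxE.
have MM : M *m (1%:M - M) = 0.
  apply/row_matrixP => i; rewrite row_mul row0.
  have -> : row i M = phi (T (b i)) by apply/rowP => j; rewrite !mxE.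
  by rewrite mulmxBr mulmx1 -phiT -phiB -TB; apply/k/JTT.
exists (\rank M), (\rank (1%:M - M)); split.
- have : (kermx M == 1%:M - M)%MS.
    apply/andP; split; last first.
      apply/sub_kermxP; rewrite mulmxBl mul1mx.
      by have := MM; rewrite mulmxBr mulmx1.
    apply/rV_subP => x /sub_kermxP hx; apply/submxP; exists x.
    by rewrite mulmxBr mulmx1 hx subr0.
  by move=> /eqmx_rank <-; rewrite mxrank_ker subnKC // rank_leq_row.
- apply: codim_ext (codim_rank M l s) => v; rewrite -phiT; exact: k.
apply: codim_ext (codim_rank (1%:M - M) l s) => v.
by rewrite mulmxBr mulmx1 -phiT -phiB; exact: k.
Qed.
End CodimSplit.

(** * Localization at the points of the fibre *)

Section Localize.
Variables (F : closedFieldType) (f g : {poly {poly F}}).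
Hypotheses (f0 : lead_coef f \is a GRing.unit) (g0 : lead_coef g \is a GRing.unit).
Variables (e : nat) (w : {poly F}).
Hypotheses (hres : resultant f g = 'X^e * w) (hw : w.[0] != 0).
Local Notation Q := {poly {poly F}}.
Local Notation ev0 := (map_poly (horner_eval (0 : F))).

(** Membership in [(f, g)] over the semilocal ring at the points [(0, c)], [c] in [cs]: the
    denominators [u] must not vanish at any of them. For a single point this is the local ring of
    the plane. *)
Definition loc_ideal (cs : seq F) (s : Q) : Prop :=
  exists2 u : Q, forall c, c \in cs -> (ev0 u).[c] != 0 & in_ideal f g (u * s).

Let ev0C (a : {poly F}) : ev0 a%:P = (a.[0])%:P.
Proof. by rewrite map_polyC. Qed.

Let ev0lift (h : {poly F}) : ev0 (map_poly polyC h) = h.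
Proof.
rewrite -map_poly_comp map_poly_id // => x _.
by rewrite /= /horner_eval hornerC.
Qed.

Let ev0_eq0 (q : Q) : ev0 q = 0 -> exists q', q = 'X%:P * q'.
Proof.
move=> h; exists (map_poly (drop_poly 1) q); apply/polyP => i.
rewrite coefCM coef_map_id0; last by rewrite drop_poly0r.
rewrite {1}[q`_i]mulX_drop_poly mulrC -horner_coef0.
have -> : (q`_i).[0] = (ev0 q)`_i by rewrite coef_map.
by rewrite h coef0 addr0.
Qed.

Lemma resultant_in_loc : in_ideal f g ('X^e * w)%:P.
Proof.
rewrite -hres; have [sf|sf] := ltnP 1 (size f); last first.
  have [c ef] : exists c, f = c%:P by exists f`_0; apply: size1_polyC.
  have key : (c^-1)%:P * f = 1.
    by rewrite ef -polyCM mulVr //; move: f0; rewrite ef lead_coefC.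
  by exists ((resultant f g)%:P * (c^-1)%:P), 0; rewrite mul0r addr0 -mulrA key mulr1.
have [sg|sg] := ltnP 1 (size g); last first.
  have [c eg] : exists c, g = c%:P by exists g`_0; apply: size1_polyC.
  have key : (c^-1)%:P * g = 1.
    by rewrite eg -polyCM mulVr //; move: g0; rewrite eg lead_coefC.
  by exists 0, ((resultant f g)%:P * (c^-1)%:P); rewrite mul0r add0r -mulrA key mulr1.
by have [uv _ ->] := resultant_in_ideal sf sg; exists uv.1, uv.2.
Qed.

Lemma loc_idealM cs s t : loc_ideal cs t -> loc_ideal cs (s * t).
Proof. by case=> u hu ht; exists u => //; rewrite mulrCA; apply: in_idealM. Qed.

Lemma loc_idealD cs s t : loc_ideal cs s -> loc_ideal cs t -> loc_ideal cs (s + t).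
Proof.
move=> [u hu hs] [v hv ht]; exists (u * v).
  by move=> c hc; rewrite rmorphM hornerM mulf_neq0 ?hu ?hv.
rewrite mulrDr; apply: in_idealD; last by rewrite -mulrA; apply: in_idealM.
by rewrite mulrAC mulrC; apply: in_idealM.
Qed.

Lemma loc_ideal_unit cs u s : (forall c, c \in cs -> (ev0 u).[c] != 0) ->
  loc_ideal cs (u * s) -> loc_ideal cs s.
Proof.
move=> hu [v hv hs]; exists (v * u); last by rewrite -mulrA.
by move=> c hc; rewrite rmorphM hornerM mulf_neq0 ?hu ?hv.
Qed.

Lemma loc_ideal_in cs s : in_ideal f g s -> loc_ideal cs s.
Proof.
move=> h; exists 1; last by rewrite mul1r.
by move=> c _; rewrite rmorph1 hornerC oner_neq0.
Qed.

(** When [cs] contains all common zeros on the fibre, a denominator [u] has no common zero with [f]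
    and [g] there. A Bezout relation on the fibre lifts to some [v] in [(u, f, g)] with [v = 1]
    modulo ['X], and such a [v] is invertible modulo any power of ['X]; since ['X^e * w] lies in
    [(f, g)], the denominator [w] suffices. *)
Lemma loc_ideal_all (cs : seq F) s :
  (forall c, root (ev0 f) c -> root (ev0 g) c -> c \in cs) ->
  (exists2 a : {poly F}, a.[0] != 0 & in_ideal f g (a *: s)) <-> loc_ideal cs s.
Proof.
move=> hcs; split=> [[a a0 ha]|[u hu hs]].
  exists a%:P; last by rewrite mul_polyC.
  by move=> c _; rewrite ev0C hornerC.
have [x [y [z hxyz]]] : exists x y z, x * ev0 u + y * ev0 f + z * ev0 g = 1.
  pose h := gcdp (ev0 f) (ev0 g).
  have cop : coprimep (ev0 u) h.
    rewrite /coprimep; apply/negPn/negP => /closed_rootP[c].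
    rewrite !root_gcd => /and3P[ru rf rg].
    by have := hu c (hcs c rf rg); rewrite -rootE ru.
  have /Bezout_eq1_coprimepP[[x y] /= hxy] := cop.
  have [[y1 z1] /eqpP[[c1 c2] /= /andP[c10 c20] hyz]] := Bezoutp (ev0 f) (ev0 g).
  exists x, (y * (c2^-1)%:P * c1%:P * y1), (y * (c2^-1)%:P * c1%:P * z1); rewrite -hxy.
  have -> : h = (c2^-1)%:P * (c1%:P * (y1 * ev0 f + z1 * ev0 g)).
    by rewrite !mul_polyC hyz scalerA mulVf // scale1r.
  ring.
pose v := map_poly polyC x * u + map_poly polyC y * f + map_poly polyC z * g.
have hv : ev0 v = 1 by rewrite !rmorphD !rmorphM /= !ev0lift.
have vs : in_ideal f g (v * s).
  have -> : v * s = map_poly polyC x * (u * s) + map_poly polyC y * s * f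
      + map_poly polyC z * s * g by rewrite /v; ring.
  by apply: in_idealD (in_idealr _ _ _); apply: in_idealD (in_ideall _ _ _); apply: in_idealM.
have [v' hv'] : exists v', v - 1 = 'X%:P * v'.
  by apply: ev0_eq0; rewrite rmorphB rmorph1 /= hv subrr.
exists w => //; rewrite -mul_polyC.
have /(in_idealM ((- v') ^+ e)) h1 := in_idealM s resultant_in_loc.
have h2 := in_idealM (w%:P * \sum_(i < e) 1 ^+ (e.-1 - i) * (- ('X%:P * v')) ^+ i) vs.
(* Geometric sum: [v = 1 + 'X v'] divides [1 - (- 'X v')^e], and the omitted term carries ['X^e]. *)
have eX : 1 - (- ('X%:P * v')) ^+ e =
    v * \sum_(i < e) 1 ^+ (e.-1 - i) * (- ('X%:P * v')) ^+ i.
  by rewrite -[1 in LHS](expr1n _ e) subrXX -hv'; congr (_ * _); ring.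
have -> : w%:P * s = (- v') ^+ e * (s * ('X^e * w)%:P)
   + (w%:P * \sum_(i < e) 1 ^+ (e.-1 - i) * (- ('X%:P * v')) ^+ i) * (v * s).
  transitivity (w%:P * s * (('X%:P * - v') ^+ e + (1 - (- ('X%:P * v')) ^+ e))).
    by rewrite mulrN addrC subrK mulr1.
  rewrite eX exprMn polyCM polyC_exp; ring.
exact: in_idealD.
Qed.

Lemma loc_ideal_cons c cs s : c \notin cs ->
  loc_ideal (c :: cs) s <-> loc_ideal [:: c] s /\ loc_ideal cs s.
Proof.
move=> hc; split=> [[u hu hs]|[[u hu hs] [v hv hs']]].
  by split; exists u => // x hx; apply: hu; rewrite inE; move: hx; rewrite ?inE => ->; rewrite ?orbT.
(* Gluing of denominators: in [u B + v A] the second term vanishes at [c] and the first at every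
   point of [cs], so the surviving term is nonzero at each point. *)
pose A : {poly F} := 'X - c%:P; pose B : {poly F} := \prod_(x <- cs) ('X - x%:P).
exists (u * map_poly polyC B + v * map_poly polyC A); last first.
  by rewrite mulrDl !(mulrAC _ _ s) ![_ * s * _]mulrC; apply: in_idealD; apply: in_idealM.
move=> x; rewrite inE => /orP[/eqP ->|hx]; rewrite rmorphD !rmorphM /= !ev0lift hornerD !hornerM.
  rewrite hornerXsubC subrr mulr0 addr0 mulf_neq0 ?hu ?mem_head //.
  by rewrite -[_ == 0]/(root B c) root_prod_XsubC.
have -> : B.[x] = 0 by apply/eqP; rewrite -[_ == 0]/(root B x) root_prod_XsubC.
rewrite mulr0 add0r mulf_neq0 ?hv // hornerXsubC subr_eq0.
by apply: contraNneq hc => <-.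
Qed.

(** On the fibre [f] is [('X - c)^n h] with [h] nonzero at [c]. Hence the [e]-th power of this
    product lies in [(f, 'X^e)], and ['X^e] is in the local ideal because [w] is invertible there;
    so [N = n e] works. *)
Lemma loc_ideal_XsubC c : exists N, loc_ideal [:: c] (map_poly polyC (('X - c%:P) ^+ N)).
Proof.
have hX : loc_ideal [:: c] ('X^e)%:P.
  exists w%:P; last by rewrite mulrC -polyCM; apply: resultant_in_loc.
  by move=> x _; rewrite ev0C hornerC.
have nzf : ev0 f != 0.
  have : (ev0 f)`_(size f).-1 != 0.
    rewrite coef_map -lead_coefE /=; move: f0; rewrite poly_unitE => /andP[/eqP/eq_leq/size1_polyC ->].
    by rewrite unitfE coefC /horner_eval hornerC.
  by apply: contra_neq => ->; rewrite coef0.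
have [n [h hh hf]] := multiplicity_XsubC (ev0 f) c.
rewrite nzf /= in hh.
pose A := map_poly polyC (('X - c%:P) ^+ n); pose H := map_poly polyC h.
have [f' hf'] : exists f', f - A * H = 'X%:P * f'.
  by apply: ev0_eq0; rewrite rmorphB rmorphM /= !ev0lift {1}hf mulrC subrr.
exists (n * e)%N; apply: (@loc_ideal_unit _ (H ^+ e)).
  by move=> x; rewrite inE => /eqP ->; rewrite rmorphXn /= ev0lift horner_exp expf_neq0.
rewrite exprM rmorphXn /= -/A -exprMn.
have -> : (H * A) ^+ e = (- f') ^+ e * ('X^e)%:P
    + (\sum_(i < e) (H * A) ^+ (e.-1 - i) * (- ('X%:P * f')) ^+ i) * f.
  have /eqP := subrXX (H * A) (- ('X%:P * f')) e; rewrite subr_eq => /eqP ->.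
  have -> : (- ('X%:P * f')) ^+ e = (- f') ^+ e * ('X^e)%:P.
    by rewrite polyC_exp -exprMn; congr (_ ^+ _); ring.
  by rewrite opprK -hf'; ring.
by apply: loc_idealD; [apply: loc_idealM | apply: loc_ideal_in; apply: in_ideall].
Qed.

Lemma loc_ideal_seq cs s : uniq cs -> (forall c, c \in cs -> loc_ideal [:: c] s) ->
  loc_ideal cs s.
Proof.
elim: cs => [|c cs IH] /=.
  by move=> _ _; exists 0 => //; rewrite mul0r; apply: in_ideal0.
move=> /andP[hc ucs] h; apply/loc_ideal_cons => //; split; first by apply: h; apply: mem_head.
by apply: IH => // x hx; apply: h; rewrite inE hx orbT.
Qed.

(** Chinese remainder argument, one point at a time: [u + v = 1] with [u] in the local ideal at [c]
    and [v] in the one at the remaining points, so multiplication by [u] is idempotent on the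
    quotient and separates the two contributions. *)
Lemma codim_loc_sum (cs : seq F) n : uniq cs -> codim (loc_ideal cs) n ->
  exists2 m : F -> nat, forall c, c \in cs -> codim (loc_ideal [:: c]) (m c)
                      & n = (\sum_(c <- cs) m c)%N.
Proof.
elim: cs n => [|c cs IH] n.
  (* With no points the denominator [0] is allowed, so the ideal is everything and [n] must be
     [0]. *)
  move=> _ [phi [_ s k]]; exists (fun=> 0%N) => //; rewrite big_nil.
  case: n phi s k => // n phi s k; have [v hv] := s (delta_mx 0 0).
  have : phi v = 0 by apply/k; exists 0 => //; rewrite mul0r; apply: in_ideal0.
  by rewrite hv => /matrixP/(_ 0 0); rewrite !mxE !eqxx => /eqP; rewrite oner_eq0.
move=> /= /andP[hc ucs] hn.
have [N hN] := @seq_choice _ _ (fun x N => loc_ideal [:: x] (map_poly polyC (('X - x%:P) ^+ N)))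
  (c :: cs) 0%N (fun x _ => loc_ideal_XsubC x).
pose A : {poly F} := ('X - c%:P) ^+ N c.
pose B : {poly F} := \prod_(x <- cs) ('X - x%:P) ^+ N x.
have BJ : loc_ideal cs (map_poly polyC B).
  apply: loc_ideal_seq => // x hx; rewrite /B (big_rem _ hx) /= rmorphM mulrC.
  by apply/loc_idealM/hN; rewrite inE hx orbT.
have /Bezout_eq1_coprimepP[[a b] /= hab] : coprimep A B.
  apply/negPn/negP => /closed_rootP[z]; rewrite root_gcd => /andP[rA].
  have /eqP -> : z == c.
    by move: rA; rewrite rootE horner_exp hornerXsubC expf_eq0 subr_eq0 => /andP[].
  rewrite /B => rB; move: hc => /negP; apply.
  elim: (cs) rB => [|x l IHl]; first by rewrite big_nil rootE hornerC oner_eq0.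
  rewrite big_cons rootM inE => /orP[|/IHl ->]; last by rewrite orbT.
  by rewrite rootE horner_exp hornerXsubC expf_eq0 subr_eq0 => /andP[_ ->].
pose u := map_poly polyC (a * A); pose v := map_poly polyC (b * B).
have uv : u + v = 1 by rewrite -rmorphD /= hab rmorph1.
have ev : v = 1 - u by rewrite -uv; ring.
have uJ : loc_ideal [:: c] u by rewrite /u rmorphM; apply/loc_idealM/hN/mem_head.
have vJ : loc_ideal cs v by rewrite /v rmorphM; apply: loc_idealM.
have [] := @codim_split _ _ _ _ (fun s => u * s) hn.
- by move=> k s t; rewrite mulrDr scalerAr.
- by move=> s hs; apply: loc_idealM.
- move=> s; have -> : u * (s - u * s) = s * (u * v) by rewrite ev; ring.
  apply/loc_idealM/loc_ideal_cons => //; split; last exact: loc_idealM.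
  by rewrite mulrC; apply: loc_idealM.
move=> n1 [n2 [en h1 h2]].
(* [u * s] always lies in the local ideal at [c], and differs from [s] by [v * s], which lies in the
   one at [cs]; so the image of [u] computes the points of [cs] and that of [v] the point [c]. *)
have su s : s = u * s + v * s by rewrite -mulrDl uv mul1r.
have {}h1 : codim (loc_ideal cs) n1.
  apply: codim_ext h1 => s; split=> [/(loc_ideal_cons _ hc)[_ h]|h].
    by rewrite [s]su; apply: loc_idealD => //; rewrite mulrC; apply: loc_idealM.
  apply/loc_ideal_cons => //; split; last exact: loc_idealM.
  by rewrite mulrC; apply: loc_idealM.
have {}h2 : codim (loc_ideal [:: c]) n2.
  have e2 s : s - u * s = v * s by rewrite ev; ring.
  apply: codim_ext h2 => s; rewrite e2; split=> [/(loc_ideal_cons _ hc)[h _]|h].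
    by rewrite [s]su; apply: loc_idealD => //; rewrite mulrC; apply: loc_idealM.
  apply/loc_ideal_cons => //; split; first exact: loc_idealM.
  by rewrite mulrC; apply: loc_idealM.
have [m hm em] := IH _ ucs h1.
exists (fun x => if x == c then n2 else m x) => [x|].
  by rewrite inE; case: eqP => [->|_] //=; apply: hm.
rewrite big_cons eqxx en em addnC; congr (_ + _)%N.
by apply: eq_big_seq => x hx; case: eqP => // e1; rewrite -e1 hx in hc.
Qed.
End Localize.

(** * Intersection multiplicities as orders of resultants *)

Lemma mpoly_ring_ind (n : nat) (R : nzRingType) (P : {mpoly R[n]} -> Prop) :
  (forall c, P c%:MP) -> (forall i, P 'X_i) ->
  (forall p q, P p -> P q -> P (p + q)) -> (forall p q, P p -> P q -> P (p * q)) ->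
  forall p, P p.
Proof.
move=> hC hX hD hM; elim/mpolyind => [|c m p _ _ hp]; first exact: (hC 0).
apply: hD => //; rewrite -mul_mpolyC; apply: (hM) => //.
rewrite mpolyXE_id; elim/big_ind: _ => [|x y|i _]; [exact: (hC 1)|exact: hM|].
by elim: (m i) => [|k IH]; [exact: (hC 1) | rewrite exprS; apply: hM].
Qed.

(* Coordinates ['X%:P] and ['X] around the points of the line [(x : y)] through [(0 : 0 : 1)],
   in the chart [t_2 = y] if [sw] and [t_1 = x] otherwise. *)
HB.lock Definition lsub (sw : bool) (R : comNzRingType) (x y : R) :
    {mpoly R[3]} -> {poly {poly R}} :=
  tsub polyC (x%:P + (if sw then 'X else 0)) (y%:P + (if sw then 0 else 'X)).
Canonical lsub_unlockable := Unlockable lsub.unlock.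

Lemma lsub_is_zmod_morphism sw (R : comNzRingType) (x y : R) : zmod_morphism (lsub sw x y).
Proof. by move=> p q; rewrite lsub.unlock [LHS]raddfB. Qed.

Lemma lsub_is_monoid_morphism sw (R : comNzRingType) (x y : R) : monoid_morphism (lsub sw x y).
Proof. by split=> [|p q]; rewrite lsub.unlock ?[LHS]rmorph1 // [LHS]rmorphM. Qed.

HB.instance Definition _ sw (R : comNzRingType) (x y : R) :=
  GRing.isZmodMorphism.Build {mpoly R[3]} {poly {poly R}} (lsub sw x y)
    (lsub_is_zmod_morphism sw x y).

HB.instance Definition _ sw (R : comNzRingType) (x y : R) :=
  GRing.isMonoidMorphism.Build {mpoly R[3]} {poly {poly R}} (lsub sw x y)
    (lsub_is_monoid_morphism sw x y).

Section LsubMorph.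
Variables (sw : bool) (R : comNzRingType) (x y : R).
Implicit Types p q : {mpoly R[3]}.

Lemma lsubB p q : lsub sw x y (p - q) = lsub sw x y p - lsub sw x y q.
Proof. exact: lsub_is_zmod_morphism. Qed.

Lemma lsubD p q : lsub sw x y (p + q) = lsub sw x y p + lsub sw x y q.
Proof. by rewrite lsub.unlock [LHS]raddfD. Qed.

Lemma lsubM p q : lsub sw x y (p * q) = lsub sw x y p * lsub sw x y q.
Proof. by case: (lsub_is_monoid_morphism sw x y) => _ ->. Qed.

Lemma lsubC c : lsub sw x y c%:MP = c%:P%:P.
Proof. by rewrite lsub.unlock tsubC. Qed.
End LsubMorph.

Definition lchart (sw : bool) : 'I_3 := if sw then inord 1 else inord 0.

Section Chart.
Variables (F : fieldType) (sw : bool) (x y : F).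
Local Notation Q := {poly {poly F}}.
Local Notation Phi := (lsub sw x y).
Local Notation ev0 := (map_poly (horner_eval (0 : F))).

Lemma ev0_lsub q c : (ev0 (Phi q)).[c] = q.@[pt3 x y c].
Proof.
rewrite lsub.unlock map_tsub horner_tsub /meval /=.
have -> : horner_eval 0 (x%:P + (if sw then 'X else 0)) = x.
  by rewrite /horner_eval; case: sw; rewrite !hornerE.
have -> : horner_eval 0 (y%:P + (if sw then 0 else 'X)) = y.
  by rewrite /horner_eval; case: sw; rewrite !hornerE.
by apply: eq_bigr => m _ /=; rewrite /horner_eval hornerC.
Qed.

Lemma lsub_surj s : exists q, Phi q = s.
Proof.
have hX2 : Phi 'X_(inord 2) = 'X by rewrite lsub.unlock tsubX /pt3 inordK.
have hC c : Phi c%:MP = c%:P%:P by rewrite lsub.unlock tsubC.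
have [q1 hq1] : exists q, Phi q = 'X%:P.
  exists ('X_(inord (if sw then 0 else 1)) - (if sw then x else y)%:MP).
  rewrite lsubB hC lsub.unlock tsubX /pt3. 
  by case: sw; rewrite inordK //= polyCD addrAC subrr add0r.
elim/poly_ind: s => [|s c [q <-]]; first by exists 0; rewrite rmorph0.
have [q' <-] : exists q', Phi q' = c%:P; last first.
  by exists (q * 'X_(inord 2) + q'); rewrite rmorphD rmorphM /= hX2.
elim/poly_ind: c => [|c a [q' hq']]; first by exists 0; rewrite rmorph0.
by exists (q' * q1 + a%:MP); rewrite rmorphD rmorphM /= hq' hq1 hC -polyCM -polyCD.
Qed.

Let z := if sw then y else x.

Lemma lsub_chart : Phi ('X_(lchart sw) - z%:MP) = 0.
Proof.
rewrite lsubB lsub.unlock tsubC tsubX /z /lchart /pt3.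
by case: sw; rewrite inordK //= addr0 subrr.
Qed.

(** [psi] undoes the substitution. The difference [p - psi (Phi p)] is a multiple of the chart
    equation on constants and variables, hence for every [p]. *)
Lemma lsub_eq0 q : Phi q = 0 -> exists r, q = ('X_(lchart sw) - z%:MP) * r.
Proof.
pose w := if sw then x else y; pose l : 'I_3 := inord (if sw then 0 else 1).
have [psi [psiC psiX psiP]] : exists psi : {rmorphism Q -> {mpoly F[3]}},
    [/\ forall a, psi a%:P%:P = a%:MP, psi 'X = 'X_(inord 2) & psi 'X%:P = 'X_l - w%:MP].
  pose psi1 := horner_eval ('X_l - w%:MP) \o map_poly (@mpolyC 3 F).
  exists (GRing.RMorphism.clone _ _ (horner_eval 'X_(inord 2) \o map_poly psi1) _).
  split=> [a||] /=.
  - by rewrite map_polyC /horner_eval hornerC /psi1 /= map_polyC /horner_eval hornerC.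
  - by rewrite map_polyX /horner_eval hornerX.
  - by rewrite map_polyC /horner_eval hornerC /psi1 /= map_polyX /horner_eval hornerX.
suff h p : exists r, p - psi (Phi p) = ('X_(lchart sw) - z%:MP) * r.
  by move=> h0; have := h q; rewrite h0 rmorph0 subr0.
elim/mpoly_ring_ind: p => [c|i|p1 p2 [r1 h1] [r2 h2]|p1 p2 [r1 h1] [r2 h2]].
- by exists 0; rewrite lsub.unlock tsubC psiC subrr mulr0.
- case: (eqVneq i (lchart sw)) => [->|ne].
    exists 1; rewrite mulr1; congr (_ - _); rewrite lsub.unlock tsubX /pt3 /lchart /z.
    by case: sw; rewrite inordK //= addr0 psiC.
  exists 0; rewrite mulr0; apply/eqP; rewrite subr_eq0; apply/eqP.
  have [e|ne2] := eqVneq i (inord 2).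
    by rewrite e lsub.unlock tsubX /pt3 inordK //= psiX.
  have -> : i = inord (if sw then 0 else 1).
    apply/val_inj; move: ne ne2; rewrite -!val_eqE /lchart; case: i => i hi.
    by case: sw; rewrite /= !inordK //; move: i hi => [|[|[|]]].
  rewrite -/l lsub.unlock tsubX /pt3; rewrite /l /w in psiP *.
  by case: sw psiP => psiP; rewrite inordK //= polyCD rmorphD /= psiP psiC; ring.
- exists (r1 + r2); rewrite rmorphD /= rmorphD /= mulrDr -h1 -h2; ring.
exists (r1 * p2 + psi (Phi p1) * r2).
by rewrite rmorphM /= rmorphM /= mulrDr mulrA -h1 mulrCA -h2; ring.
Qed.
End Chart.

Section IntMult.
Variables (F : closedFieldType) (sw : bool) (x y c : F).
Hypothesis hchart : chart (pt3 x y c) = lchart sw.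
Variables f g : {mpoly F[3]}.
Local Notation Phi := (lsub sw x y).
Local Notation A := (pt3 x y c).

(** By [lsub_surj] and [lsub_eq0], [Phi] is exactly the quotient by the chart equation, and [u(A)]
    is the value of [Phi u] at the point [c] of the fibre. *)
Lemma in_local_idealP s :
  in_local_ideal f g A s <-> loc_ideal (Phi f) (Phi g) [:: c] (Phi s).
Proof.
have Az : A (lchart sw) = if sw then y else x.
  by rewrite /pt3 /lchart; case: sw; rewrite inordK.
split=> [[u [a [b [r [u0 e]]]]]|[u u0 [a [b e]]]].
  exists (Phi u); first by move=> z; rewrite inE => /eqP ->; rewrite ev0_lsub.
  exists (Phi a), (Phi b); rewrite -!rmorphM -rmorphD /= e hchart Az.
  by rewrite [LHS]rmorphD /= [X in _ + X]rmorphM /= lsub_chart mul0r addr0.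
have [u' eu] := lsub_surj sw x y u; have [a' ea] := lsub_surj sw x y a.
have [b' eb] := lsub_surj sw x y b.
have [r er] : exists r, u' * s - (a' * f + b' * g) = ('X_(lchart sw) - (A (lchart sw))%:MP) * r.
  rewrite Az; apply: lsub_eq0; rewrite lsubB lsubD !lsubM eu ea eb e.
  by rewrite subrr.
exists u', a', b', r; split; last by rewrite hchart -er addrC subrK.
by rewrite -(ev0_lsub sw) eu u0 // mem_head.
Qed.

(** Preimages of the standard basis are independent, and more than [m] vectors of [F^m] satisfy a
    linear relation. *)
Lemma int_multP m : codim (loc_ideal (Phi f) (Phi g) [:: c]) m -> int_mult f g A m.
Proof.
move=> [phi [l s k]].
have kP q : phi (Phi q) = 0 <-> in_local_ideal f g A q.
  by split=> [/k/in_local_idealP|/in_local_idealP/k].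
have lC n (d h : 'I_n -> _) : phi (Phi (\sum_(i < n) d i *: h i)) =
    \sum_(i < n) d i *: phi (Phi (h i)).
  rewrite -linC_sum // raddf_sum; congr phi; apply: eq_bigr => i _.
  by rewrite /= -mul_mpolyC lsubM lsubC mul_polyC.
split.
  have [b hb] : exists b : 'I_m -> {mpoly F[3]}, forall i, phi (Phi (b i)) = delta_mx 0 i.
    apply: (fin_all_exists (P := fun i q => phi (Phi q) = delta_mx 0 i)) => i.
    by have [v <-] := s (delta_mx 0 i); have [q <-] := lsub_surj sw x y v; exists q.
  pose h := mkseq (fun i => if insub i is Some j then b j else 0) m.
  have sh : size h = m by rewrite size_mkseq.
  exists h; split=> // d sd; rewrite sh => /kP; rewrite lC => e i.
  have [im|im] := ltnP i m; last by rewrite nth_default // sd sh.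
  have : \row_(j < m) d`_j = 0.
    rewrite -e [LHS]row_sum_delta; apply: eq_bigr => j _; rewrite mxE; congr (_ *: _).
    by rewrite nth_mkseq ?ltn_ord // valK hb.
  by move/rowP => /(_ (Ordinal im)); rewrite !mxE.
move=> h hi; rewrite leqNgt; apply/negP => hm.
have [v v0 hv] := row_kernel (\matrix_(i < size h) phi (Phi h`_i)) hm.
case/negP: v0; apply/eqP/rowP => i; rewrite mxE.
pose d := mkseq (fun i => if insub i is Some j then v 0 j else 0) (size h).
have dE j : d`_(nat_of_ord j) = v 0 j by rewrite nth_mkseq ?ltn_ord // valK.
rewrite -dE; apply: (hi d); first by rewrite size_mkseq.
apply/kP; rewrite lC -[RHS]hv mulmx_sum_row; apply: eq_bigr => j _.
by rewrite dE rowK.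
Qed.
End IntMult.

Lemma enum_ord3 : enum 'I_3 = [:: inord 0; inord 1; inord 2].
Proof. by apply: (inj_map val_inj); rewrite val_enum_ord /= !inordK. Qed.

Lemma chart_pt3 (F : fieldType) (x y c : F) :
  chart (pt3 x y c) = if x != 0 then lchart false
                      else if y != 0 then lchart true
                      else odflt ord0 (ohead [seq k <- [:: inord 2] | pt3 x y c k != 0]).
Proof.
have -> : chart (pt3 x y c) = odflt ord0 (ohead [seq k <- enum 'I_3 | pt3 x y c k != 0]).
  by rewrite /chart /pick enumT; congr (odflt _ (ohead _)).
have h0 : pt3 x y c (inord 0) = x by rewrite /pt3 inordK.
have h1 : pt3 x y c (inord 1) = y by rewrite /pt3 inordK.
by rewrite enum_ord3 /= h0 h1; case: (x != 0) => //=; case: (y != 0).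
Qed.

Lemma int_mult_sum (F : closedFieldType) (sw : bool) (x y : F) (f g : {mpoly F[3]})
    (e : nat) (w : {poly F}) (cs : seq F) :
  (forall c, chart (pt3 x y c) = lchart sw) ->
  lead_coef (lsub sw x y f) \is a GRing.unit -> lead_coef (lsub sw x y g) \is a GRing.unit ->
  resultant (lsub sw x y f) (lsub sw x y g) = 'X^e * w -> w.[0] != 0 ->
  uniq cs ->
  (forall c, f.@[pt3 x y c] = 0 -> g.@[pt3 x y c] = 0 -> c \in cs) ->
  exists2 m : F -> nat, forall c, c \in cs -> int_mult f g (pt3 x y c) (m c)
                      & e = (\sum_(c <- cs) m c)%N.
Proof.
move=> hch f0 g0 hres hw ucs hcs.
have hc := codim_ideal_loc f0 g0 hres hw.
have {hc} hc : codim (loc_ideal (lsub sw x y f) (lsub sw x y g) cs) e.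
  apply: codim_ext hc => s; apply: (loc_ideal_all f0 g0 hres hw) => c.
  by rewrite !rootE !ev0_lsub => /eqP h1 /eqP h2; apply: hcs.
have [m hm em] := codim_loc_sum f0 g0 hres hw ucs hc.
by exists m => // c /hm; apply: int_multP.
Qed.

(** The shape of the Sylvester matrix depends on the degrees, so both leading coefficients must
    survive [h]. This is why the specializations that follow all carry nonvanishing side
    conditions. *)
Lemma resultant_map (R S : nzRingType) (h : {rmorphism R -> S}) (p q : {poly R}) :
  h (lead_coef p) != 0 -> h (lead_coef q) != 0 ->
  h (resultant p q) = resultant (map_poly h p) (map_poly h q).
Proof.
move=> hp hq; rewrite /resultant /Sylvester_mx !size_map_poly_id0 // -det_map_mx /= map_col_mx.
by congr (\det (col_mx _ _)); apply: map_lin1_mx => v; rewrite map_poly_rV rmorphM /= map_rVpoly.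
Qed.

Lemma coef_lead (R : nzRingType) (p : {poly R}) n :
  (size p <= n.+1)%N -> p`_n != 0 -> size p = n.+1 /\ lead_coef p = p`_n.
Proof.
move=> sp pn; have sz : size p = n.+1.
  apply/eqP; rewrite eqn_leq sp /= ltnNge; apply: contra_neqN pn => h.
  by rewrite nth_default.
by split=> //; rewrite lead_coefE sz.
Qed.

Lemma size_comb (R : nzRingType) (w : 'I_4 -> R) (q : 'I_4 -> {poly R}) n :
  (forall i, (size (q i) <= n.+1)%N) -> (size (\sum_(i < 4) w i *: q i)%R <= n.+1)%N.
Proof.
move=> h; apply: leq_trans (size_sum _ _ _) _; apply/bigmax_leqP => i _.
exact: leq_trans (size_scale_leq _ _) (h i).
Qed.

Lemma map_comb (R S : nzRingType) (h : {rmorphism R -> S}) (w : 'I_4 -> R) (q : 'I_4 -> {poly R}) :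
  map_poly h (\sum_(i < 4) w i *: q i) = \sum_(i < 4) h (w i) *: map_poly h (q i).
Proof. by rewrite rmorph_sum; apply: eq_bigr => i _; rewrite /= map_polyZ. Qed.

Lemma coef_comb (R : nzRingType) (w : 'I_4 -> R) (q : 'I_4 -> {poly R}) n :
  (\sum_(i < 4) w i *: q i)`_n = \sum_(i < 4) w i * (q i)`_n.
Proof. by rewrite coef_sum; apply: eq_bigr => i _; rewrite coefZ. Qed.

Lemma resultant_comb_map (R S : nzRingType) (h : {rmorphism R -> S}) (w1 w2 : 'I_4 -> R)
    (q : 'I_4 -> {poly R}) n :
  (forall i, (size (q i) <= n.+1)%N) ->
  \sum_(i < 4) h (w1 i) * h (q i)`_n != 0 -> \sum_(i < 4) h (w2 i) * h (q i)`_n != 0 ->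
  h (resultant (\sum_(i < 4) w1 i *: q i) (\sum_(i < 4) w2 i *: q i)) =
  resultant (\sum_(i < 4) h (w1 i) *: map_poly h (q i))
            (\sum_(i < 4) h (w2 i) *: map_poly h (q i)).
Proof.
move=> sq h1 h2; have key (w : 'I_4 -> R) : \sum_(i < 4) h (w i) * h (q i)`_n != 0 ->
    h (lead_coef (\sum_(i < 4) w i *: q i)) != 0.
  set U := \sum_(i < 4) _ *: _ => hv.
  have e1 : h U`_n = \sum_(i < 4) h (w i) * h (q i)`_n.
    by rewrite coef_comb rmorph_sum; apply: eq_bigr => i _; rewrite /= rmorphM.
  have Un : U`_n != 0 by apply: contraNneq hv => e0; rewrite -e1 e0 rmorph0.
  by have [_ ->] := coef_lead (size_comb _ sq) Un; rewrite e1.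
by rewrite resultant_map ?key // !map_comb.
Qed.

(** * The universal resultant *)

Definition Ures (R : comNzRingType) (q : 'I_4 -> {poly R}) : {mpoly R[4 + 4]} :=
  resultant (\sum_(i < 4) 'X_(lshift 4 i) *: map_poly (@mpolyC (4 + 4) R) (q i))
            (\sum_(i < 4) 'X_(rshift 4 i) *: map_poly (@mpolyC (4 + 4) R) (q i)).

Lemma Ures_spec (R S : comNzRingType) (h : {rmorphism R -> S}) (w : 'I_(4 + 4) -> S)
    (q : 'I_4 -> {poly R}) n :
  (forall i, (size (q i) <= n.+1)%N) ->
  \sum_(i < 4) w (lshift 4 i) * h (q i)`_n != 0 ->
  \sum_(i < 4) w (rshift 4 i) * h (q i)`_n != 0 ->
  mmap h w (Ures q) = resultant (\sum_(i < 4) w (lshift 4 i) *: map_poly h (q i))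
                                (\sum_(i < 4) w (rshift 4 i) *: map_poly h (q i)).
Proof.
move=> sq hl hr.
have mE i : map_poly (mmap h w) (map_poly (@mpolyC (4 + 4) R) (q i)) = map_poly h (q i).
  by rewrite -map_poly_comp; apply: eq_map_poly => z; rewrite /= mmapC.
have sC i : (size (map_poly (@mpolyC (4 + 4) R) (q i)) <= n.+1)%N.
  exact: leq_trans (size_poly _ _) (sq i).
have cE (v : 'I_4 -> 'I_(4 + 4)) :
    \sum_(i < 4) mmap h w 'X_(v i) * mmap h w (map_poly (@mpolyC (4 + 4) R) (q i))`_n
    = \sum_(i < 4) w (v i) * h (q i)`_n.
  by apply: eq_bigr => i _; rewrite mmapX mmap1U coef_map /= mmapC.
rewrite /Ures (resultant_comb_map (h := mmap h w) sC) /= ?cE //.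
by congr resultant; apply: eq_bigr => i _; rewrite mE mmapX mmap1U.
Qed.

Lemma resultant_neq0 (K : closedFieldType) (p q : {poly K}) :
  (forall x, root p x -> root q x -> False) -> resultant p q != 0.
Proof.
move=> h; rewrite resultant_eq0 -leqNgt leqNgt; apply/negP => sg.
have /closed_rootP[x] : size (gcdp p q) != 1%N by rewrite neq_ltn sg orbT.
by rewrite root_gcd => /andP[]; apply: h.
Qed.

Lemma resultant_common_root (K : fieldType) (p q : {poly K}) x :
  p != 0 -> root p x -> root q x -> resultant p q = 0.
Proof.
move=> p0 px qx; apply/eqP; rewrite resultant_eq0.
apply: (@root_size_gt1 _ x); first by rewrite gcdp_eq0 negb_and p0.
by rewrite root_gcd px.
Qed.

(** * Generic combinations and their common roots *)

Section GenericCombination.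
Variable K : closedFieldType.
Hypothesis char0 : [pchar K] =i pred0.

(** The coefficients are sought on the moment curve [(1, t, t^2, t^3)], where each condition
    excludes only the roots of a nonzero polynomial in [t]. *)
Lemma nonvanishing_comb (vs : seq {ffun 'I_4 -> K}) : 0 \notin vs ->
  exists y : 'I_4 -> K, forall v, v \in vs -> \sum_(i < 4) y i * v i != 0.
Proof.
move=> h; pose P (v : {ffun 'I_4 -> K}) := \poly_(i < 4) v (inord i).
have [t ht] : exists t, (\prod_(v <- vs) P v).[t] != 0.
  apply: poly_nonroot => //; rewrite prodf_seq_neq0; apply/allP => v hv /=.
  apply: contraNneq h => /polyP e; suff -> : 0 = v by [].
  apply/esym/ffunP => i; rewrite ffunE; have := e i.
  by rewrite coef_poly ltn_ord inord_val coef0.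
exists (fun i => t ^+ i) => v hv; move: ht; rewrite horner_prod prodf_seq_neq0 => /allP/(_ _ hv) /=.
rewrite horner_poly; congr (_ != 0); apply: eq_bigr => i _.
by rewrite inord_val mulrC.
Qed.

(** One good specialization suffices: the first combination becomes [q 0], and the second is chosen
    to keep degree [n] and to avoid the finitely many roots of [q 0]. *)
Lemma Ures_neq0 (q : 'I_4 -> {poly K}) n :
  (forall i, size (q i) = n.+1) -> (forall x, exists i, ~~ root (q i) x) -> Ures q != 0.
Proof.
move=> sq hroot; have [rs hrs] := closed_field_poly_normal (q 0).
have lq i : (q i)`_n != 0.
  have -> : n = (size (q i)).-1 by rewrite sq.
  by rewrite -lead_coefE lead_coef_eq0 -size_poly_eq0 sq.
pose vs := [ffun i => (q i)`_n] :: [seq [ffun i => (q i).[x]] | x <- rs].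
have [|y hy] := nonvanishing_comb (vs := vs).
  apply/negP; rewrite inE => /orP[/eqP/ffunP/(_ 0)|/mapP[x _ /ffunP e]].
    by rewrite !ffunE => /eqP; rewrite eq_sym (negbTE (lq 0)).
  have [i] := hroot x; rewrite rootE.
  by have := e i; rewrite !ffunE => <-; rewrite eqxx.
pose w (j : 'I_(4 + 4)) : K := match split j with inl i => (i == 0)%:R | inr i => y i end.
have wl i : w (lshift 4 i) = (i == 0)%:R by rewrite /w (unsplitK (inl i)).
have wr i : w (rshift 4 i) = y i by rewrite /w (unsplitK (inr i)).
have sel (T : lmodType K) (f : 'I_4 -> T) : \sum_(i < 4) w (lshift 4 i) *: f i = f 0.
  by rewrite (bigD1 0) //= wl eqxx scale1r big1 ?addr0 // => i /negbTE hi; rewrite wl hi scale0r.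
have hn : \sum_(i < 4) w (rshift 4 i) * (q i)`_n != 0.
  have := hy _ (mem_head _ _); apply: contra_neq => e; rewrite -[RHS]e.
  by apply: eq_bigr => i _; rewrite wr ffunE.
have hl : \sum_(i < 4) w (lshift 4 i) * (q i)`_n != 0.
  by rewrite [X in X != 0](sel K^o (fun i => (q i)`_n)).
suff : mmap idfun w (Ures q) != 0 by apply: contraNneq => ->; rewrite raddf0.
rewrite (@Ures_spec K K idfun w q n) // => [|i]; last by rewrite sq.
apply: resultant_neq0 => x; rewrite sel map_poly_id // hrs rootZ; last first.
  by rewrite lead_coef_eq0 -size_poly_eq0 sq.
rewrite root_prod_XsubC => hx.
have : [ffun i => (q i).[x]] \in vs by rewrite inE map_f ?orbT.
move/hy => hxy /eqP; rewrite horner_sum; apply/eqP; apply: contra_neq hxy => e; rewrite -[RHS]e.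
by apply: eq_bigr => i _; rewrite wr ffunE hornerZ map_poly_id.
Qed.
End GenericCombination.

HB.instance Definition _ (K F : fieldType) (iota : {rmorphism {mpoly K[4 + 4]} -> F}) :=
  GRing.RMorphism.copy (kF iota) (iota \o @mpolyC (4 + 4) K).

Section GenericLines.
Variables (K F : closedFieldType) (iota : {rmorphism {mpoly K[4 + 4]} -> F}).
Hypotheses (char0 : [pchar K] =i pred0) (iota_inj : injective iota).
Local Notation kf := (kF iota).
Local Notation w := (fun j => iota 'X_j).

Lemma mmap_iota : mmap kf w =1 iota.
Proof. by apply: mpoly_rmorph_eq => [c|i]; rewrite /= ?mmapC ?mmapX ?mmap1U. Qed.

Lemma iota_comb_neq0 (v : 'I_4 -> 'I_(4 + 4)) (c : 'I_4 -> K) :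
  injective v -> c 0 != 0 -> \sum_(i < 4) w (v i) * kf (c i) != 0.
Proof.
move=> vi c0.
have -> : \sum_(i < 4) w (v i) * kf (c i) = iota (\sum_(i < 4) c i *: 'X_(v i)).
  by rewrite rmorph_sum; apply: eq_bigr => i _; rewrite /= -mul_mpolyC rmorphM mulrC.
rewrite -(rmorph0 iota) (inj_eq iota_inj); apply: contraNneq c0.
move/(congr1 (mcoeff U_(v 0))); rewrite raddf_sum /= (bigD1 0) //= mcoeffZ mcoeffXU eqxx mulr1.
rewrite big1 ?addr0 ?mcoeff0 => [->//|i i0].
by rewrite mcoeffZ mcoeffXU (inj_eq vi) (negbTE i0) mulr0.
Qed.

(** Common linear factors over [K] are removed by induction on the degree. Once none is left,
    [Ures_neq0] and the injectivity of [iota] give a nonzero resultant, so the two combinations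
    share no root even over [F]. *)
Lemma generic_common_root (q : 'I_4 -> {poly K}) n c : (forall i, size (q i) = n.+1) ->
  root (\sum_(i < 4) w (lshift 4 i) *: map_poly kf (q i)) c ->
  root (\sum_(i < 4) w (rshift 4 i) *: map_poly kf (q i)) c ->
  exists2 c0, c = kf c0 & forall i, root (q i) c0.
Proof.
elim: n q => [|n IH] q sq hl hr.
  have h0 : \sum_(i < 4) w (lshift 4 i) * kf (q i)`_0 != 0.
    apply: iota_comb_neq0; first exact: lshift_inj.
    by have := lead_coef_eq0 (q 0); rewrite -size_poly_eq0 lead_coefE sq /= => ->.
  case/negP: h0; move: hl; rewrite rootE horner_sum; apply: etrans; congr (_ == _).
  apply: eq_bigr => i _; rewrite hornerZ; congr (_ * _).
  by have /eq_leq/size1_polyC -> := sq i; rewrite map_polyC !hornerC coefC.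
have [rs hrs] := closed_field_poly_normal (q 0).
have l0 : lead_coef (q 0) != 0 by rewrite lead_coef_eq0 -size_poly_eq0 sq.
have [/hasP[z zrs /forallP hz]|/hasPn hno] := boolP (has (fun z => [forall i, root (q i) z]) rs).
  have [q' hq'] : exists q' : 'I_4 -> {poly K}, forall i, q i = q' i * ('X - z%:P).
    apply: (fin_all_exists (P := fun i q' => q i = q' * ('X - z%:P))) => i.
    exact/factor_theorem.
  have sq' i : size (q' i) = n.+1.
    have := sq i; rewrite hq' size_Mmonic ?monicXsubC ?size_XsubC //; first by rewrite addn2 => -[].
    by apply/eqP => e; have := sq i; rewrite hq' e mul0r size_poly0.
  have fact (v : 'I_4 -> 'I_(4 + 4)) : \sum_(i < 4) w (v i) *: map_poly kf (q i) =
      (\sum_(i < 4) w (v i) *: map_poly kf (q' i)) * ('X - (kf z)%:P).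
    rewrite mulr_suml; apply: eq_bigr => j _.
    by rewrite hq' rmorphM /= map_polyXsubC scalerAl.
  move: hl hr; rewrite !fact !rootM !root_XsubC.
  have [->|_] := eqVneq c (kf z); first by move=> _ _; exists z.
  rewrite ?orbF => hl hr; have [c0 e0 hc0] := IH q' sq' hl hr.
  by exists c0 => // i; rewrite hq' rootM hc0.
have U0 : Ures q != 0.
  apply: (Ures_neq0 char0 sq) => x; apply/existsP; rewrite -negb_forall.
  have [hx|hx] := boolP (x \in rs); first exact: hno.
  apply: contra hx => /forallP/(_ 0); rewrite hrs rootZ // root_prod_XsubC //.
have lc i : (q i)`_n.+1 != 0.
  by have := lead_coef_eq0 (q i); rewrite -size_poly_eq0 lead_coefE sq /= => ->.
have nl := iota_comb_neq0 (c := fun i => (q i)`_n.+1) (@lshift_inj 4 4) (lc 0).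
have nr := iota_comb_neq0 (c := fun i => (q i)`_n.+1) (@rshift_inj 4 4) (lc 0).
have := @Ures_spec _ _ kf w q n.+1 (fun i => eq_leq (sq i)) nl nr.
rewrite mmap_iota (resultant_common_root _ hl hr) => [e|].
  by case/negP: U0; rewrite -(inj_eq iota_inj) e rmorph0.
apply: contraNneq nl => /polyP/(_ n.+1); rewrite coef_comb coef0 => e; rewrite -[X in _ == X]e.
by apply/eqP/eq_bigr => i _; rewrite coef_map.
Qed.
End GenericLines.

(** * The order of the universal resultant along a line *)

Lemma mpoly_Xval (K : fieldType) n (q : {mpoly {poly K}[n]}) : q != 0 ->
  exists e q', q = ('X^e)%:MP * q' /\ map_mpoly (horner_eval 0) q' != 0.
Proof.
move=> q0; have [m hm] : exists m, q@_m != 0.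
  by exists (mlead q); rewrite mleadc_eq0.
have [N] := ubnP (size q@_m); elim: N q {q0} hm => // N IH q hm hN.
have [e0|ne0] := eqVneq (map_mpoly (horner_eval (0 : K)) q) 0; last first.
  by exists 0%N, q; rewrite expr0 mul1r.
pose q1 := map_mpoly (drop_poly 1) q.
have eq1 : q = 'X%:MP * q1.
  apply/mpolyP => m'; rewrite mcoeffCM mcoeff_map_mpoly.
  rewrite {1}[q@_m']mulX_drop_poly mulrC -horner_coef0.
  have -> : (q@_m').[0] = (map_mpoly (horner_eval (0 : K)) q)@_m' by rewrite mcoeff_map_mpoly.
  by rewrite e0 mcoeff0 addr0.
have [||e [q' [eq' hq']]] := IH q1.
- by apply: contraNneq hm => e1; rewrite eq1 mcoeffCM e1 mulr0.
- have : size q@_m = (size q1@_m).+1.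
    rewrite {1}eq1 mcoeffCM mulrC size_mulX //.
    by apply: contraNneq hm => e1; rewrite eq1 mcoeffCM e1 mulr0.
  by move=> e1; rewrite e1 in hN.
by exists e.+1, q'; split=> //; rewrite eq1 eq' mulrA -mpolyCM -exprS.
Qed.

Lemma eq_int_mult (F : fieldType) (f g : {mpoly F[3]}) (A B : 'I_3 -> F) m :
  A =1 B -> int_mult f g A m -> int_mult f g B m.
Proof.
move=> AB; have cAB : chart A = chart B.
  by rewrite /chart; congr odflt; apply: eq_pick => k; rewrite AB.
have lAB s : in_local_ideal f g A s <-> in_local_ideal f g B s.
  split=> -[u [a [b [r [u0 e]]]]]; exists u, a, b, r.
    by rewrite -(meval_eq _ AB) -AB -cAB.
  by rewrite (meval_eq _ AB) AB cAB.
move=> [[h [sh hi]] hmax]; split.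
  by exists h; split=> // c sc /lAB; apply: hi.
by move=> h' hi'; apply: hmax => c sc /lAB; apply: hi'.
Qed.

Lemma lead_lsub sw (R : comNzRingType) (x y : R) (q : {mpoly R[3]}) d :
  q \is d.-homog -> (lsub sw x y q)`_d = (q.@[@e3 R])%:P.
Proof. by move=> hq; rewrite lsub.unlock lead_tsub. Qed.

Lemma size_lsub sw (R : comNzRingType) (x y : R) (q : {mpoly R[3]}) d :
  q \is d.-homog -> (size (lsub sw x y q) <= d.+1)%N.
Proof. by move=> hq; rewrite lsub.unlock size_tsub. Qed.

Lemma eq_tsub (R : nzRingType) (S : comNzRingType) (g g' : R -> S) x y q :
  g =1 g' -> tsub g x y q = tsub g' x y q.
Proof. by move=> e; apply/polyP => j; rewrite !coef_tsub; apply: eq_bigr => m _; rewrite e. Qed.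

Lemma lsub_map sw (R S : comNzRingType) (h : {rmorphism R -> S}) x y q :
  lsub sw (h x) (h y) (map_mpoly h q) = map_poly (map_poly h) (lsub sw x y q).
Proof.
rewrite !lsub.unlock tsub_map map_tsub !rmorphD /= !map_polyC.
have e b : map_poly h (if b then 'X else 0) = if b then 'X else 0.
  by case: b; rewrite ?map_polyX ?raddf0.
have e' b : map_poly h (if b then 0 else 'X) = if b then 0 else 'X.
  by case: b; rewrite ?map_polyX ?raddf0.
rewrite e e'; apply: eq_tsub => c /=; by rewrite map_polyC.
Qed.

Section LineW.
Variables (K F : closedFieldType) (iota : {rmorphism {mpoly K[4 + 4]} -> F}).
Hypotheses (char0 : [pchar K] =i pred0) (iota_inj : injective iota).
Variables (p : 'I_4 -> {mpoly K[3]}) (d : nat).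
Hypotheses (hhom : forall i, p i \is d.-homog) (hp001 : forall i, (p i).@[e3 K] != 0).
Variables (sw : bool) (x y : K).
Hypothesis hch : forall c : F, chart (pt3 (kF iota x) (kF iota y) c) = lchart sw.
Local Notation kf := (kF iota).

Lemma kf_inj : injective kf.
Proof. by move=> a b /iota_inj/eqP; rewrite mpolyC_eq => /eqP. Qed.

Definition line_res : {mpoly {poly K}[4 + 4]} := Ures (fun i => lsub sw x y (p i)).

Let wF (j : 'I_(4 + 4)) : {poly F} := (iota 'X_j)%:P.

Lemma lsub_W (v : 'I_4 -> 'I_(4 + 4)) :
  lsub sw (kf x) (kf y) (\sum_(i < 4) iota 'X_(v i) *: map_mpoly kf (p i)) =
  \sum_(i < 4) wF (v i) *: map_poly (map_poly kf) (lsub sw x y (p i)).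
Proof.
rewrite raddf_sum; apply: eq_bigr => i _ /=.
by rewrite -mul_mpolyC lsubM lsubC lsub_map mul_polyC.
Qed.

Lemma lead_W (v : 'I_4 -> 'I_(4 + 4)) : injective v ->
  exists2 b, b != 0 & \sum_(i < 4) wF (v i) * map_poly kf (lsub sw x y (p i))`_d = b%:P.
Proof.
move=> vi; exists (\sum_(i < 4) iota 'X_(v i) * kf (p i).@[e3 K]).
  exact: (iota_comb_neq0 iota_inj (c := fun i => (p i).@[e3 K])).
rewrite rmorph_sum; apply: eq_bigr => i _ /=.
by rewrite lead_lsub // map_polyC /= -polyCM.
Qed.

Lemma line_mult (e : nat) (R' : {mpoly {poly K}[4 + 4]}) (cs : seq K) :
  line_res = ('X^e)%:MP * R' -> map_mpoly (horner_eval 0) R' != 0 -> uniq cs ->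
  (forall c, (forall i, (p i).@[pt3 x y c] = 0) -> c \in cs) ->
  exists2 m : K -> nat,
    forall c, c \in cs -> int_mult (W1 iota p) (W2 iota p) (fun j => kf (pt3 x y c j)) (m c)
  & e = (\sum_(c <- cs) m c)%N.
Proof.
move=> hR hR' ucs hcs.
have [b1 b10 hb1] := lead_W (@lshift_inj 4 4).
have [b2 b20 hb2] := lead_W (@rshift_inj 4 4).
have szl i : (size (lsub sw x y (p i)) <= d.+1)%N by apply: size_lsub.
have szF i : (size (map_poly (map_poly kf) (lsub sw x y (p i))) <= d.+1)%N.
  exact: leq_trans (size_poly _ _) (szl i).
have unitW (v : 'I_4 -> 'I_(4 + 4)) b : b != 0 ->
    \sum_(i < 4) wF (v i) * map_poly kf (lsub sw x y (p i))`_d = b%:P ->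
    lead_coef (\sum_(i < 4) wF (v i) *: map_poly (map_poly kf) (lsub sw x y (p i)))
      \is a GRing.unit.
  move=> b0 hb; set U := \sum_(i < 4) _.
  have eU : U`_d = b%:P by rewrite -hb coef_comb; apply: eq_bigr => i _; rewrite coef_map.
  have U0 : U`_d != 0 by rewrite eU polyC_eq0.
  have [_ ->] := coef_lead (size_comb _ szF) U0.
  by rewrite eU poly_unitE size_polyC b0 coefC unitfE b0.
have hres : resultant (lsub sw (kf x) (kf y) (W1 iota p)) (lsub sw (kf x) (kf y) (W2 iota p))
    = 'X^e * mmap (map_poly kf) wF R'.
  rewrite !lsub_W -(@Ures_spec _ _ (map_poly kf) wF _ d) ?hb1 ?hb2 ?polyC_eq0 //.
  by rewrite -/line_res hR rmorphM /= mmapC /= map_polyXn.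
(* Setting [s = 0] commutes with [iota], so this value is the image of the nonzero reduction of [R']
   under an injective map. *)
have hw : (mmap (map_poly kf) wF R').[0] != 0.
  have -> : (mmap (map_poly kf) wF R').[0] = iota (map_mpoly (horner_eval 0) R').
    suff h : horner_eval 0 \o mmap (map_poly kf) wF =1 iota \o map_mpoly (horner_eval 0).
      by apply: h.
    apply: mpoly_rmorph_eq => [c|i] /=.
      by rewrite mmapC map_mpolyC /= /horner_eval !horner_coef0 coef_map.
    by rewrite mmapX mmap1U map_mpolyX /horner_eval hornerC.
  by rewrite -(rmorph0 iota) (inj_eq iota_inj).
have hl1 : lead_coef (lsub sw (kf x) (kf y) (W1 iota p)) \is a GRing.unit.
  by rewrite lsub_W; apply: unitW hb1.
have hl2 : lead_coef (lsub sw (kf x) (kf y) (W2 iota p)) \is a GRing.unit.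
  by rewrite lsub_W; apply: unitW hb2.
have ucs' : uniq (map kf cs) by rewrite map_inj_uniq //; apply: kf_inj.
(* The side goal is that the common zeros of [W_1] and [W_2] on the line, a priori over [F], all
   come from [cs]. *)
have [c h1 h2|m hm em] := int_mult_sum hch hl1 hl2 hres hw ucs'.
  pose q i := tsub idfun x y (p i).
  have sq i : size (q i) = d.+1.
    have qd : (q i)`_d != 0 by rewrite /q lead_tsub //=; apply: hp001.
    by have [] := coef_lead (size_tsub _ _ _ (hhom i)) qd.
  have hq (v : 'I_4 -> 'I_(4 + 4)) :
      (\sum_(i < 4) iota 'X_(v i) *: map_mpoly kf (p i)).@[pt3 (kf x) (kf y) c] =
      (\sum_(i < 4) iota 'X_(v i) *: map_poly kf (q i)).[c].
    rewrite raddf_sum horner_sum; apply: eq_bigr => i _ /=.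
    rewrite mevalZ hornerZ -horner_tsub_id tsub_map /q map_tsub.
    by congr (_ * horner _ _); apply: eq_tsub.
  have [] := generic_common_root char0 iota_inj (c := c) sq.
  - rewrite rootE -(hq (lshift 4)); apply/eqP; exact: h1.
  - rewrite rootE -(hq (@rshift 4 4)); apply/eqP; exact: h2.
  move=> c0 -> hc0; apply/map_f/hcs => i.
  by apply/eqP; rewrite -horner_tsub_id -rootE; apply: hc0.
exists (m \o kf); last by rewrite em big_map.
move=> c hc; apply: eq_int_mult (hm (kf c) (map_f _ hc)) => j.
by rewrite /pt3; case: ifP => _ //; case: ifP.
Qed.
End LineW.

(** * The resultant attached to a matrix *)

Section SpecM.
Variables (K : closedFieldType) (p : 'I_4 -> {mpoly K[3]}) (d : nat) (M : 'M[K]_3).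
Hypotheses (char0 : [pchar K] =i pred0).
Hypotheses (hhom : forall i, p i \is d.-homog) (hp001 : forall i, (p i).@[e3 K] != 0).
Local Notation Tt := {mpoly K[2]}.
Local Notation Bx := {mpoly Tt[4]}.

(* Coefficients of [x_4 L_r(P) - z L_4(P)] on [p_1, ..., p_4]. *)
Definition wrow (S : comNzRingType) (k : K -> S) (x4 z : S) (r : 'I_3) (i : 'I_4) : S :=
  if (i < 3)%N then x4 * k (M r (inord i)) else - z.

Definition wmx (S : comNzRingType) (k : K -> S) (X : 'I_4 -> S) (j : 'I_(4 + 4)) : S :=
  match split j with
  | inl i => wrow k (X ord_max) (X 0) 0 i
  | inr i => wrow k (X ord_max) (X (inord 2)) (inord 2) i
  end.

Lemma wmx_lshift S k X i : @wmx S k X (lshift 4 i) = wrow k (X ord_max) (X 0) 0 i.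
Proof. by rewrite /wmx (unsplitK (inl i)). Qed.

Lemma wmx_rshift S k X i :
  @wmx S k X (rshift 4 i) = wrow k (X ord_max) (X (inord 2)) (inord 2) i.
Proof. by rewrite /wmx (unsplitK (inr i)). Qed.

Lemma wrow_sum (S : comNzRingType) k (x4 z : S) r (f : 'I_4 -> S) :
  \sum_(i < 4) wrow k x4 z r i * f i =
  x4 * (\sum_(l < 3) k (M r l) * f (widen_ord (leqnSn 3) l)) - z * f ord_max.
Proof.
rewrite big_ord_recr /= {2}/wrow ltnn mulNr mulr_sumr; congr (_ - _).
by apply: eq_bigr => l _; rewrite /wrow /= ltn_ord inord_val mulrA.
Qed.

Lemma rmorph_wrow (S T : comNzRingType) (h : {rmorphism S -> T}) k x4 z r i :
  h (wrow k x4 z r i) = wrow (h \o k) (h x4) (h z) r i.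
Proof. by rewrite /wrow; case: ifP; rewrite ?rmorphM ?rmorphN. Qed.

Let k0 : K -> Bx := @mpolyC 4 Tt \o @mpolyC 2 K.

Lemma KL_comb (r : 'I_3) (z : Bx) :
  xv K ord_max * LP p M r - z%:P * L4P p =
  \sum_(i < 4) wrow k0 'X_ord_max z r i *: toBxt3 (p i).
Proof.
rewrite big_ord_recr /= {2}/wrow ltnn scaleNr -mul_polyC; congr (_ - _).
rewrite /LP mulr_sumr; apply: eq_bigr => l _.
by rewrite /wrow /= ltn_ord inord_val -mul_polyC polyCM mulrA.
Qed.

Lemma ResL_map (S : comNzRingType) (h : {rmorphism Bx -> S})
    (X := fun i => h 'X_i) (k := h \o k0) :
  \sum_(i < 4) wrow k (X ord_max) (X 0) 0 i * k (p i).@[e3 K] != 0 ->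
  \sum_(i < 4) wrow k (X ord_max) (X (inord 2)) (inord 2) i * k (p i).@[e3 K] != 0 ->
  h (ResL p M) =
  resultant
    (\sum_(i < 4) wrow k (X ord_max) (X 0) 0 i
       *: tsub k (h ('X_ord0)%:MP) (h ('X_(inord 1))%:MP) (p i))
    (\sum_(i < 4) wrow k (X ord_max) (X (inord 2)) (inord 2) i
       *: tsub k (h ('X_ord0)%:MP) (h ('X_(inord 1))%:MP) (p i)).
Proof.
have e1 : K1L p M = _ := KL_comb 0 'X_0.
have e2 : K2L p M = _ := KL_comb (inord 2) 'X_(inord 2).
move=> h1 h2; rewrite /ResL e1 e2 {e1 e2}.
have sT i : (size (toBxt3 (p i)) <= d.+1)%N by rewrite toBxt3E size_tsub.
have cE z r : \sum_(i < 4) h (wrow k0 'X_ord_max z r i) * h (toBxt3 (p i))`_d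
    = \sum_(i < 4) wrow k (X ord_max) (h z) r i * k (p i).@[e3 K].
  by apply: eq_bigr => i _; rewrite rmorph_wrow toBxt3E lead_tsub.
rewrite (resultant_comb_map sT) ?cE //.
by congr resultant; apply: eq_bigr => i _; rewrite rmorph_wrow toBxt3E map_tsub.
Qed.

Lemma wrow_lead_neq0 r (i : 'I_4) : i != ord_max ->
  \sum_(j < 4) wrow (@mpolyC 4 {poly K} \o polyC) 'X_ord_max 'X_i r j
    * (p j).@[e3 K]%:P%:MP != 0.
Proof.
move=> hi; rewrite wrow_sum; apply: contra_neq (hp001 ord_max).
move/(congr1 (meval (fun j => (j == i)%:R))); rewrite mevalB !mevalM !mevalXU eqxx.
rewrite eq_sym (negbTE hi) mul0r sub0r mul1r mevalC meval0 => /eqP.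
by rewrite oppr_eq0 polyC_eq0 => /eqP.
Qed.

Definition line_pt (sw : bool) (x y : K) (j : 'I_2) : {poly K} :=
  if j == 0 then x%:P + (if sw then 'X else 0) else y%:P + (if sw then 0 else 'X).

Lemma ResL_line sw x y :
  map_mpoly (mmap polyC (line_pt sw x y)) (ResL p M) =
  mmap (@mpolyC 4 {poly K}) (wmx (@mpolyC 4 {poly K} \o polyC) (fun i => 'X_i))
    (line_res p sw x y).
Proof.
have h1 := @wrow_lead_neq0 0 0 isT.
have h2 : \sum_(j < 4) wrow (@mpolyC 4 {poly K} \o polyC) 'X_ord_max 'X_(inord 2) (inord 2) j
    * (p j).@[e3 K]%:P%:MP != 0.
  by apply: wrow_lead_neq0; rewrite -val_eqE /= inordK.
pose h := map_mpoly (n := 4) (mmap polyC (line_pt sw x y)).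
have hX i : h 'X_i = 'X_i by rewrite /h map_mpolyX.
have hk c : h (k0 c) = c%:P%:MP by rewrite /h /k0 /= map_mpolyC /= mmapC.
have ht i : h ('X_i)%:MP = (line_pt sw x y i)%:MP by rewrite /h map_mpolyC /= mmapX mmap1U.
have eT i : tsub (h \o k0) (h ('X_ord0)%:MP) (h ('X_(inord 1))%:MP) (p i)
    = map_poly (@mpolyC 4 {poly K}) (lsub sw x y (p i)).
  rewrite lsub.unlock map_tsub !ht /line_pt -[inord 1 == 0]val_eqE /= inordK //=.
  exact: eq_tsub.
have eW z r i : wrow (h \o k0) (h 'X_ord_max) (h 'X_z) r i
    = wrow (@mpolyC 4 {poly K} \o polyC) 'X_ord_max 'X_z r i.
  by rewrite !hX /wrow; case: ifP => // _; rewrite /= hk.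
have eS z r : \sum_(i < 4) wrow (h \o k0) (h 'X_ord_max) (h 'X_z) r i * (h \o k0) (p i).@[e3 K]
    = \sum_(i < 4) wrow (@mpolyC 4 {poly K} \o polyC) 'X_ord_max 'X_z r i
        * (p i).@[e3 K]%:P%:MP.
  by apply: eq_bigr => i _; rewrite eW /= hk.
rewrite -/h [LHS](ResL_map (h := h)); [|by rewrite eS|by rewrite eS].
rewrite /line_res (@Ures_spec _ _ _ _ _ d) => [|i||].
- congr resultant; apply: eq_bigr => i _; rewrite eT eW ?wmx_lshift ?wmx_rshift //.
- exact: size_lsub.
- by move: h1; congr (_ != 0); apply: eq_bigr => i _; rewrite wmx_lshift lead_lsub.
by move: h2; congr (_ != 0); apply: eq_bigr => i _; rewrite wmx_rshift lead_lsub.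
Qed.

(** A single [X] with nonzero value shows that the specialized cofactor does not vanish identically
    in [x] at [s = 0]. So [e] is the exact minimum of the orders of the [x]-coefficients along the
    line. *)
Lemma ResL_order sw x y e (R' : {mpoly {poly K}[4 + 4]}) (X : 'I_4 -> K) :
  line_res p sw x y = ('X^e)%:MP * R' ->
  (map_mpoly (horner_eval 0) R').@[wmx idfun X] != 0 ->
  (forall m, exists s, mmap polyC (line_pt sw x y) (ResL p M)@_m = 'X^e * s) /\
  (exists m s, mmap polyC (line_pt sw x y) (ResL p M)@_m = 'X^e * s /\ s.[0] != 0).
Proof.
move=> hR hR'; have := ResL_line sw x y; rewrite hR rmorphM /= mmapC.
set R2 := mmap _ _ R' => e1.
have e2 m : mmap polyC (line_pt sw x y) (ResL p M)@_m = 'X^e * R2@_m.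
  by rewrite -mcoeffCM -e1 mcoeff_map_mpoly.
have [m hm] : exists m, (R2@_m).[0] != 0.
  have : map_mpoly (horner_eval 0) R2 != 0.
    apply: contraNneq hR' => e3; apply/eqP.
    have <- : (map_mpoly (horner_eval 0) R2).@[X] = (map_mpoly (horner_eval 0) R').@[wmx idfun X].
      suff h : meval X \o map_mpoly (horner_eval 0)
          \o mmap (@mpolyC 4 {poly K}) (wmx (@mpolyC 4 {poly K} \o polyC) (fun i => 'X_i))
          =1 meval (wmx idfun X) \o map_mpoly (horner_eval 0) by apply: h.
      apply: mpoly_rmorph_eq => [c|i] /=.
        by rewrite mmapC !map_mpolyC !mevalC.
      rewrite mmapX mmap1U map_mpolyX mevalXU /wmx.
      by case: (split i) => j; rewrite /wrow; case: ifP => _;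
        rewrite ?rmorphM ?rmorphN /= ?map_mpolyX ?mevalXU //
          map_mpolyC ?mevalM ?mevalC /= /horner_eval hornerC.
    by rewrite e3 meval0.
  move=> h; exists (mlead (map_mpoly (horner_eval 0) R2)).
  by rewrite -[_.[0]]/(horner_eval 0 _) -mcoeff_map_mpoly mleadc_eq0.
by split=> [m'|]; [exists R2@_m' | exists m, R2@_m].
Qed.

(** Values of [x] with nonzero resultant are constructed: [x_4 = 1], then [x_1] keeping the degree
    of the first polynomial, then [x_3] making the second nonzero at each root of the first. Where
    [p_4] is nonzero the last condition excludes one value of [x_3]; where [p_4] is zero it does not
    involve [x_3], and the hypothesis takes over. *)
Lemma ResL_off_base (x y : K) :
  (forall c, (p ord_max).@[pt3 x y c] = 0 ->
     \sum_(l < 3) M 0 l * (p (widen_ord (leqnSn 3) l)).@[pt3 x y c] = 0 ->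
     \sum_(l < 3) M (inord 2) l * (p (widen_ord (leqnSn 3) l)).@[pt3 x y c] = 0 -> False) ->
  exists m, ((ResL p M)@_m).@[fun j : 'I_2 => if j == 0 then x else y] != 0.
Proof.
move=> hM; set a := fun j : 'I_2 => _.
have avoid (s : seq K) : exists z, z \notin s.
  have [z hz] : exists z, (\prod_(x <- s) ('X - x%:P)).[z] != 0.
    apply: poly_nonroot => //; apply: monic_neq0; exact: monic_prod_XsubC.
  by exists z; rewrite -root_prod_XsubC.
pose q i := tsub idfun x y (p i).
pose g i := (p i).@[e3 K].
pose L (r : 'I_3) (f : 'I_4 -> K) := \sum_(l < 3) M r l * f (widen_ord (leqnSn 3) l).
have LE z r (f : 'I_4 -> K) : \sum_(i < 4) wrow idfun 1 z r i * f i = L r f - z * f ord_max.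
  by rewrite wrow_sum mul1r.
have outside z r (f : 'I_4 -> K) : f ord_max != 0 -> z != L r f / f ord_max ->
    \sum_(i < 4) wrow idfun 1 z r i * f i != 0.
  move=> f0; apply: contra_neq; rewrite LE => /eqP; rewrite subr_eq0 => /eqP ->.
  by rewrite mulfK.
have [z0 hz0] := avoid [:: L 0 g / g ord_max].
have hg0 : \sum_(i < 4) wrow idfun 1 z0 0 i * g i != 0.
  by apply: outside; [exact: hp001 | rewrite inE in hz0].
pose f1 := \sum_(i < 4) wrow idfun 1 z0 0 i *: q i.
have f10 : f1 != 0.
  apply: contra_neq hg0 => /polyP/(_ d); rewrite coef_comb coef0 => e; rewrite -[RHS]e.
  by apply: eq_bigr => i _; rewrite lead_tsub.
have [rs hrs] := closed_field_poly_normal f1.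
have [z2] := avoid (L (inord 2) g / g ord_max
   :: [seq L (inord 2) (fun i => (q i).[c]) / (q ord_max).[c] | c <- rs]).
rewrite inE negb_or => /andP[hz2 hz2'].
have hg2 : \sum_(i < 4) wrow idfun 1 z2 (inord 2) i * g i != 0.
  by apply: outside => //; exact: hp001.
pose X (i : 'I_4) := if i == 0 then z0 else if i == inord 2 then z2 else 1.
have i2 : (inord 2 == 0 :> 'I_4) = false by rewrite -val_eqE /= inordK.
have i3 : (ord_max == inord 2 :> 'I_4) = false by rewrite -val_eqE /= inordK.
pose h := mmap (meval a) X.
have hX i : h 'X_i = X i by rewrite /h mmapX mmap1U.
have hX3 : h 'X_ord_max = 1 by rewrite hX /X i3.
have hk c : h (k0 c) = c by rewrite /h /k0 /= mmapC /= mevalC.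
have ht i : h ('X_i)%:MP = a i by rewrite /h mmapC /= mevalXU.
have eT i : tsub (h \o k0) (h ('X_ord0)%:MP) (h ('X_(inord 1))%:MP) (p i) = q i.
  by rewrite !ht /a -[inord 1 == 0]val_eqE /= inordK //=; apply: eq_tsub.
have eW z r i : wrow (h \o k0) (h 'X_ord_max) (h 'X_z) r i = wrow idfun 1 (X z) r i.
  by rewrite hX3 hX /wrow /= hk.
have eS z r : \sum_(i < 4) wrow (h \o k0) (h 'X_ord_max) (h 'X_z) r i * (h \o k0) (p i).@[e3 K]
    = \sum_(i < 4) wrow idfun 1 (X z) r i * g i.
  by apply: eq_bigr => i _; rewrite eW /= hk.
have X2 : X (inord 2) = z2 by rewrite /X i2 eqxx.
have hR : h (ResL p M) != 0.
  rewrite [X in X != 0](ResL_map (h := h)); [|by rewrite eS|by rewrite eS X2].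
  have eR z r : \sum_(i < 4) wrow (h \o k0) (h 'X_ord_max) (h 'X_z) r i
      *: tsub (h \o k0) (h ('X_ord0)%:MP) (h ('X_(inord 1))%:MP) (p i)
      = \sum_(i < 4) wrow idfun 1 (X z) r i *: q i.
    by apply: eq_bigr => i _; rewrite eT eW.
  rewrite [X in resultant X]eR [X in resultant _ X]eR X2.
  apply: resultant_neq0 => c hc1 hc2.
  have hcE z r : root (\sum_(i < 4) wrow idfun 1 z r i *: q i) c ->
      \sum_(i < 4) wrow idfun 1 z r i * (q i).[c] = 0.
    move=> /eqP; rewrite horner_sum => e; rewrite -[RHS]e.
    by apply: eq_bigr => i _; rewrite hornerZ.
  have crs : c \in rs.
    by move: hc1; rewrite -/f1 hrs rootZ ?lead_coef_eq0 // root_prod_XsubC.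
  have [q3|q3] := eqVneq (q ord_max).[c] 0.
    apply: (hM c); first by rewrite -horner_tsub_id.
      have := hcE _ _ hc1; rewrite LE q3 mulr0 subr0 => e; rewrite -[RHS]e.
      by apply: eq_bigr => l _; rewrite -horner_tsub_id.
    have := hcE _ _ hc2; rewrite LE q3 mulr0 subr0 => e; rewrite -[RHS]e.
    by apply: eq_bigr => l _; rewrite -horner_tsub_id.
  have : z2 != L (inord 2) (fun i => (q i).[c]) / (q ord_max).[c].
    apply: contraNneq hz2' => ->.
    by apply: (map_f (fun c => L (inord 2) (fun i => (q i).[c]) / (q ord_max).[c])).
  by move/(outside _ _ (fun i => (q i).[c]) q3); rewrite hcE // eqxx.
have [/hasP[m _ hm]|/hasPn h0] :=
  boolP (has (fun m => ((ResL p M)@_m).@[a] != 0) (msupp (ResL p M))).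
  by exists m.
case/negP: hR; rewrite /h /mmap big_seq big1 // => m /h0 /negPn /eqP e.
by rewrite /= e mul0r.
Qed.
End SpecM.

(** * Finiteness of the base locus and generic matrices *)

Section Gauss.
Variable K : closedFieldType.
Local Notation ev a := (map_poly (horner_eval (a : K))).

(** Over an algebraically closed field a nonconstant content has a root, so having unit content can
    be tested by evaluations. *)
Definition primitive (h : {poly {poly K}}) : Prop := forall a, ev a h != 0.

Lemma ev_eq0 a (h : {poly {poly K}}) : ev a h = 0 -> exists h', h = ('X - a%:P) *: h'.
Proof.
move=> e; pose h' := map_poly (fun c => c %/ ('X - a%:P)) h.
exists h'; apply/polyP => i; rewrite coefZ coef_map_id0 ?div0p // mulrC divpK //.
rewrite -root_factor_theorem rootE.
by have /polyP/(_ i) := e; rewrite coef_map coef0 => /eqP.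
Qed.

Lemma primitive_part (h : {poly {poly K}}) : h != 0 ->
  exists k h', [/\ h = k *: h', k != 0 & primitive h'].
Proof.
have [n] := ubnP (size (lead_coef h)); elim: n h => // n IH h hn h0.
have l0 : lead_coef h != 0 by rewrite lead_coef_eq0.
have [rs hrs] := closed_field_poly_normal (lead_coef h).
have [/hasP[a _ /eqP/ev_eq0[h' hh']]|/hasPn ha] := boolP (has (fun a => ev a h == 0) rs).
  have h'0 : h' != 0 by apply: contraNneq h0 => e; rewrite hh' e scaler0.
  have nzX : 'X - a%:P != 0 :> {poly K} by rewrite polyXsubC_eq0.
  have [|k [h2 [e k0 ph2]]] := IH h' _ h'0.
    move: hn; rewrite hh' lead_coefZ size_mul ?lead_coef_eq0 // size_XsubC.
    by rewrite addSn add1n.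
  by exists (('X - a%:P) * k), h2; rewrite hh' e scalerA mulf_neq0.
exists 1, h; rewrite scale1r oner_neq0; split=> // a.
have [hars|hars] := boolP (a \in rs); first exact: ha.
apply: contra hars => /eqP e; have : root (lead_coef h) a.
  by rewrite rootE lead_coefE -[_.[_]]/(horner_eval a _) -coef_map e coef0.
by rewrite hrs rootZ ?lead_coef_eq0 // root_prod_XsubC.
Qed.

(** Gauss's lemma, removing one linear factor of [c] at a time: at a root of [c] the product [q h]
    vanishes while [h] does not, so [q] contains the same factor. *)
Lemma gauss_dvd (c : {poly K}) (p q h : {poly {poly K}}) :
  primitive h -> c != 0 -> c *: p = q * h -> exists q', p = q' * h.
Proof.
move=> ph; have [n] := ubnP (size c); elim: n c q => // n IH c q hn c0 e.
have [/size_poly1P[k k0 ek]|sc] := boolP (size c == 1%N).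
  exists (k^-1%:P *: q); rewrite -scalerAl -e ek scalerA -polyCM mulVf // scale1r.
  by [].
have /closed_rootP[a ra] := sc.
have /factor_theorem[c' ec'] := ra.
have : ev a q * ev a h = 0.
  transitivity (ev a (c *: p)); first by rewrite e rmorphM.
  by rewrite map_polyZ /= /horner_eval (eqP ra) scale0r.
move/eqP; rewrite mulf_eq0 (negbTE (ph a)) orbF => /eqP/ev_eq0[q1 eq1].
have nzX : 'X - a%:P != 0 :> {poly K} by rewrite polyXsubC_eq0.
have c'0 : c' != 0 by apply: contraNneq c0 => e1; rewrite ec' e1 mul0r.
apply: (IH c' q1) => //.
  by move: hn; rewrite ec' size_mul // size_XsubC addn2.
have : ('X - a%:P) *: (c' *: p) = ('X - a%:P) *: (q1 * h).
  by rewrite scalerA mulrC -ec' e eq1 scalerAl.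
move/eqP; rewrite -subr_eq0 -scalerBr -mul_polyC mulf_eq0 polyC_eq0 (negbTE nzX) subr_eq0.
by move/eqP.
Qed.

(** Over a domain, the gcd is in the ideal only after multiplication by a denominator [c]. The ideal
    is an arbitrary predicate [I] because the uses differ: vanishing at a point for base points,
    divisibility after homogenization for the content. *)
Lemma Bezout_seq (R : idomainType) (qs : seq {poly R}) :
  exists h c, [/\ c != 0, forall q, q \in qs -> Pdiv.Idomain.dvdp h q &
    forall I : {poly R} -> Prop, (forall u v, I u -> I v -> I (u + v)) ->
      (forall a u, I u -> I (a * u)) -> I 0 -> (forall q, q \in qs -> I q) -> I (c *: h)].
Proof.
elim: qs => [|q qs [h [c [c0 hd hI]]]].
  by exists 0, 1; split=> // [|I _ _ I0 _]; rewrite ?oner_neq0 // scaler0.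
have [[u v] /eqpP[[c1 c2] /= /andP[c10 c20] e]] := Bezoutp q h.
exists (gcdp q h), (c * c2); split; first by rewrite mulf_neq0.
  move=> r; rewrite inE => /orP[/eqP ->|/hd]; first exact: dvdp_gcdl.
  exact/dvdp_trans/dvdp_gcdr.
move=> I ID IM I0 Iq.
have -> : (c * c2) *: gcdp q h = (c * c1)%:P * u * q + c1%:P * v * (c *: h).
  rewrite -scalerA -e -!mul_polyC polyCM; ring.
apply: (ID); first by apply/IM/Iq/mem_head.
by apply/IM/(hI I ID IM I0) => r hr; apply: Iq; rewrite inE hr orbT.
Qed.
End Gauss.

Lemma mpolyXX2 (R : nzRingType) (a b : nat) : 'X_0 ^+ a * 'X_1 ^+ b =
  'X_[U_(0) *+ a + U_(1) *+ b] :> {mpoly R[2]}.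
Proof. by rewrite mpolyXD !mpolyXn. Qed.

Section Homogenize.
Variable K : fieldType.
Hypothesis char0 : [pchar K] =i pred0.

(** The factor ['X_0] takes care of the hyperplane at infinity: by homogeneity, ['X_0 q] vanishes at
    every point. *)
Lemma homog_eq0 n d (q : {mpoly K[n.+1]}) : q \is d.-homog ->
  (forall v, v ord0 = 1 -> q.@[v] = 0) -> q = 0.
Proof.
move=> hq h; suff : 'X_ord0 * q == 0.
  rewrite mulf_eq0 => /orP[/eqP /(congr1 (meval (fun=> 1)))|/eqP//].
  by rewrite mevalXU meval0 => /eqP; rewrite oner_eq0.
apply/negPn/negP => /(mpoly_nonroot char0)[v]; rewrite mevalM mevalXU.
have [->|v0] := eqVneq (v ord0) 0; first by rewrite mul0r eqxx.
have -> : q.@[v] = v ord0 ^+ d * q.@[fun i => (v ord0)^-1 * v i].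
  by rewrite -(meval_homog _ _ hq); apply: meval_eq => i; rewrite mulrA mulfV // mul1r.
by rewrite h ?mulr0 ?eqxx // mulVf.
Qed.

Definition dehomog3 (q : {mpoly K[3]}) : {mpoly K[2]} :=
  mmap (@mpolyC 2 K) (pt3 1 'X_0 'X_1) q.

Lemma dehomog3B q1 q2 : dehomog3 (q1 - q2) = dehomog3 q1 - dehomog3 q2.
Proof. exact: (rmorphB (mmap (@mpolyC 2 K) (pt3 1 'X_0 'X_1))). Qed.

Lemma dehomog3M q1 q2 : dehomog3 (q1 * q2) = dehomog3 q1 * dehomog3 q2.
Proof. exact: (rmorphM (mmap (@mpolyC 2 K) (pt3 1 'X_0 'X_1))). Qed.

Lemma dehomog3_eval q x y : (dehomog3 q).@[fun i => if i == 0 then x else y] = q.@[pt3 1 x y].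
Proof.
suff h : meval (fun i : 'I_2 => if i == 0 then x else y) \o mmap (@mpolyC 2 K) (pt3 1 'X_0 'X_1)
  =1 meval (pt3 1 x y) by apply: h.
apply: mpoly_rmorph_eq => [c|i] /=; first by rewrite mmapC !mevalC.
rewrite mmapX mmap1U mevalXU /pt3.
by case: ifP => _; [rewrite meval1|case: ifP => _; rewrite mevalXU].
Qed.

Lemma dehomog3_inj d (q : {mpoly K[3]}) : q \is d.-homog -> dehomog3 q = 0 -> q = 0.
Proof.
move=> hq e; apply: (homog_eq0 hq) => v v0.
transitivity (dehomog3 q).@[fun i : 'I_2 => if i == 0 then v (inord 1) else v (inord 2)].
  rewrite dehomog3_eval; apply: meval_eq => i; rewrite /pt3.
  case: ifP => [/eqP i0|i0]; first by rewrite -v0; congr v; apply/val_inj.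
  case: ifP => [/eqP i1|i1]; congr v; apply/val_inj; rewrite /= inordK //.
  by case: i i0 i1 => [[|[|[|]]]].
by rewrite e meval0.
Qed.

Lemma dehomog3E (q : {mpoly K[3]}) :
  dehomog3 q = \sum_(m <- msupp q) q@_m *: ('X_0 ^+ m (inord 1) * 'X_1 ^+ m (inord 2)).
Proof.
apply: eq_bigr => m _; rewrite mul_mpolyC /mmap1 big_ord3 /pt3 !inordK //=.
by rewrite expr1n mul1r.
Qed.

Lemma msize_dehomog3 d (q : {mpoly K[3]}) : q \is d.-homog -> (msize (dehomog3 q) <= d.+1)%N.
Proof.
move=> hq; rewrite dehomog3E; apply: leq_trans (msize_sum _ _ _) _.
rewrite big_seq; apply/bigmax_leqP_seq => m _ hm; apply: leq_trans (msizeZ_le _ _) _.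
rewrite mpolyXX2 msizeX mdegD !mdegMn !mdeg1 -(mdeg_homog hq hm) mdeg3; lia.
Qed.

Lemma dehomog3_surj n (g : {mpoly K[2]}) : (msize g <= n.+1)%N ->
  exists2 q, q \is n.-homog & dehomog3 q = g.
Proof.
move=> hg; exists (\sum_(m <- msupp g) g@_m *: 'X_[U_(inord 0) *+ (n - mdeg m)
    + U_(inord 1) *+ m 0 + U_(inord 2) *+ m 1]).
  rewrite big_seq; apply: rpred_sum => m hm; apply: dhomogZ.
  rewrite dhomogX /= !mdegD !mdegMn !mdeg1.
  have eD : mdeg m = (m 0%R + m 1%R)%N.
    rewrite mdegE !big_ord_recl big_ord0 addn0; congr (_ + m _)%N; exact/val_inj.
  have := msize_mdeg_lt hm; rewrite eD => h; apply/eqP; lia.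
rewrite /dehomog3 raddf_sum [RHS]mpolyE; apply: eq_bigr => m _ /=.
rewrite mmapZ mul_mpolyC mmapX; congr (_ *: _).
rewrite /mmap1 big_ord3 /pt3 !inordK //= expr1n mul1r !mnmDE !mulmnE !mnm1E.
have i01 : (inord 0 == inord 1 :> 'I_3) = false by rewrite -val_eqE /= !inordK.
have i02 : (inord 0 == inord 2 :> 'I_3) = false by rewrite -val_eqE /= !inordK.
have i12 : (inord 1 == inord 2 :> 'I_3) = false by rewrite -val_eqE /= !inordK.
have i21 : (inord 2 == inord 1 :> 'I_3) = false by rewrite -val_eqE /= !inordK.
rewrite i01 i02 i12 i21 !eqxx !mul0n !mul1n !add0n addn0.
rewrite [RHS]mpolyXE_id !big_ord_recl big_ord0 mulr1.
by have -> : lift ord0 ord0 = 1 :> 'I_2 by apply/val_inj.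
Qed.
End Homogenize.

Lemma ev_lsub (K : fieldType) (a c : K) (q : {mpoly K[3]}) :
  (map_poly (horner_eval a) (lsub false 1 0 q)).[c] = q.@[pt3 1 a c].
Proof.
rewrite lsub.unlock map_tsub horner_tsub /meval /=.
have -> : horner_eval a (1%:P + 0) = 1 by rewrite /horner_eval !hornerE.
have -> : horner_eval a (0%:P + 'X) = a by rewrite /horner_eval !hornerE.
by apply: eq_bigr => m _ /=; rewrite /horner_eval hornerC.
Qed.

Section BaseFinite.
Variables (K : closedFieldType) (p : 'I_4 -> {mpoly K[3]}) (d : nat).
Hypotheses (char0 : [pchar K] =i pred0) (hgcd : mpoly_coprime4 p).
Hypotheses (hhom : forall i, p i \is d.-homog) (hp001 : forall i, (p i).@[e3 K] != 0).
Local Notation ev a := (map_poly (horner_eval (a : K))).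

(** Let [h] be the gcd of the [p_i] with respect to [t_3] over [K[s]]. If it has degree [0], a
    multiple of it in [K[s]] lies in the ideal and vanishes at every base direction. Otherwise its
    primitive part divides all [p_i] and homogenizes to a nonconstant common divisor, against
    coprimality. *)
Lemma base_finite : exists2 rho : {poly K}, rho != 0 &
  forall a c, (forall i, (p i).@[pt3 1 a c] = 0) -> root rho a.
Proof.
pose P i := lsub false 1 0 (p i).
have evP i a c : (ev a (P i)).[c] = (p i).@[pt3 1 a c] := ev_lsub a c (p i).
have P0 i : P i != 0.
  apply: contra_neq (hp001 i) => /polyP/(_ d); rewrite lead_lsub // coef0.
  by move/eqP; rewrite polyC_eq0 => /eqP.
have [h [c [c0 hd hI]]] := Bezout_seq [seq P i | i <- enum 'I_4].
have hdP i : Pdiv.Idomain.dvdp h (P i) by apply/hd/map_f; rewrite mem_enum.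
have h0 : h != 0 by apply: contraTneq (hdP 0) => ->; rewrite Pdiv.Idomain.dvd0p.
have [sh|sh] := leqP (size h) 1.
  have [b eb] : exists b, h = b%:P by exists h`_0; apply: size1_polyC.
  exists (c * b) => [|a z hz]; first by rewrite mulf_neq0 // -polyC_eq0 -eb.
  have : (ev a (c *: h)).[z] = 0.
    apply: (hI (fun s => (ev a s).[z] = 0)) => [u v|u v||q].
    - by rewrite rmorphD hornerD => -> ->; rewrite addr0.
    - by rewrite rmorphM hornerM => ->; rewrite mulr0.
    - by rewrite rmorph0 hornerC.
    by case/mapP => i _ ->; rewrite evP.
  by rewrite eb -mul_polyC -polyCM map_polyC hornerC => /eqP.
exfalso.
have [k [h' [eh k0 ph]]] := primitive_part h0.
have [q hq] : exists q, forall i, P i = q i * h'.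
  apply: (fin_all_exists (P := fun i q => P i = q * h')) => i.
  have /Pdiv.Idomain.dvdpP[[c1 q1] /= c10 e1] := hdP i.
  apply: (gauss_dvd ph c10 (q := k%:P * q1)); rewrite e1 eh -mul_polyC; ring.
have h'0 : h' != 0 by apply: contraNneq h0 => e; rewrite eh e scaler0.
have sh' : (1 < size h')%N by move: sh; rewrite eh size_scale.
pose k1 := horner_eval ('X_0 : {mpoly K[2]}) \o map_poly (@mpolyC 2 K).
pose k2 := horner_eval ('X_1 : {mpoly K[2]}) \o map_poly k1.
have k1C a : k1 a%:P = a%:MP by rewrite /k1 /= map_polyC /horner_eval hornerC.
have k1X : k1 'X = 'X_0 by rewrite /k1 /= map_polyX /horner_eval hornerX.
have k2C a : k2 a%:P = k1 a by rewrite /k2 /= map_polyC /horner_eval hornerC.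
have k2X : k2 'X = 'X_1 by rewrite /k2 /= map_polyX /horner_eval hornerX.
have k2P i : k2 (P i) = dehomog3 (p i).
  suff e : k2 \o lsub false 1 0 =1 mmap (@mpolyC 2 K) (pt3 1 'X_0 'X_1) by apply: e.
  apply: mpoly_rmorph_eq => [a|j] /=.
    by rewrite lsubC mmapC; exact: etrans (k2C _) (k1C _).
  rewrite mmapX mmap1U lsub.unlock tsubX /pt3 addr0 add0r.
  case: ifP => _; first by apply: etrans (k2C _) (k1C _).
  by case: ifP => _; [apply: etrans (k2C _) k1X|].
have k2ev s a z : (k2 s).@[fun i => if i == 0 then a else z] = (ev a s).[z].
  rewrite /k2 /= /horner_eval -horner_map /= mevalXU -map_poly_comp /=.
  congr horner; apply: eq_map_poly => r; rewrite /k1 /= /horner_eval -horner_map /= mevalXU.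
  by rewrite -map_poly_comp map_poly_id // => x _; rewrite /= mevalC.
pose eta := k2 h'.
have e1 i : dehomog3 (p i) = k2 (q i) * eta by rewrite -k2P hq /k2 /eta rmorphM.
have nz i : k2 (q i) * eta != 0.
  rewrite -e1; apply: contra_neq (hp001 i) => /(dehomog3_inj char0 (hhom i)) ->.
  by rewrite meval0.
have eta0 : eta != 0 by apply: contraNneq (nz 0) => ->; rewrite mulr0.
have q0 i : k2 (q i) != 0 by apply: contraNneq (nz i) => ->; rewrite mul0r.
pose n := (msize eta).-1.
(* The cofactor thus has degree at most [d - n], as needed to homogenize both factors to total
   degree [d]. *)
have msz i : (msize (k2 (q i)) + n <= d.+1)%N.
  have := msize_dehomog3 (hhom i); rewrite e1 msizeM //.
  have aux u v w : (0 < v -> (u + v).-1 <= w.+1 -> u + v.-1 <= w.+1)%N by lia.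
  by apply: aux; rewrite lt0n msize_poly_eq0.
have [D hD eD] := @dehomog3_surj _ n eta (leqSpred _).
have [b eb] : exists b, D = b%:MP.
  apply: hgcd => i.
  have nd : (n <= d)%N.
    have := msz i; have : (0 < msize (k2 (q i)))%N by rewrite lt0n msize_poly_eq0.
    lia.
  have [|G hG eG] := @dehomog3_surj _ (d - n) (k2 (q i)).
    have aux u : (u + n <= d.+1 -> u <= (d - n).+1)%N by lia.
    exact/aux/msz.
  exists G; apply/eqP; rewrite -subr_eq0; apply/eqP/(@dehomog3_inj _ char0 d).
    have hGD : G * D \is d.-homog by rewrite -(subnK nd); apply: dhomogM.
    by apply: rpredB; [apply: hhom|].
  by rewrite dehomog3B dehomog3M eG eD e1 subrr.
(* [h'] dehomogenizes the constant [b], yet on a line that keeps its leading coefficient it is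
   nonconstant in [t_3]. *)
have [a ha] : exists a, (lead_coef h').[a] != 0.
  by apply: poly_nonroot => //; rewrite lead_coef_eq0.
have [z] : exists z, (ev a h' - b%:P).[z] != 0.
  apply: poly_nonroot => //; apply: contraNneq ha => /polyP/(_ (size h').-1).
  rewrite coefB coef_map coefC coef0 -lead_coefE /horner_eval.
  by case: (size h') sh' => [|[|m]] //= _; rewrite subr0 => /eqP.
rewrite hornerD hornerN hornerC -k2ev -/eta -eD eb.
by rewrite /dehomog3 mmapC mevalC subrr eqxx.
Qed.
End BaseFinite.

(** * A relation along the curve where the last form vanishes *)

Definition tdeg_le (R : nzRingType) (N : nat) (s : {poly {poly R}}) : Prop :=
  forall i j, (N < i + j)%N -> s`_j`_i = 0.

Section TotalDegree.
Variable R : nzRingType.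
Implicit Types s t : {poly {poly R}}.

Lemma tdeg_leB N s t : tdeg_le N s -> tdeg_le N t -> tdeg_le N (s - t).
Proof. by move=> hs ht i j h; rewrite !coefB hs // ht // subrr. Qed.

Lemma tdeg_leM N1 N2 s t : tdeg_le N1 s -> tdeg_le N2 t -> tdeg_le (N1 + N2) (s * t).
Proof.
move=> hs ht i j h; rewrite coefM coef_sum big1 // => j1 _.
rewrite coefM big1 // => i1 _.
have [h1|h1] := ltnP N1 (i1 + j1); first by rewrite hs // mul0r.
rewrite ht ?mulr0 //; have := ltn_ord i1; have := ltn_ord j1; lia.
Qed.

Lemma tdeg_leX N k s : tdeg_le N s -> tdeg_le (N * k) (s ^+ k).
Proof.
move=> hs; elim: k => [|k IH].
  by move=> i [|j] h; rewrite expr0 !coefC ?coef0 //; case: i h.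
by rewrite exprS mulnS; apply: tdeg_leM.
Qed.
End TotalDegree.

Lemma tdeg_lsub (K : fieldType) d (q : {mpoly K[3]}) :
  q \is d.-homog -> tdeg_le d (lsub false 1 0 q).
Proof.
move=> hq i j h; rewrite lsub.unlock coef_tsub coef_sum big_seq_cond big1 // => m.
case/andP => hm /eqP mj; rewrite addr0 add0r expr1n mulr1 coefCM coefXn.
case: eqP => [ei|]; last by rewrite mulr0.
move: h; rewrite -(mdeg_homog hq hm) mdeg3; lia.
Qed.

(** Because the leading coefficient of [f] is a constant and [f] has total degree at most [d], each
    step of long division in [t_3] subtracts a polynomial of total degree at most [N]. *)
Lemma tdeg_mod (K : fieldType) (N d : nat) (f s : {poly {poly K}}) (b : K) :
  (size f <= d.+1)%N -> f`_d = b%:P -> b != 0 -> tdeg_le d f -> tdeg_le N s ->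
  exists q t, [/\ s = q * f + t, tdeg_le N t & (size t <= d)%N].
Proof.
move=> sf fd b0 hf; have [n] := ubnP (size s); elim: n s => // n IH s hn hs.
have [ss|ss] := leqP (size s) d; first by exists 0, s; rewrite mul0r add0r.
pose k := (size s).-1; have sk : size s = k.+1 by rewrite prednK // (leq_ltn_trans _ ss).
have dk : (d <= k)%N by rewrite -ltnS -sk.
have kN : (k <= N)%N.
  rewrite leqNgt; apply/negP => kN; have : s`_k != 0.
    by rewrite -lead_coefE lead_coef_eq0 -size_poly_eq0 sk.
  by move/negP; apply; apply/eqP/polyP => i; rewrite coef0 hs // ltn_addl.
pose u : {poly {poly K}} := (s`_k * b^-1%:P) *: 'X^(k - d).
have hu : tdeg_le (N - d) u.
  move=> i j h; rewrite coefZ coefXn; case: eqP => [ej|]; last by rewrite mulr0 coef0.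
  rewrite mulr1 mulrC coefCM hs ?mulr0 //; lia.
have hs1 : tdeg_le N (s - u * f).
  apply: tdeg_leB => //; rewrite -(subnK (leq_trans dk kN)); exact: tdeg_leM.
have uf j : (k <= j)%N -> (u * f)`_j = if j == k then s`_k else 0.
  move=> hj; rewrite /u -scalerAl coefZ coefXnM.
  have -> : (j < k - d)%N = false by apply/negbTE; rewrite -leqNgt; lia.
  case: eqP => [->|/eqP jk].
    by rewrite subKn // fd -mulrA -polyCM mulVf ?mulr1.
  rewrite (leq_sizeP _ _ sf) ?mulr0 //; lia.
have ss1 : (size (s - u * f)%R < n)%N.
  apply: leq_ltn_trans (_ : k < n)%N; last by rewrite -ltnS -sk.
  apply/leq_sizeP => j hj; rewrite coefB uf //.
  by case: eqP => [->|/eqP jk]; rewrite ?subrr // subr0 nth_default // sk; lia.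
have [q [t [e ht st]]] := IH _ ss1 hs1.
by exists (u + q), t; split=> //; rewrite mulrDl -addrA -e addrC subrK.
Qed.

Section CurveRelation.
Variables (K : closedFieldType) (p : 'I_4 -> {mpoly K[3]}) (d : nat).
Hypotheses (hhom : forall i, p i \is d.-homog) (hp001 : forall i, (p i).@[e3 K] != 0).

(** All these monomials have degree [2 n]: both free exponents are at most [n], so the subtraction
    in the third is never truncated. *)
Definition hmon (R : nzRingType) n (x y z : R) (k : 'I_n.+1 * 'I_n.+1) : R :=
  x ^+ k.1 * y ^+ k.2 * z ^+ (2 * n - k.1 - k.2).

(** Modulo [p_4] the monomials in [p_1, p_2, p_3] live in a space whose dimension grows linearly in
    [n], while their number grows quadratically. *)
Lemma curve_relation : exists n (v : 'I_n.+1 * 'I_n.+1 -> K), (exists k, v k != 0) /\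
  forall a c, (p ord_max).@[pt3 1 a c] = 0 ->
   \sum_k v k * hmon (p (inord 0)).@[pt3 1 a c] (p (inord 1)).@[pt3 1 a c]
     (p (inord 2)).@[pt3 1 a c] k = 0.
Proof.
(* With this [n] there are [(n + 1)^2 = 4 d^4 + 4 d^2 + 1] monomials, against
   [d (N + 1) = 4 d^4 + d] coefficients of the remainders. *)
pose P i := lsub false 1 0 (p i); pose n := (2 * d ^ 2)%N; pose N := (d * (2 * n))%N.
pose T := ('I_n.+1 * 'I_n.+1)%type.
have hP i : tdeg_le d (P i) by apply: tdeg_lsub.
pose mon (k : T) := hmon (P (inord 0)) (P (inord 1)) (P (inord 2)) k.
have hmonN k : tdeg_le N (mon k).
  have -> : N = (d * k.1 + d * k.2 + d * (2 * n - k.1 - k.2))%N.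
    rewrite -!mulnDr; congr (_ * _)%N; have := ltn_ord k.1; have := ltn_ord k.2; lia.
  by apply: tdeg_leM; [apply: tdeg_leM|]; apply: tdeg_leX.
have sP : (size (P ord_max) <= d.+1)%N by apply: size_lsub.
have [q hq] : exists q : T -> {poly {poly K}} * {poly {poly K}}, forall k,
    [/\ mon k = (q k).1 * P ord_max + (q k).2, tdeg_le N (q k).2 & (size (q k).2 <= d)%N].
  apply: (fin_all_exists (P := fun k q =>
    [/\ mon k = q.1 * P ord_max + q.2, tdeg_le N q.2 & (size q.2 <= d)%N])) => k.
  have [q [t h]] :=
    tdeg_mod sP (lead_lsub false 1 0 (hhom ord_max)) (hp001 _) (hP ord_max) (hmonN k).
  by exists (q, t).
pose C := ('I_d * 'I_N.+1)%type.
pose A : 'M[K]_(#|{: T}|, #|{: C}|) :=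
  \matrix_(r, s) (((q (enum_val r)).2)`_((enum_val s : C).1))`_((enum_val s : C).2).
have [|v v0 hv] := row_kernel A.
  rewrite !card_prod !card_ord /N /n; nia.
exists n, (fun k => v 0 (enum_rank k)); split.
  case/rV0Pn: v0 => r hr; exists (enum_val r); by rewrite enum_valK.
have h0 : \sum_k (v 0 (enum_rank k))%:P%:P * (q k).2 = 0.
  apply/polyP => j; apply/polyP => i; rewrite coef_sum !coef0 coef_sum.
  under eq_bigr => k _ do rewrite coefCM coefCM.
  have [ji|ji] := boolP ((j < d) && (i < N.+1))%N; last first.
    apply: big1 => k _; have [_ h1 h2] := hq k.
    move: ji; rewrite negb_and -!leqNgt => /orP[jd|iN].
      by rewrite (leq_sizeP _ _ h2) // coef0 mulr0.
    by rewrite h1 ?mulr0 // ltn_addr.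
  case/andP: ji => jd iN; move/rowP: hv => /(_ (enum_rank (Ordinal jd, Ordinal iN))).
  rewrite !mxE => e; rewrite -[RHS]e (reindex (fun r : 'I_#|{: T}| => enum_val r)) /=; last first.
    exact/onW_bij/enum_val_bij.
  by apply: eq_bigr => r _; rewrite mxE enum_rankK enum_valK.
have h1 : \sum_k (v 0 (enum_rank k))%:P%:P * mon k =
    (\sum_k (v 0 (enum_rank k))%:P%:P * (q k).1) * P ord_max.
  rewrite -[RHS]addr0 -[X in _ = _ + X]h0 mulr_suml -big_split; apply: eq_bigr => k _ /=.
  by have [-> _ _] := hq k; rewrite mulrDr mulrA.
move=> a c hac.
have [e [eP eC]] : exists e : {rmorphism {poly {poly K}} -> K},
    (forall i, e (P i) = (p i).@[pt3 1 a c]) /\ (forall b, e b%:P%:P = b).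
  exists (GRing.RMorphism.clone _ _ (horner_eval c \o map_poly (horner_eval (a : K))) _).
  split=> [i|b] /=; first exact: ev_lsub.
  by rewrite map_polyC /= /horner_eval !hornerC.
transitivity (e (\sum_k (v 0 (enum_rank k))%:P%:P * mon k)); last first.
  by rewrite h1 rmorphM eP hac mulr0.
rewrite rmorph_sum; apply: eq_bigr => k _.
by rewrite rmorphM /mon /hmon 2!rmorphM !rmorphXn !eP eC.
Qed.

Definition cross (R : nzRingType) (A : 'I_3 -> 'I_3 -> R) (r s i j : 'I_3) : R :=
  A r i * A s j - A r j * A s i.

(* If [p_4] vanishes at [t] and rows [1] and [3] of [M] kill [v = (p_1, p_2, p_3)(t)], then the
   cross product of these rows is a multiple of [v], hence a zero of the relation. *)
Lemma avoid_curve : [pchar K] =i pred0 -> exists2 h : {mpoly K[3 * 3]}, h != 0 &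
  forall M : 'M[K]_3, h.@[mx_coords M] != 0 -> forall a c,
    let v i := (p (inord i)).@[pt3 1 a c] in (p ord_max).@[pt3 1 a c] = 0 ->
    M 0 (inord 0) * v 0%N + M 0 (inord 1) * v 1%N + M 0 (inord 2) * v 2%N = 0 ->
    M (inord 2) (inord 0) * v 0%N + M (inord 2) (inord 1) * v 1%N
      + M (inord 2) (inord 2) * v 2%N = 0 ->
    [/\ v 0%N = 0, v 1%N = 0 & v 2%N = 0].
Proof.
move=> char0; have [n [v [[k0 hk0] hv]]] := curve_relation.
pose G (R : nzRingType) (f : K -> R) x y z := \sum_k f (v k) * hmon x y z (k : 'I_n.+1 * 'I_n.+1).
have Ghom (l x y z : K) : G _ idfun (l * x) (l * y) (l * z) = l ^+ (2 * n) * G _ idfun x y z.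
  rewrite /G mulr_sumr; apply: eq_bigr => k _; rewrite /hmon /= !exprMn.
  have -> : l ^+ (2 * n) = l ^+ k.1 * l ^+ k.2 * l ^+ (2 * n - k.1 - k.2).
    rewrite -!exprD; congr (_ ^+ _); have := ltn_ord k.1; have := ltn_ord k.2; lia.
  by ring.
have Gmap (R S : nzRingType) (h : {rmorphism R -> S}) (f : K -> R) x y z :
    h (G _ f x y z) = G _ (h \o f) (h x) (h y) (h z).
  rewrite /G rmorph_sum; apply: eq_bigr => k _.
  by rewrite /hmon !rmorphM !rmorphXn.
have [z hz] : exists z : 'I_2 -> K, G _ idfun (z 0) (z 1) 1 != 0.
  have : G _ (@mpolyC 2 K) 'X_0 'X_1 1 != 0.
    apply: contra_neq hk0 => /(congr1 (mcoeff (U_(0) *+ k0.1 + U_(1) *+ k0.2))).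
    rewrite mcoeff0 raddf_sum (bigD1 k0) //= => e; rewrite -[RHS]e.
    have cE k : ((v k)%:MP * hmon ('X_0 : {mpoly K[2]}) 'X_1 1 k)@_(U_(0) *+ k0.1 + U_(1) *+ k0.2)
       = v k * (k == k0)%:R.
      rewrite mcoeffCM /hmon expr1n mulr1 mpolyXX2 mcoeffX; congr (_ * _%:R).
      congr nat_of_bool; apply/eqP/eqP => [/mnmP em|-> //].
      have := em 0; have := em 1; rewrite !mnmDE !mulmnE !mnm1E /= => e1 e0.
      apply/eqP; rewrite -pair_eqE /pair_eq -!val_eqE /=; apply/andP; split; apply/eqP; lia.
    by rewrite cE eqxx mulr1 big1 ?addr0 // => k /negbTE hk; rewrite cE hk mulr0.
  move/(mpoly_nonroot char0) => [z hz]; exists z; move: hz.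
  rewrite (Gmap _ _ (meval z)) /= !mevalXU meval1; congr (_ != 0).
  by apply: eq_bigr => k _; rewrite /= mevalC.
pose X (r c : 'I_3) : {mpoly K[3 * 3]} := 'X_(mxvec_index r c).
pose h := G _ (@mpolyC (3 * 3) K) (cross X 0 (inord 2) (inord 1) (inord 2))
  (cross X 0 (inord 2) (inord 2) (inord 0)) (cross X 0 (inord 2) (inord 0) (inord 1)).
have hE (M : 'M[K]_3) : h.@[mx_coords M] = G _ idfun (cross M 0 (inord 2) (inord 1) (inord 2))
  (cross M 0 (inord 2) (inord 2) (inord 0)) (cross M 0 (inord 2) (inord 0) (inord 1)).
  have XE r c : (X r c).@[mx_coords M] = M r c by rewrite /X mevalXU /mx_coords mxvecE.
  have cE r s i j : (cross X r s i j).@[mx_coords M] = cross M r s i j.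
    by rewrite /cross mevalB !mevalM !XE.
  rewrite (Gmap _ _ (meval (mx_coords M))) /= !cE.
  by apply: eq_bigr => k _; rewrite /= mevalC.
exists h.
  (* The rows [(1, 0, - z 0)] and [(0, 1, - z 1)] have cross product [(z 0, z 1, 1)], where the
     relation is nonzero. *)
  pose M : 'M[K]_3 := \matrix_(r, c) if r == 0%N :> nat then pt3 1 0 (- z 0) c
                                     else pt3 0 1 (- z 1) c.
  apply: contraNneq hz => /(congr1 (meval (mx_coords M))); rewrite hE meval0 => e.
  apply/eqP; rewrite -[RHS]e; congr G;
    by rewrite /cross !mxE /pt3 !inordK //=; ring.
move=> M hM a c w h3 r0 r2.
have hw := hv a c h3; rewrite hE in hM.
set c1 := cross M _ _ _ _ in hM; set c2 := cross M _ _ _ _ in hM.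
set c3 := cross M _ _ _ _ in hM.
have key l : c1 = l * w 0%N -> c2 = l * w 1%N -> c3 = l * w 2%N -> False.
  move=> e1 e2 e3; case/negP: hM; rewrite e1 e2 e3 Ghom.
  by rewrite [X in _ * X](_ : _ = 0) ?mulr0.
have e12 : c1 * w 1%N = c2 * w 0%N.
  apply/eqP; rewrite -subr_eq0; apply/eqP.
  transitivity (M (inord 2) (inord 2) *
      (M 0 (inord 0) * w 0%N + M 0 (inord 1) * w 1%N
       + M 0 (inord 2) * w 2%N)
    - M 0 (inord 2) * (M (inord 2) (inord 0) * w 0%N + M (inord 2) (inord 1) * w 1%N
      + M (inord 2) (inord 2) * w 2%N)).
    by rewrite /c1 /c2 /cross; ring.
  by rewrite r0 r2 !mulr0 subrr.
have e23 : c2 * w 2%N = c3 * w 1%N.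
  apply/eqP; rewrite -subr_eq0; apply/eqP.
  transitivity (M (inord 2) (inord 0) *
      (M 0 (inord 0) * w 0%N + M 0 (inord 1) * w 1%N
       + M 0 (inord 2) * w 2%N)
    - M 0 (inord 0) * (M (inord 2) (inord 0) * w 0%N + M (inord 2) (inord 1) * w 1%N
      + M (inord 2) (inord 2) * w 2%N)).
    by rewrite /c2 /c3 /cross; ring.
  by rewrite r0 r2 !mulr0 subrr.
have e31 : c3 * w 0%N = c1 * w 2%N.
  apply/eqP; rewrite -subr_eq0; apply/eqP.
  transitivity (M (inord 2) (inord 1) *
      (M 0 (inord 0) * w 0%N + M 0 (inord 1) * w 1%N
       + M 0 (inord 2) * w 2%N)
    - M 0 (inord 1) * (M (inord 2) (inord 0) * w 0%N + M (inord 2) (inord 1) * w 1%N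
      + M (inord 2) (inord 2) * w 2%N)).
    by rewrite /c3 /c1 /cross; ring.
  by rewrite r0 r2 !mulr0 subrr.
(* Any nonzero coordinate of [w] provides the factor [l] for [key]. *)
have [w0|w0] := eqVneq (w 0%N) 0; last first.
  by exfalso; apply: (key (c1 / w 0%N)); [|rewrite mulrAC e12|rewrite mulrAC -e31];
    rewrite ?mulfK ?divfK.
have [w1|w1] := eqVneq (w 1%N) 0; last first.
  by exfalso; apply: (key (c2 / w 1%N)); [rewrite mulrAC -e12| |rewrite mulrAC e23];
    rewrite ?mulfK ?divfK.
have [w2|w2] := eqVneq (w 2%N) 0; last first.
  by exfalso; apply: (key (c3 / w 2%N)); [rewrite mulrAC e31|rewrite mulrAC -e23|];
    rewrite ?mulfK ?divfK.
by [].
Qed.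
End CurveRelation.

(** * Content of a resultant *)

Definition xhomog (R : nzRingType) (k n d : nat) (b : {mpoly {mpoly R[k]}[n]}) : Prop :=
  forall m, b@_m \is d.-homog.

Section XHomog.
Variables (R : comNzRingType) (k n : nat).
Implicit Types b c : {mpoly {mpoly R[k]}[n]}.

Lemma xhomog0 d : xhomog d (0 : {mpoly {mpoly R[k]}[n]}).
Proof. by move=> m; rewrite mcoeff0 rpred0. Qed.

Lemma xhomogD d b c : xhomog d b -> xhomog d c -> xhomog d (b + c).
Proof. by move=> hb hc m; rewrite mcoeffD rpredD. Qed.

Lemma xhomogN d b : xhomog d b -> xhomog d (- b).
Proof. by move=> hb m; rewrite mcoeffN rpredN. Qed.

Lemma xhomogM d e b c : xhomog d b -> xhomog e c -> xhomog (d + e) (b * c).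
Proof.
move=> hb hc m; rewrite mcoeffM; apply: rpred_sum => -[i j] _ /=.
by apply: dhomogM; [exact: hb | exact: hc].
Qed.

Lemma xhomogC d (c : {mpoly R[k]}) : c \is d.-homog -> xhomog d (c%:MP : {mpoly {mpoly R[k]}[n]}).
Proof.
move=> hc m; rewrite mcoeffC; case: (m == 0%MM); first by rewrite mulr1.
by rewrite mulr0 rpred0.
Qed.

Lemma xhomog1 : xhomog 0 (1 : {mpoly {mpoly R[k]}[n]}).
Proof. by rewrite -mpolyC1; apply: xhomogC; apply: dhomog1. Qed.

Lemma xhomogX i : xhomog 0 ('X_i : {mpoly {mpoly R[k]}[n]}).
Proof.
move=> m; rewrite mcoeffX; case: (_ == m); first exact: dhomog1.
by rewrite rpred0.
Qed.

Lemma xhomogXn d e b : xhomog d b -> xhomog (d * e) (b ^+ e).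
Proof.
move=> hb; elim: e => [|e IH]; first by rewrite muln0 expr0; apply: xhomog1.
by rewrite exprS mulnS; apply: xhomogM.
Qed.

Lemma xhomog_sum d (I : Type) (r : seq I) (P : pred I) (F : I -> {mpoly {mpoly R[k]}[n]}) :
  (forall i, P i -> xhomog d (F i)) -> xhomog d (\sum_(i <- r | P i) F i).
Proof.
by move=> h; elim/big_ind: _ => //; [exact: xhomog0|move=> x y; exact: xhomogD].
Qed.

(** With row weights [w] and column weights [u], every nonzero term of the determinant has the
    degree [\sum w - \sum u], whatever the permutation. *)
Lemma xhomog_det s (A : 'M[{mpoly {mpoly R[k]}[n]}]_s) (w u : 'I_s -> nat) :
  (forall i j, A i j = 0 \/ (u j <= w i)%N /\ xhomog (w i - u j) (A i j)) ->
  xhomog (\sum_i w i - \sum_i u i) (\det A).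
Proof.
move=> hA; rewrite /determinant; apply: xhomog_sum => t _.
suff h : xhomog (\sum_i w i - \sum_i u i) (\prod_i A i (t i)).
  by case: (odd_perm t); rewrite ?expr1 ?mulN1r ?expr0 ?mul1r //; apply: xhomogN.
have [/existsP[i /eqP hi]|/existsPn h0] := boolP [exists i, A i (t i) == 0].
  by rewrite [X in xhomog _ X](bigD1 i) // hi /= mul0r; apply: xhomog0.
have h i : (u (t i) <= w i)%N /\ xhomog (w i - u (t i)) (A i (t i)).
  by case: (hA i (t i)) => // e; have := h0 i; rewrite e eqxx.
have -> : (\sum_i w i - \sum_i u i = \sum_i (w i - u (t i)))%N.
  rewrite sumnB => [|i _]; last by have [] := h i.
  by congr (_ - _)%N; rewrite (reindex_inj (@perm_inj _ t)).
elim/big_ind2: _ => //; [exact: xhomog1|move=> ? ? ? ?; exact: xhomogM|].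
by move=> i _; have [] := h i.
Qed.
End XHomog.

Section ResLHomog.
Variables (K : closedFieldType) (p : 'I_4 -> {mpoly K[3]}) (d : nat) (M : 'M[K]_3).
Hypotheses (hhom : forall i, p i \is d.-homog).

Lemma KL_homog r i l : (l <= d)%N ->
  xhomog (d - l) (xv K ord_max * LP p M r - xv K i * L4P p)`_l.
Proof.
move=> ld; rewrite KL_comb coef_comb; apply: xhomog_sum => j _.
rewrite -[(d - l)%N]add0n; apply: xhomogM.
  have hc c : xhomog 0 ((c%:MP : {mpoly K[2]})%:MP : {mpoly {mpoly K[2]}[4]}).
    by apply: xhomogC; rewrite -alg_mpolyC; apply: dhomogZ; apply: dhomog1.
  rewrite /wrow; case: ifP => _; last by apply: xhomogN; apply: xhomogX.
  by apply: (@xhomogM _ _ _ 0 0); [exact: xhomogX|exact: hc].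
rewrite toBxt3E coef_tsub big_seq_cond; apply: xhomog_sum => m /andP[hm /eqP hl].
have := mdeg_homog (hhom j) hm; rewrite mdeg3 hl => hd.
have -> : (d - l = 0 + 1 * m (inord 0) + 1 * m (inord 1))%N by rewrite -hd; lia.
have hX i' : ('X_i' : {mpoly K[2]}) \is 1.-homog by rewrite dhomogX /= mdeg1.
apply: xhomogM; [apply: xhomogM|]; try by apply: xhomogXn; apply: xhomogC; apply: hX.
by apply: xhomogC; rewrite -alg_mpolyC; apply: dhomogZ; apply: dhomog1.
Qed.

Lemma KL_size r i : (size (xv K ord_max * LP p M r - xv K i * L4P p)%R <= d.+1)%N.
Proof.
rewrite KL_comb; apply: size_comb => j; rewrite toBxt3E; exact: size_tsub.
Qed.

(** The Sylvester entry in a row of shift [k] and column [l] is a coefficient of [t_3^(l - k)], of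
    degree [d - (l - k)]; so the row weight is [d + k] and the column weight [l]. *)
Lemma ResL_homog : exists N, xhomog N (ResL p M).
Proof.
pose w (i : 'I_((size (K2L p M)).-1 + (size (K1L p M)).-1)) : nat :=
  match split i with inl k => (d + k)%N | inr k => (d + k)%N end.
exists (\sum_i w i - \sum_(i < (size (K2L p M)).-1 + (size (K1L p M)).-1) nat_of_ord i)%N.
apply: xhomog_det => i j; rewrite Sylvester_mxE /w.
have key r z (k l : nat) : let S := xv K ord_max * LP p M r - xv K z * L4P p in
    S`_(l - k) *+ (k <= l) = 0 \/ (l <= d + k)%N /\ xhomog (d + k - l) (S`_(l - k) *+ (k <= l)).
  move=> S; case: (leqP k l) => kl; last by left; rewrite mulr0n.
  have [ld|ld] := leqP (l - k) d; last first.
    by left; rewrite (leq_sizeP _ _ (KL_size r z)) // mul0rn.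
  right; rewrite mulr1n; split; first by rewrite addnC -leq_subLR.
  have -> : (d + k - l = d - (l - k))%N by rewrite subnBA.
  exact: KL_homog.
by case: (split i) => k; [apply: (key 0 0 k j) | apply: (key (inord 2) (inord 2) k j)].
Qed.
End ResLHomog.

(** * Binary forms *)

Lemma ord2P (i : 'I_2) : i = 0 \/ i = 1.
Proof. by case: i => -[|[|//]] h; [left|right]; apply/val_inj. Qed.

Lemma mdeg2 (m : 'X_{1..2}) : mdeg m = (m 0%R + m 1%R)%N.
Proof.
by rewrite mdegE !big_ord_recl big_ord0 addn0; congr (_ + m _)%N; apply/val_inj.
Qed.

Section BinaryForms.
Variable K : fieldType.
Hypothesis char0 : [pchar K] =i pred0.
Implicit Types q : {mpoly K[2]}.

Definition pt2 (R : Type) (x y : R) (i : 'I_2) : R := if i == 0 then x else y.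

Lemma meval_pt2 q v : q.@[v] = q.@[pt2 (v 0) (v 1)].
Proof. by apply: meval_eq => i; rewrite /pt2; case: (ord2P i) => ->. Qed.

Definition dehom : {mpoly K[2]} -> {poly K} := mmap polyC (pt2 1 'X).

HB.instance Definition _ := GRing.RMorphism.copy dehom (mmap polyC (pt2 1 'X)).

Lemma dehom_horner q x : (dehom q).[x] = q.@[pt2 1 x].
Proof.
suff h : horner_eval x \o mmap polyC (pt2 1 'X) =1 meval (pt2 1 x) by apply: h.
apply: mpoly_rmorph_eq => [c|i] /=.
  by rewrite mmapC mevalC /horner_eval hornerC.
rewrite mmapX mmap1U mevalXU /horner_eval /pt2.
by case: ifP => _; rewrite ?hornerC ?hornerX.
Qed.

Lemma dehom_inj d q : q \is d.-homog -> dehom q = 0 -> q = 0.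
Proof.
move=> hq e; apply: (homog_eq0 char0 hq) => v v0; rewrite meval_pt2 -[v 0]/(v ord0) v0.
by rewrite -dehom_horner e horner0.
Qed.

Lemma dehomX0 : dehom 'X_0 = 1. Proof. by rewrite /dehom mmapX mmap1U. Qed.
Lemma dehomX1 : dehom 'X_1 = 'X. Proof. by rewrite /dehom mmapX mmap1U. Qed.
Lemma dehomC c : dehom c%:MP = c%:P. Proof. by rewrite /dehom mmapC. Qed.

Lemma homogXi d i : ('X_i ^+ d : {mpoly K[2]}) \is d.-homog.
Proof.
have h : ('X_i : {mpoly K[2]}) \is 1.-homog by rewrite dhomogX /= mdeg1.
by have := dhomogMn d h; rewrite mul1n.
Qed.

Lemma dehom_surj n (r : {poly K}) : (size r <= n.+1)%N ->
  exists2 q, q \is n.-homog & dehom q = r.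
Proof.
move=> hr; exists (\sum_(k < n.+1) r`_k *: ('X_0 ^+ (n - k) * 'X_1 ^+ k)).
  apply: rpred_sum => k _; apply: dhomogZ.
  have := dhomogM (homogXi (n - k) 0) (homogXi k 1).
  by rewrite subnK // -ltnS.
rewrite raddf_sum /=; transitivity (\poly_(k < n.+1) r`_k).
  rewrite poly_def; apply: eq_bigr => k _; rewrite -mul_mpolyC !rmorphM !rmorphXn /=.
  by rewrite dehomC dehomX0 dehomX1 expr1n mul1r mul_polyC.
apply/polyP => k; rewrite coef_poly; case: ltnP => // hk.
by rewrite nth_default // (leq_trans hr).
Qed.

(** [zeta] sets ['X_0] to [0], so ['X_0] divides [q - zeta q]. Moreover ['X_1 * zeta q] vanishes
    everywhere, the factor ['X_1] covering the excluded value [y = 0]. *)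
Lemma dvd_X0 q : (forall y, y != 0 -> q.@[pt2 0 y] = 0) -> mdvd 'X_0 q.
Proof.
have [zeta [zC zX]] : exists zeta : {rmorphism {mpoly K[2]} -> {mpoly K[2]}},
    (forall c, zeta c%:MP = c%:MP) /\ (forall i, zeta 'X_i = pt2 0 'X_1 i).
  exists (GRing.RMorphism.clone _ _ (mmap (@mpolyC 2 K) (pt2 0 'X_1)) _).
  by split=> [c|i] /=; rewrite ?mmapC // mmapX mmap1U.
have hz (r : {mpoly K[2]}) : exists s, r - zeta r = s * 'X_0.
  elim/mpoly_ring_ind: r => [c|i|r s [r1 h1] [s1 h2]|r s [r1 h1] [s1 h2]].
  - by exists 0; rewrite zC subrr mul0r.
  - rewrite zX /pt2; case: (ord2P i) => -> /=.
      by exists 1; rewrite subr0 mul1r.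
    by exists 0; rewrite subrr mul0r.
  - by exists (r1 + s1); rewrite mulrDl -h1 -h2 rmorphD /=; ring.
  exists (r1 * s + zeta r * s1); rewrite rmorphM /=.
  transitivity ((r - zeta r) * s + zeta r * (s - zeta s)); first by ring.
  by rewrite h1 h2; ring.
move=> hq; have [s hs] := hz q; exists s; rewrite -hs.
suff -> : zeta q = 0 by rewrite subr0.
have X10 : 'X_1 != 0 :> {mpoly K[2]} by rewrite -msize_poly_eq0 msizeX.
apply: (mulfI X10); rewrite mulr0; apply/eqP/negPn/negP => /(mpoly_nonroot char0)[v].
rewrite mevalM mevalXU mulf_eq0 negb_or => /andP[v1].
suff -> : (zeta q).@[v] = q.@[pt2 0 (v 1)] by rewrite hq ?eqxx.
suff h : meval v \o zeta =1 meval (pt2 0 (v 1)) by apply: h.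
apply: mpoly_rmorph_eq => [c|i] /=; first by rewrite zC !mevalC.
by rewrite zX mevalXU /pt2; case: ifP => _; rewrite ?meval0 ?mevalXU.
Qed.

Lemma X0_cancel n l (a b : {mpoly K[2]}) :
  a * 'X_1 ^+ l = b * 'X_0 ^+ n -> mdvd ('X_0 ^+ n) a.
Proof.
elim: n a b => [|n IH] a b e; first by exists a; rewrite mulr1.
have [a1 ea] : mdvd 'X_0 a.
  apply: dvd_X0 => y y0.
  have := congr1 (meval (pt2 0 y)) e; rewrite !mevalM !rmorphXn /= !mevalXU /pt2 /=.
  rewrite exprS mul0r mulr0 => /eqP; rewrite mulf_eq0 expf_eq0 (negbTE y0) andbF orbF.
  by move/eqP.
have X00 : 'X_0 != 0 :> {mpoly K[2]} by rewrite -msize_poly_eq0 msizeX.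
have [|c ec] := IH a1 b.
  by apply: (mulIf X00); rewrite mulrAC -ea e exprSr mulrA.
by exists c; rewrite ea ec exprSr mulrA.
Qed.
End BinaryForms.
Arguments dehom {K} _.

Section Content.
Variable K : closedFieldType.
Hypothesis char0 : [pchar K] =i pred0.
Local Notation dinf := (mmap polyC (line_pt true (0 : K) 1)).

Lemma line_pt_dehom a (q : {mpoly K[2]}) e s :
  mmap polyC (line_pt false 1 a) q = 'X^e * s ->
  exists2 s', dehom q = ('X - a%:P) ^+ e * s' & s'.[a] = s.[0].
Proof.
move=> h; exists (s \Po ('X - a%:P)); last first.
  by rewrite horner_comp !hornerE subrr.
have -> : dehom q = mmap polyC (line_pt false 1 a) q \Po ('X - a%:P).
  suff hh : dehom =1 comp_poly ('X - a%:P) \o mmap polyC (line_pt false 1 a) by apply: hh.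
  apply: mpoly_rmorph_eq => [c|i] /=; first by rewrite mmapC dehomC comp_polyC.
  rewrite mmapX mmap1U /line_pt; case: (ord2P i) => -> /=.
    by rewrite dehomX0 addr0 comp_polyC.
  by rewrite dehomX1 comp_polyD comp_polyC comp_polyX addrC subrK.
by rewrite h comp_polyM rmorphXn /= comp_polyX.
Qed.

Lemma coef_dehom (q : {mpoly K[2]}) k :
  (dehom q)`_k = \sum_(m <- msupp q | m 1%R == k) q@_m.
Proof.
rewrite /dehom /mmap coef_sum [RHS]big_mkcond; apply: eq_bigr => m _.
rewrite /mmap1 !big_ord_recl big_ord0 mulr1.
have -> : lift ord0 ord0 = 1 :> 'I_2 by apply/val_inj.
rewrite /pt2 /= expr1n mul1r coefCM coefXn eq_sym.
by case: eqP; rewrite ?mulr1 ?mulr0.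
Qed.

Lemma coef_dinf (q : {mpoly K[2]}) k :
  (dinf q)`_k = \sum_(m <- msupp q | m 0%R == k) q@_m.
Proof.
rewrite /mmap coef_sum [RHS]big_mkcond; apply: eq_bigr => m _.
rewrite /mmap1 !big_ord_recl big_ord0 mulr1.
have -> : lift ord0 ord0 = 1 :> 'I_2 by apply/val_inj.
rewrite /line_pt /= addr0 add0r expr1n mulr1 coefCM coefXn eq_sym.
by case: eqP; rewrite ?mulr1 ?mulr0.
Qed.

(** The two dehomogenizations of a form of degree [N] have the same coefficients in reverse order,
    so vanishing to order [e] at infinity lowers the degree by [e]. *)
Lemma size_dehom N (q : {mpoly K[2]}) e s : q \is N.-homog -> dinf q = 'X^e * s ->
  (size (dehom q) <= N.+1 - e)%N.
Proof.
move=> hq hs; apply/leq_sizeP => j hj; rewrite coef_dehom.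
have [jN|jN] := leqP j N; last first.
  rewrite big_seq_cond big1 // => m /andP[hm /eqP mj].
  have := mdeg_homog hq hm; rewrite mdeg2 mj; lia.
transitivity ((dinf q)`_(N - j)); last first.
  by rewrite hs coefXnM; case: ltnP => // h; have := hj; lia.
rewrite coef_dinf big_seq_cond [RHS]big_seq_cond; apply: eq_bigl => m.
have [hm|] := boolP (m \in msupp q) => //=.
have := mdeg_homog hq hm; rewrite mdeg2 => e1; apply/eqP/eqP; lia.
Qed.

Lemma prod_XsubC_dvd (L : seq K) (e : K -> nat) (r : {poly K}) : uniq L ->
  (forall a, a \in L -> ('X - a%:P) ^+ e a %| r) ->
  \prod_(a <- L) ('X - a%:P) ^+ e a %| r.
Proof.
elim: L => [|a L IH]; first by rewrite big_nil dvd1p.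
rewrite /= => /andP[aL uL] h; rewrite big_cons Gauss_dvdp.
  rewrite h ?mem_head //=; apply: IH => // b hb; apply: h; by rewrite inE hb orbT.
apply: coprimep_expl; elim: L {IH h uL} aL => [|b L IH]; first by rewrite big_nil coprimep1.
rewrite inE negb_or big_cons coprimepMr => /andP[ab /IH ->]; rewrite andbT.
apply: coprimep_expr; rewrite coprimep_XsubC rootE hornerXsubC.
by rewrite subr_eq0 eq_sym.
Qed.

Variables (R : {mpoly {mpoly K[2]}[4]}) (N : nat) (L : seq K) (e : K -> nat) (einf : nat).
Hypotheses (hR : xhomog N R) (uL : uniq L).
Hypothesis hfin : forall a, a \in L ->
  (forall m, exists s, mmap polyC (line_pt false 1 a) R@_m = 'X^(e a) * s) /\
  exists m s, mmap polyC (line_pt false 1 a) R@_m = 'X^(e a) * s /\ s.[0] != 0.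
Hypothesis hinf : (forall m, exists s, dinf R@_m = 'X^einf * s) /\
  exists m s, dinf R@_m = 'X^einf * s /\ s.[0] != 0.
Hypothesis hoff : forall a, a \notin L -> exists m, (R@_m).@[pt2 1 a] != 0.

Let E := (einf + \sum_(a <- L) e a)%N.
Let gam : {poly K} := \prod_(a <- L) ('X - a%:P) ^+ e a.
Let C : {mpoly K[2]} := 'X_0 ^+ einf * \prod_(a <- L) ('X_1 - a%:MP * 'X_0) ^+ e a.

Let C_homog : C \is E.-homog.
Proof.
apply: dhomogM; first exact: homogXi.
elim: L => [|a l IH]; first by rewrite !big_nil; apply: dhomog1.
rewrite !big_cons; apply: dhomogM => //.
have h : ('X_1 - a%:MP * 'X_0 : {mpoly K[2]}) \is 1.-homog.
  apply: rpredB; first by have := homogXi K 1 1; rewrite expr1.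
  by rewrite mul_mpolyC; apply: dhomogZ; have := homogXi K 1 0; rewrite expr1.
by have := dhomogMn (e a) h; rewrite mul1n.
Qed.

Let dehom_C : dehom C = gam.
Proof.
rewrite /C rmorphM rmorphXn /= dehomX0 expr1n mul1r rmorph_prod.
apply: eq_bigr => a _; rewrite rmorphXn rmorphB rmorphM /=.
by rewrite dehomX1 dehomX0 dehomC mulr1.
Qed.

Let size_gam : size gam = (\sum_(a <- L) e a).+1.
Proof.
rewrite /gam; elim: L => [|a l IH]; first by rewrite !big_nil size_poly1.
rewrite !big_cons size_Mmonic ?IH; last by rewrite monic_prod // => b _; rewrite monic_exp ?monicXsubC.
  by rewrite size_exp_XsubC addnS.
by rewrite monic_neq0 // monic_exp ?monicXsubC.
Qed.

Let C0 : C != 0.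
Proof.
apply/eqP => e0; have : dehom C = 0 by rewrite e0 rmorph0.
by rewrite dehom_C => /eqP; rewrite -size_poly_eq0 size_gam.
Qed.

(** The finite orders make [gam] divide [dehom R@_m]; the order at infinity bounds the degree of the
    quotient, which therefore homogenizes in degree [N - E]. *)
Let quotient_form m : R@_m != 0 ->
  exists psi, [/\ R@_m = C * psi, psi \is (N - E).-homog & (E <= N)%N].
Proof.
move=> Rm0; have [sinf hsinf] := hinf.1 m.
have nz : dehom R@_m != 0 by apply: contra_neq Rm0 => /(dehom_inj char0 (hR m)).
have /dvdpP[t ht] : gam %| dehom R@_m.
  apply: prod_XsubC_dvd => // a aL; have [s /line_pt_dehom[s' -> _]] := (hfin aL).1 m.
  exact: dvdp_mulr.
have t0 : t != 0 by apply: contraNneq nz => e0; rewrite ht e0 mul0r.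
have g0 : gam != 0 by rewrite -size_poly_eq0 size_gam.
have st : (size t + E <= N.+1)%N.
  have aux x y z n : (0 < x -> (x + y.+1).-1 <= n.+1 - z -> x + (z + y) <= n.+1)%N by lia.
  apply: aux; first by rewrite size_poly_gt0.
  by have := size_dehom (hR m) hsinf; rewrite ht size_mul // size_gam.
have EN : (E <= N)%N.
  have aux x y n : (0 < x -> x + y <= n.+1 -> y <= n)%N by lia.
  by apply: aux st; rewrite size_poly_gt0.
have [psi hpsi epsi] : exists2 psi, psi \is (N - E).-homog & dehom psi = t.
  apply: dehom_surj; have aux x y n : (y <= n -> x + y <= n.+1 -> x <= (n - y).+1)%N by lia.
  exact: aux.
exists psi; split=> //; apply/eqP; rewrite -subr_eq0; apply/eqP/(dehom_inj char0 (d := N)).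
  apply: rpredB; first exact: hR.
  by rewrite -(subnKC EN); apply: dhomogM.
by rewrite rmorphB rmorphM /= dehom_C epsi ht mulrC subrr.
Qed.

Let msize_C : E = (msize C).-1.
Proof. exact: dhomog_uniq C0 C_homog (dhomog_msize C_homog). Qed.

Let dvd_R m : mdvd C R@_m.
Proof.
have [->|Rm0] := eqVneq R@_m 0; first by exists 0; rewrite mul0r.
by have [psi [-> _ _]] := quotient_form Rm0; exists psi; rewrite mulrC.
Qed.

(** The cofactors [psi m] have no common zero on the projective line. From this an arbitrary common
    divisor [D] is shown to divide [C] times a power of ['X_0] and also [C] times a power of ['X_1],
    hence [C]. *)
Let max_dvd D : (forall m, mdvd D R@_m) -> mdvd D C.
Proof.
move=> hD.
have [psi ht] : exists psi : 'X_{1..4} -> {mpoly K[2]}, forall m, R@_m != 0 ->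
    R@_m = C * psi m /\ psi m \is (N - E).-homog.
  have [m|f hf] := @seq_choice _ _ (fun m q => R@_m = C * q /\ q \is (N - E).-homog)
    (msupp R) (0 : {mpoly K[2]}).
    by rewrite mcoeff_msupp => /quotient_form[q [h1 h2 _]]; exists q.
  by exists f => m hm; apply: hf; rewrite mcoeff_msupp.
pose t m := dehom (psi m).
(* These [u] form an ideal, since sums can be homogenized after adjusting degrees by powers of
   ['X_0]. It contains every [t m], so a Bezout relation will put [1] in it. *)
pose good (u : {poly K}) := exists n U, [/\ U \is n.-homog, dehom U = u & mdvd D (C * U)].
have good1 : good 1.
  have [h [c [c0 hd hI]]] := Bezout_seq [seq t m | m <- msupp R].
  (* A root of [h] would be a common zero of the [t m]: on [L] this contradicts the minimality of
     [e], off [L] it contradicts [hoff]. *)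
  have [b b0 eb] : exists2 b, b != 0 & h = b%:P.
    apply/size_poly1P/negPn/negP => /closed_rootP[z hz].
    have tz m : R@_m != 0 -> (t m).[z] = 0.
      move=> hm; apply/eqP; rewrite -rootE; apply: root_dvdp hz.
      by apply/hd/map_f; rewrite mcoeff_msupp.
    have eT m : R@_m != 0 -> dehom R@_m = gam * t m.
      by move=> hm; have [e1 _] := ht m hm; rewrite {1}e1 rmorphM /= dehom_C.
    have [zL|zL] := boolP (z \in L).
      have [m [s [/line_pt_dehom[s' es' s'z] s0]]] := (hfin zL).2.
      have Rm0 : R@_m != 0.
        apply: contraNneq s0 => e0; rewrite -s'z; move: es'; rewrite e0 rmorph0 => /esym/eqP.
        by rewrite mulf_eq0 expf_eq0 polyXsubC_eq0 andbF /= => /eqP ->; rewrite horner0.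
      case/negP: s0; rewrite -s'z; apply/eqP.
      have nzX : ('X - z%:P) ^+ e z != 0 :> {poly K} by rewrite expf_neq0 // polyXsubC_eq0.
      have -> : s' = (\prod_(a <- rem z L) ('X - a%:P) ^+ e a) * t m.
        by apply: (mulfI nzX); rewrite -es' eT // /gam (big_rem z zL) /= mulrA.
      by rewrite hornerM tz ?mulr0.
    have [m hm] := hoff zL; case/negP: (hm); apply/eqP.
    have Rm0 : R@_m != 0 by apply: contraNneq hm => ->; rewrite meval0.
    by rewrite -dehom_horner eT // hornerM tz ?mulr0.
  have goodI : good (c *: h).
    apply: hI => [u v [n1 [U1 [hU1 dU1 [q1 hq1]]]] [n2 [U2 [hU2 dU2 [q2 hq2]]]]
                 |a u [n [U [hU dU [q hq]]]]||q].
    - exists (n2 + n1)%N, ('X_0 ^+ n2 * U1 + 'X_0 ^+ n1 * U2); split.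
      + apply: rpredD; first by apply: dhomogM => //; apply: homogXi.
        by rewrite addnC; apply: dhomogM => //; apply: homogXi.
      + by rewrite rmorphD !rmorphM !rmorphXn /= dehomX0 !expr1n !mul1r dU1 dU2.
      exists ('X_0 ^+ n2 * q1 + 'X_0 ^+ n1 * q2).
      transitivity ('X_0 ^+ n2 * (C * U1) + 'X_0 ^+ n1 * (C * U2)); first by ring.
      by rewrite hq1 hq2; ring.
    - have [A hA dA] := @dehom_surj _ _ a (leqnSn (size a)).
      exists (size a + n)%N, (A * U); split; first exact: dhomogM.
        by rewrite rmorphM /= dA dU.
      by exists (A * q); rewrite mulrCA hq; ring.
    - by exists 0%N, 0; split; [apply: rpred0|rewrite rmorph0|exists 0; rewrite mulr0 mul0r].
    case/mapP => m hm ->; have Rm0 : R@_m != 0 by rewrite -mcoeff_msupp.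
    have [eR hh] := ht m Rm0; exists (N - E)%N, (psi m); split=> //.
    by rewrite -eR; apply: hD.
  have [n [U [hU dU [q hq]]]] := goodI.
  exists n, ((c * b)^-1 *: U); split; first exact: dhomogZ.
    rewrite -mul_mpolyC rmorphM /= dehomC dU eb -mul_polyC -!polyCM.
    by rewrite mulVf // mulf_neq0.
  by exists ((c * b)^-1 *: q); rewrite -scalerAr hq scalerAl.
have [n [U [hU dU [q1 hq1]]]] := good1.
have eU : U = 'X_0 ^+ n.
  apply/eqP; rewrite -subr_eq0; apply/eqP/(dehom_inj char0 (d := n)).
    by apply: rpredB => //; apply: homogXi.
  by rewrite rmorphB rmorphXn /= dehomX0 expr1n dU subrr.
have [m [s [hs s0]]] := hinf.2.
have Rm0 : R@_m != 0.
  apply: contraNneq s0 => e0; move: hs; rewrite e0 rmorph0 => /esym/eqP.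
  by rewrite mulf_eq0 expf_eq0 polyX_eq0 andbF /= => /eqP ->; rewrite horner0.
have [Rpsi hpsi] := ht m Rm0.
pose b := (psi m).@[pt2 0 1].
have b0 : b != 0.
  have dX0 : dinf 'X_0 = 'X by rewrite mmapX mmap1U /line_pt /= add0r.
  have dX1 : dinf 'X_1 = 1 by rewrite mmapX mmap1U /line_pt /= addr0.
  have nzX : 'X^einf != 0 :> {poly K} by rewrite expf_neq0 // polyX_eq0.
  have es : s = dinf (\prod_(a <- L) ('X_1 - a%:MP * 'X_0) ^+ e a) * dinf (psi m).
    by apply: (mulfI nzX); rewrite -hs Rpsi /C !rmorphM rmorphXn /= dX0 mulrA.
  apply: contraNneq s0 => e0; rewrite es hornerM.
  have -> : (dinf (psi m)).[0] = b.
    suff h : horner_eval 0 \o dinf =1 meval (pt2 0 1) by apply: h.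
    apply: mpoly_rmorph_eq => [c|i] /=; first by rewrite mmapC mevalC /horner_eval hornerC.
    rewrite mmapX mmap1U mevalXU /horner_eval /line_pt /pt2.
    by case: ifP => _; rewrite !hornerE.
  by rewrite e0 mulr0.
pose k := (N - E)%N.
have [g hg] : mdvd 'X_0 (psi m - b *: 'X_1 ^+ k).
  apply: dvd_X0 => // y y0; rewrite mevalB mevalZ rmorphXn /= mevalXU /pt2 /=.
  have -> : (psi m).@[pt2 0 y] = y ^+ k * b.
    rewrite -(meval_homog _ _ hpsi); apply: meval_eq => i.
    by rewrite /pt2; case: ifP; rewrite ?mulr0 ?mulr1.
  by rewrite mulrC subrr.
have [q2 hq2] : mdvd D (C * 'X_1 ^+ (k * n)).
  have [q hq] := hD m.
  (* Since [psi m = b 'X_1^k + g 'X_0], the [n]-th power of [b 'X_1^k] is a multiple of [psi m] plus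
     one of ['X_0^n]; after multiplication by [C] both are divisible by [D]. *)
  pose T := \sum_(i < n) (b *: 'X_1 ^+ k) ^+ (n.-1 - i) * (- (g * 'X_0)) ^+ i.
  have e1 : (b *: 'X_1 ^+ k) ^+ n = psi m * T + (- g) ^+ n * 'X_0 ^+ n.
    have /eqP := subrXX (b *: 'X_1 ^+ k) (- (g * 'X_0)) n; rewrite subr_eq => /eqP ->.
    congr (_ * _ + _); first by rewrite opprK -hg addrC subrK.
    by rewrite -exprMn mulNr.
  exists ((b ^+ n)^-1 *: (q * T + (- g) ^+ n * q1)).
  rewrite -scalerAl mulrDl.
  have -> : q * T * D + (- g) ^+ n * q1 * D = C * (b *: 'X_1 ^+ k) ^+ n.
    rewrite e1 mulrDr [C * (psi m * T)]mulrA -Rpsi hq [C * _]mulrCA -eU hq1; ring.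
  rewrite exprZn -exprM scalerAr scalerA mulVf ?scale1r //.
  by rewrite expf_neq0.
have D0 : D != 0.
  apply: contraNneq C0 => e0; have [q hq] := hD m; move: hq.
  by rewrite e0 mulr0 => e1; rewrite e1 eqxx in Rm0.
have XE : q1 * 'X_1 ^+ (k * n) = q2 * 'X_0 ^+ n.
  by apply: (mulfI D0); rewrite !mulrA ![D * _]mulrC -hq1 -hq2 eU; ring.
have [q3 hq3] := X0_cancel char0 XE.
exists q3; apply: (mulIf (expf_neq0 n (_ : 'X_0 != 0 :> {mpoly K[2]}))).
  by rewrite -msize_poly_eq0 msizeX.
by rewrite -eU hq1 hq3 eU mulrAC.
Qed.

Lemma content_exists : exists2 C : {mpoly K[2]}, is_content_x R C & E = deg_t C.
Proof. by exists C; [split; [exact: dvd_R | exact: max_dvd] | exact: msize_C]. Qed.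
End Content.

(** * Lines through (0 : 0 : 1) *)

Section Lines.
Variables (K : closedFieldType) (p : 'I_4 -> {mpoly K[3]}) (d : nat).
Hypotheses (char0 : [pchar K] =i pred0).
Hypotheses (hhom : forall i, p i \is d.-homog) (hp001 : forall i, (p i).@[e3 K] != 0).

Definition on_base (x y c : K) : Prop := forall i, (p i).@[pt3 x y c] = 0.

Lemma pt3_scale (l x y z : K) : (fun i => l * pt3 x y z i) =1 pt3 (l * x) (l * y) (l * z).
Proof. by move=> i; rewrite /pt3; case: ifP => _ //; case: ifP. Qed.

Lemma on_base_scale l x y c : on_base x y c -> on_base (l * x) (l * y) (l * c).
Proof.
move=> h i; have := meval_homog l (pt3 x y c) (hhom i); rewrite h mulr0 => <-.
by apply: meval_eq => j; rewrite pt3_scale.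
Qed.

(** At [s = b] the moving line carries no base point, so [Ures_neq0] applies to the
    specialization. *)
Lemma line_res_neq0 sw x y b :
  (forall c, ~ on_base (x + (if sw then b else 0)) (y + (if sw then 0 else b)) c) ->
  line_res p sw x y != 0.
Proof.
set x' := x + _; set y' := y + _ => hb.
pose q i := tsub idfun x' y' (p i).
have qd i : (q i)`_d = (p i).@[e3 K] by rewrite /q lead_tsub.
have sq i : size (q i) = d.+1.
  have h : (q i)`_d != 0 by rewrite qd; apply: hp001.
  by have [] := coef_lead (size_tsub _ _ _ (hhom i)) h.
have U0 : Ures q != 0.
  apply: (Ures_neq0 char0 sq) => c; apply/existsP; rewrite -negb_forall; apply/negP => /forallP h.
  by apply: (hb c) => i; rewrite -horner_tsub_id; apply/eqP/h.
pose h := @mpolyC (4 + 4) K \o horner_eval b.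
have hq i : map_poly h (lsub sw x y (p i)) = map_poly (@mpolyC (4 + 4) K) (q i).
  rewrite lsub.unlock !map_tsub /h /=.
  have -> : horner_eval b (x%:P + (if sw then 'X else 0)) = x'.
    by rewrite /horner_eval /x' hornerD hornerC; case: (sw); rewrite ?hornerX ?horner0.
  have -> : horner_eval b (y%:P + (if sw then 0 else 'X)) = y'.
    by rewrite /horner_eval /y' hornerD hornerC; case: (sw); rewrite ?hornerX ?horner0.
  by apply: eq_tsub => c /=; rewrite /horner_eval hornerC.
have hn (v : 'I_4 -> 'I_(4 + 4)) : injective v ->
    \sum_(i < 4) 'X_(v i) * h (lsub sw x y (p i))`_d != 0.
  move=> vi; apply: contra_neq (hp001 0) => /(congr1 (meval (fun j => (j == v 0)%:R))).
  rewrite meval0 raddf_sum (bigD1 0) //= big1 => [|i i0]; rewrite mevalM mevalXU.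
    by rewrite eqxx mul1r addr0 lead_lsub // /h /= mevalC /horner_eval hornerC.
  by rewrite (inj_eq vi) (negbTE i0) mul0r.
have := @Ures_spec _ _ h (fun j => 'X_j) _ d (fun i => size_lsub sw x y (hhom i))
  (hn _ (@lshift_inj 4 4)) (hn _ (@rshift_inj 4 4)).
rewrite -/(line_res p sw x y) => e; apply: contraNneq U0 => e0.
rewrite e0 rmorph0 in e; rewrite /Ures e; apply/eqP.
by congr resultant; apply: eq_bigr => i _; rewrite hq.
Qed.

Lemma base_seq x y : exists2 cs : seq K, uniq cs & forall c, c \in cs <-> on_base x y c.
Proof.
pose q := tsub idfun x y (p ord_max).
have q0 : q != 0.
  apply: contra_neq (hp001 ord_max) => /polyP/(_ d); rewrite lead_tsub // coef0.
  by [].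
have [rs hrs] := closed_field_poly_normal q.
exists [seq c <- undup rs | [forall i, (p i).@[pt3 x y c] == 0]].
  by rewrite filter_uniq // undup_uniq.
move=> c; rewrite mem_filter; split=> [/andP[/forallP h _] i|h]; first exact/eqP.
apply/andP; split; first by apply/forallP => i; rewrite h.
rewrite mem_undup -root_prod_XsubC; have : root q c.
  by rewrite rootE horner_tsub_id h.
by rewrite hrs rootZ // lead_coef_eq0.
Qed.
End Lines.

(* The line through [(0 : 0 : 1)] of direction [(1 : a)] for [Some a], [(0 : 1)] for [None]. *)
Definition line_sw (K : Type) (l : option K) : bool := if l is Some _ then false else true.
Definition line_x (K : nzRingType) (l : option K) : K := if l is Some _ then 1 else 0.
Definition line_y (K : nzRingType) (l : option K) : K := if l is Some a then a else 1.
Definition line_point (K : nzRingType) (lc : option K * K) : 'I_3 -> K :=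
  pt3 (line_x lc.1) (line_y lc.1) lc.2.

Lemma line_chart (F : fieldType) (K : closedFieldType) (f : {rmorphism K -> F}) l c :
  chart (pt3 (f (line_x l)) (f (line_y l)) c) = lchart (line_sw l).
Proof.
by rewrite chart_pt3; case: l => [a|] /=; rewrite ?rmorph1 ?rmorph0 ?oner_neq0 ?eqxx.
Qed.

Lemma line_point_inj (K : fieldType) (A B : option K * K) :
  proportional (line_point A) (line_point B) -> A = B.
Proof.
case=> l l0 h; have := h (inord 0); have := h (inord 1); have := h (inord 2).
rewrite /line_point /pt3 !inordK //=; case: A B {h} => [[a|] c] [[a'|] c'] /=.
- by move=> e2 e1; rewrite mulr1 => e0; move: e2 e1; rewrite -e0 !mul1r => -> ->.
- by move=> _ _ /eqP; rewrite mulr1 eq_sym (negbTE l0).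
- by move=> _ _ /eqP; rewrite mulr0 oner_eq0.
by move=> e2; rewrite mulr1 => e1 _; move: e2; rewrite -e1 mul1r => ->.
Qed.

Section MultBase.
Variables (K F : closedFieldType) (iota : {rmorphism {mpoly K[4 + 4]} -> F}).
Variables (p : 'I_4 -> {mpoly K[3]}) (d : nat).
Hypotheses (hhom : forall i, p i \is d.-homog) (hp001 : forall i, (p i).@[e3 K] != 0).

(** Scaling by the first nonzero one of its first two coordinates puts each base point on exactly
    one listed line; the point [(0 : 0 : 1)], where both vanish, is not a base point. *)
Lemma mult_baseP (lines : seq (option K)) (cs : option K -> seq K) (m : option K -> K -> nat) :
  uniq lines -> None \in lines ->
  (forall a c, on_base p 1 a c -> Some a \in lines) ->
  (forall l, l \in lines -> uniq (cs l)) ->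
  (forall l c, l \in lines -> c \in cs l <-> on_base p (line_x l) (line_y l) c) ->
  (forall l c, l \in lines -> c \in cs l ->
     int_mult (W1 iota p) (W2 iota p) (fun j => kF iota (line_point (l, c) j)) (m l c)) ->
  mult_base iota p (\sum_(l <- lines) \sum_(c <- cs l) m l c)%N.
Proof.
move=> ul hN hS ucs hcs hm.
pose P := [seq (l, c) | l <- lines, c <- cs l].
have uP : uniq P by apply: allpairs_uniq_dep => // -[? ?] [? ?] _ _ /= [-> ->].
have memP l c : (l, c) \in P <-> l \in lines /\ c \in cs l.
  split=> [/allpairsPdep[l' [c' [h1 h2 [-> ->]]]] //|[h1 h2]].
  by apply/allpairsPdep; exists l, c.
have nthP i : (i < size P)%N -> nth (fun=> 0) (map (@line_point K) P) i
    = line_point (nth (None, 0) P i) by move=> h; rewrite (nth_map (None, 0)).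
exists (map (@line_point K) P); rewrite size_map; split; [|split; [|split]].
- move=> i hi; rewrite nthP //; case E : (nth _ _ _) (mem_nth (None, 0) hi) => [l c].
  case/memP => hl hc; split; last exact/hcs.
  exists (if l is Some _ then inord 0 else inord 1); rewrite /line_point /pt3.
  by case: (l) => [a|] /=; rewrite inordK //= oner_neq0.
- move=> i j hi hj ij; rewrite !nthP // => /line_point_inj/eqP.
  by rewrite nth_uniq // (negbTE ij).
- move=> B [[j0 hj0] hB].
  have hB3 : B =1 pt3 (B (inord 0)) (B (inord 1)) (B (inord 2)).
    move=> i; rewrite /pt3; case: ifP => [/eqP i0|i0].
      by congr B; apply/val_inj; rewrite /= inordK.
    case: ifP => [/eqP i1|i1]; congr B; apply/val_inj; rewrite /= inordK //.
    by case: i i0 i1 => [[|[|[|]]]].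
  have bB : on_base p (B (inord 0)) (B (inord 1)) (B (inord 2)).
    by move=> i; rewrite -(hB i); apply: meval_eq => j; rewrite -hB3.
  have fin l c b : b != 0 -> (l, c) \in P -> B =1 (fun j => b * line_point (l, c) j) ->
      exists2 i, (i < size P)%N & proportional (nth (fun=> 0) (map (@line_point K) P) i) B.
    move=> b0 hP eB; exists (index (l, c) P); first by rewrite index_mem.
    by rewrite nthP ?index_mem // nth_index //; exists b.
  have [B0|B0] := eqVneq (B (inord 0)) 0; last first.
    have hb : on_base p 1 (B (inord 1) / B (inord 0)) (B (inord 2) / B (inord 0)).
      have := on_base_scale hhom (B (inord 0))^-1 bB.
      by rewrite mulVf // ![_^-1 * _]mulrC.
    apply: (fin (Some (B (inord 1) / B (inord 0))) (B (inord 2) / B (inord 0)) _ B0).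
      have hl := hS _ _ hb; apply/memP; split=> //; exact/hcs.
    by move=> j; rewrite pt3_scale mulr1 !mulrA ![B (inord 0) * _]mulrC !mulfK // hB3.
  have [B1|B1] := eqVneq (B (inord 1)) 0; last first.
    have hb : on_base p 0 1 (B (inord 2) / B (inord 1)).
      have := on_base_scale hhom (B (inord 1))^-1 bB.
      by rewrite B0 mulr0 mulVf // ![_^-1 * _]mulrC.
    apply: (fin None (B (inord 2) / B (inord 1)) _ B1).
      apply/memP; split=> //; exact/hcs.
    by move=> j; rewrite pt3_scale mulr1 mulr0 mulrA ![B (inord 1) * _]mulrC !mulfK // hB3 B0.
  exfalso; have B2 : B (inord 2) != 0.
    by apply: contraNneq hj0 => e; rewrite hB3 B0 B1 e /pt3; case: ifP => // _; case: ifP.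
  have /eqP := bB 0; rewrite B0 B1.
  have -> : (p 0).@[pt3 0 0 (B (inord 2))] = B (inord 2) ^+ d * (p 0).@[e3 K].
    rewrite -(meval_homog _ _ (hhom 0)); apply: meval_eq => j; rewrite /pt3 /e3.
    by case: j => [[|[|[|]]]] //= hj; rewrite ?mulr0 ?mulr1.
  by rewrite mulf_eq0 expf_eq0 (negbTE B2) andbF (negbTE (hp001 0)).
exists [seq m lc.1 lc.2 | lc <- P]; rewrite !size_map; split=> //; split.
  move=> i hi; rewrite nthP // (nth_map (None, 0)) //.
  case E : (nth _ _ _) (mem_nth (None, 0) hi) => [l c] /memP[hl hc]; exact: hm.
by rewrite sumnE big_map /P big_allpairs_dep.
Qed.
End MultBase.

(** * Generic matrices and assembly *)

Lemma meval_mx_coords (K : comNzRingType) (M : 'M[K]_3) i j :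
  ('X_(mxvec_index i j) : {mpoly K[3 * 3]}).@[mx_coords M] = M i j.
Proof. by rewrite mevalXU /mx_coords mxvecE. Qed.

Section Generic.
Variable K : closedFieldType.
Hypothesis char0 : [pchar K] =i pred0.

Lemma generic_unitmx (h : {mpoly K[3 * 3]}) : h != 0 ->
  exists2 M : 'M[K]_3, M \in unitmx & h.@[mx_coords M] != 0.
Proof.
move=> h0; pose D : {mpoly K[3 * 3]} := \det (\matrix_(i, j) 'X_(mxvec_index i j)).
have DE (M : 'M[K]_3) : D.@[mx_coords M] = \det M.
  rewrite /D -det_map_mx; congr (\det _).
  by apply/matrixP => i j; rewrite mxE mxE /= meval_mx_coords.
have D0 : D != 0.
  apply: contra_neq (oner_neq0 K) => /(congr1 (meval (mx_coords 1%:M))).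
  by rewrite DE det1 meval0.
have [v hv] := mpoly_nonroot char0 (mulf_neq0 h0 D0).
pose M : 'M[K]_3 := vec_mx (\row_i v i).
have eM : v =1 mx_coords M by move=> i; rewrite /mx_coords vec_mxK mxE.
move: hv; rewrite (meval_eq _ eM) mevalM DE mulf_eq0 negb_or => /andP[hM dM].
by exists M => //; rewrite unitmxE unitfE.
Qed.

(** Let [v] be a point where [N] is nonzero. Fixing [x_4 = 1] and taking [x_1], [x_3] from the
    coordinates of [v] attached to [p_4] leaves the six entries of rows 1 and 3 of [M] free to match
    the others, so the composite is a nonzero polynomial in [M]. *)
Lemma generic_wmx (N : {mpoly K[4 + 4]}) : N != 0 ->
  exists2 h : {mpoly K[3 * 3]}, h != 0 &
    forall M : 'M[K]_3, h.@[mx_coords M] != 0 -> exists X, N.@[wmx M idfun X] != 0.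
Proof.
move=> /(mpoly_nonroot char0)[v hv].
pose X (i : 'I_4) : K := if i == 0 then - v (lshift 4 ord_max)
  else if i == inord 2 then - v (rshift 4 ord_max) else 1.
have i2 : (inord 2 : 'I_4) != 0 by rewrite -val_eqE /= inordK.
have X4 : X ord_max = 1 by rewrite /X -!val_eqE /= inordK.
have X0 : X 0 = - v (lshift 4 ord_max) by rewrite /X eqxx.
have X2 : X (inord 2) = - v (rshift 4 ord_max) by rewrite /X (negbTE i2) eqxx.
pose w (j : 'I_(4 + 4)) : {mpoly K[3 * 3]} := match split j with
  | inl i => if (i < 3)%N then 'X_(mxvec_index 0 (inord i)) else (v (lshift 4 ord_max))%:MP
  | inr i => if (i < 3)%N then 'X_(mxvec_index (inord 2) (inord i))
             else (v (rshift 4 ord_max))%:MP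
  end.
have wE M j : (w j).@[mx_coords M] = wmx M idfun X j.
  rewrite /w /wmx X4 X0 X2; case: (split j) => i; rewrite /wrow; case: ifP => _;
    by rewrite ?meval_mx_coords ?mevalC ?mul1r ?opprK.
exists (N \mPo [tuple w j | j < 4 + 4]).
  pose M : 'M[K]_3 := \matrix_(r, c)
    if r == 0 then v (lshift 4 (inord c)) else v (rshift 4 (inord c)).
  apply: contraNneq hv => /(congr1 (meval (mx_coords M))).
  rewrite comp_mpoly_meval meval0 => e; apply/eqP; rewrite -[RHS]e; apply: meval_eq => j.
  rewrite tnth_mktuple wE /wmx -[j in LHS]splitK.
  case: (split j) => i; rewrite /wrow /= X4 ?X0 ?X2 opprK mul1r; case: ltnP => hi.
  - by rewrite mxE eqxx inordK // inord_val.
  - by congr (v (lshift _ _)); apply/val_inj => /=; have := ltn_ord i; lia.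
  - by rewrite mxE -val_eqE /= !inordK //= inord_val.
  - by congr (v (rshift _ _)); apply/val_inj => /=; have := ltn_ord i; lia.
move=> M; rewrite comp_mpoly_meval => hM; exists X.
by rewrite -(meval_eq _ (_ : (fun i => (tnth [tuple w j | j < 4 + 4] i).@[mx_coords M]) =1 _)) //
  => j; rewrite tnth_mktuple wE.
Qed.
End Generic.

Section Assembly.
Variables (K F : closedFieldType) (iota : {rmorphism {mpoly K[4 + 4]} -> F}).
Variables (p : 'I_4 -> {mpoly K[3]}) (d : nat).
Hypotheses (char0 : [pchar K] =i pred0) (iota_inj : injective iota).
Hypotheses (hhom : forall i, p i \is d.-homog) (hp001 : forall i, (p i).@[e3 K] != 0).

Lemma line_data (rho : {poly K}) l : rho != 0 ->
  (forall a c, on_base p 1 a c -> root rho a) ->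
  exists D : nat * {mpoly {poly K}[4 + 4]} * seq K * (K -> nat),
    [/\ line_res p (line_sw l) (line_x l) (line_y l) = ('X^(D.1.1.1))%:MP * D.1.1.2,
        map_mpoly (horner_eval 0) D.1.1.2 != 0,
        uniq D.1.2,
        forall c, c \in D.1.2 <-> on_base p (line_x l) (line_y l) c &
        D.1.1.1 = (\sum_(c <- D.1.2) D.2 c)%N] /\
    (forall c, c \in D.1.2 ->
      int_mult (W1 iota p) (W2 iota p) (fun j => kF iota (line_point (l, c) j)) (D.2 c)).
Proof.
move=> rho0 hrho.
have [b hb] : exists b, forall c,
    ~ on_base p (line_x l + (if line_sw l then b else 0))
                (line_y l + (if line_sw l then 0 else b)) c.
  (* A nearby line with [rho] nonzero is needed: direction [(1 : t)] is reached by [b = t - a], and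
     from [(0 : 1)] by [b = t^-1], which also requires [t] nonzero. *)
  case: l => [a|] /=.
    have [t ht] := poly_nonroot char0 rho0; exists (t - a) => c.
    by rewrite addr0 addrC subrK => /hrho; apply/negP.
  have [t] := poly_nonroot char0 (mulf_neq0 rho0 (negbT (polyX_eq0 K))).
  rewrite hornerM hornerX mulf_eq0 negb_or => /andP[ht t0]; exists t^-1 => c.
  rewrite add0r addr0 => /(on_base_scale hhom t); rewrite mulfV // mulr1 => /hrho.
  exact/negP.
have [e [R' [hR hR']]] := mpoly_Xval (line_res_neq0 char0 hhom hp001 hb).
have [cs ucs hcs] := base_seq hhom hp001 (line_x l) (line_y l).
have [m hm em] := line_mult char0 iota_inj hhom hp001 (line_chart (kF iota) l) hR hR' ucs
  (fun c hc => (hcs c).2 hc).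
by exists (e, R', cs, m).
Qed.

Lemma mult_base_content (hgcd : mpoly_coprime4 p) :
  exists2 h : {mpoly K[3 * 3]}, h != 0 & forall M : 'M[K]_3, h.@[mx_coords M] != 0 ->
    exists m : nat, mult_base iota p m /\
      exists2 C : {mpoly K[2]}, is_content_x (ResL p M) C & m = deg_t C.
Proof.
have [rho rho0 hrho] := base_finite char0 hgcd hhom hp001.
have [rs hrs] := closed_field_poly_normal rho.
(* A listed line may carry no base point; its exponent is then an empty sum, so it contributes
   nothing to either side. *)
pose L := undup rs; pose lines := None :: map Some L.
have ul : uniq lines.
  by rewrite /= map_inj_uniq ?undup_uniq ?andbT; [apply/mapP => -[] | move=> ? ? []].
have inL a : root rho a -> a \in L.
  by rewrite hrs rootZ ?lead_coef_eq0 // root_prod_XsubC mem_undup.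
have inlines a : (Some a \in lines) = (a \in L).
  by rewrite inE /= mem_map // => ? ? [].
have [D hD] := @seq_choice _ _ _ lines (0%N, 0, [::], fun=> 0%N)
  (fun l _ => line_data l rho0 hrho).
(* One product gathers the conditions of all lines, so a single [X] works for every one of them. *)
pose N := \prod_(l <- lines) map_mpoly (horner_eval 0) (D l).1.1.2.
have N0 : N != 0.
  by rewrite /N big_seq prodf_seq_neq0; apply/allP => l hl; apply/implyP => _; have [[]] := hD l hl.
have [h1 h1n hN] := generic_wmx char0 N0.
have [h2 h2n hav] := avoid_curve hhom hp001 char0.
exists (h1 * h2); first exact: mulf_neq0.
move=> M; rewrite mevalM mulf_eq0 negb_or => /andP[/hN[X hX] hM2].
have hXl l : l \in lines -> (map_mpoly (horner_eval 0) (D l).1.1.2).@[wmx M idfun X] != 0.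
  move=> hl; apply: contra_neq hX => e; rewrite /N (big_rem l) //= mevalM e mul0r //.
have hord l : l \in lines -> _ := fun hl => let: conj H _ := hD l hl in
  let: And5 hR _ _ _ _ := H in ResL_order hhom hp001 hR (hXl l hl).
have [Nd hNd] := ResL_homog M hhom.
exists (\sum_(l <- lines) \sum_(c <- (D l).1.2) (D l).2 c)%N; split.
  apply: (mult_baseP hhom hp001) => //; rewrite ?mem_head //.
  - by move=> a c hb; rewrite inlines; apply/inL/hrho/hb.
  - by move=> l hl; have [[]] := hD l hl.
  - by move=> l c hl; have [[]] := hD l hl.
  - by move=> l c hl; have [_] := hD l hl; apply.
pose e a := (D (Some a)).1.1.1.
have -> : (\sum_(l <- lines) \sum_(c <- (D l).1.2) (D l).2 c
    = (D None).1.1.1 + \sum_(a <- L) e a)%N.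
  transitivity (\sum_(l <- lines) (D l).1.1.1)%N.
    by rewrite big_seq [RHS]big_seq; apply: eq_bigr => l hl; have [[]] := hD l hl.
  by rewrite /lines big_cons big_map.
apply: (content_exists char0 hNd (undup_uniq rs)).
- by move=> a ha; apply: (hord (Some a)); rewrite inlines.
- exact: (hord None (mem_head _ _)).
(* A failure here would, by [avoid_curve], make all four forms vanish at the point, so that [a]
   would be a root of [rho]. *)
move=> a ha; apply: (ResL_off_base char0 hhom hp001) => c e4 e0 e2.
case/negP: ha; apply/inL/(hrho a c).
rewrite !big_ord3 in e0 e2.
have wE (k : nat) : (k < 3)%N -> widen_ord (leqnSn 3) (inord k) = inord k.
  by move=> hk; apply/val_inj; rewrite /= !inordK // ltnW.
rewrite /= !wE // addrA in e0; rewrite /= !wE // addrA in e2.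
have [v0 v1 v2] := hav M hM2 a c e4 e0 e2.
move=> i; have [hi|hi] := ltnP i 3; last first.
  by rewrite (_ : i = ord_max) //; apply/val_inj => /=; have := ltn_ord i; lia.
rewrite -(inord_val i); case: (i : nat) hi => [|[|[|]]] //.
Qed.
End Assembly.

Theorem theorem2p8
  (K : closedFieldType) (charK0 : [pchar K] =i pred0)
  (p : 'I_4 -> {mpoly K[3]}) (d : nat)
  (hhom : forall i, p i \is d.-homog)
  (hgcd : mpoly_coprime4 p)
  (hp4 : p ord_max != 0)
  (hp001 : forall i, (p i).@[e3 K] != 0)
  (F : closedFieldType) (iota : {rmorphism {mpoly K[4 + 4]} -> F})
  (iota_inj : injective iota)
  (F_alg : forall z : F, exists2 q : {poly {mpoly K[4 + 4]}},
             q != 0 & root (map_poly iota q) z) :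
  exists Omega : 'M[K]_3 -> Prop,
    zariski_open_GL3 Omega /\ (exists M, Omega M) /\
    forall M, Omega M ->
      exists m : nat, mult_base iota p m /\
        exists2 C : {mpoly K[2]}, is_content_x (ResL p M) C & m = deg_t C.
Proof.
have [h h0 hM] := mult_base_content charK0 iota_inj hhom hp001 hgcd.
exists (fun M => M \in unitmx /\ h.@[mx_coords M] != 0); split; [split|split].
- by move=> M [].
- exists [:: h] => M uM; split=> [[_ hh]|[h']]; first by exists h; rewrite ?mem_head.
  by rewrite inE => /eqP ->.
- by have [M uM hm] := generic_unitmx charK0 h0; exists M.
by move=> M [_ /hM].
Qed.
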